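(* (Riemann-Roch) Let $F$ be a number field with discriminant $\Delta$ and let $D$ be an Arakelov divisor of $F$. Then $$h^0(D)-h^0(\kappa-D)=\deg(D)-\tfrac12\log|\Delta|,$$ where $\kappa$ is the canonical divisor of $F$.
   Context: Let $F$ be a number field with ring of integers $O_F$. The infinite primes $\sigma$ of $F$ are the real embeddings together with one chosen embedding from each pair of complex conjugate embeddings. An Arakelov divisor of $F$ is a formal finite sum $D=\sum_P x_P P+\sum_\sigma x_\sigma\sigma$, with $P$ running over the nonzero prime ideals of $O_F$, $\sigma$ over the infinite primes, $x_P\in\mathbb{Z}$ (almost all zero) and $x_\sigma\in\mathbb{R}$. Arakelov divisors are added coefficientwise. The degree is $\deg(D)=\sum_P \log(\#(O_F/P))\,x_P+\sum_\sigma x_\sigma$. The fractional ideal associated to $D$ is $I=\prod_P P^{-x_P}$. For $f\in F$ put $$\|f\|_D^2=\sum_{\sigma\text{ real}}|\sigma(f)|^2e^{-2x_\sigma}+\sum_{\sigma\text{ complex}}2|\sigma(f)|^2e^{-x_\sigma}.$$ Put $k^0(D)=\sum_{f\in I}e^{-\pi\|f\|_D^2}$ and $h^0(D)=\log k^0(D)$. The canonical divisor $\kappa$ is the Arakelov divisor whose associated fractional ideal is the inverse $\partial^{-1}$ of the different $\partial$ of $F$ and whose infinite components are all zero (so $\deg\kappa=\log|\Delta|$). *)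

(* Defs.v *)
(* A number field is an F : fieldExtType rat. Complex numbers are R[i] from   *)
(* real-closed; the formal sums {freeg K / int} come from multinomials.       *)
From HB Require Import structures.
From mathcomp Require Import all_boot all_order all_algebra all_field.
From mathcomp Require Import complex.
From mathcomp Require Import finmap freeg.
From mathcomp Require Import all_classical all_reals all_analysis.

Set Implicit Arguments.
Unset Strict Implicit.
Unset Printing Implicit Defensive.

Import Order.TTheory GRing.Theory Num.Theory.

Local Open Scope classical_set_scope.
Local Open Scope ring_scope.

Section IntegersOfNumberField.
Variable F : fieldExtType rat.

Definition is_algint : {pred F} :=
  [pred x | `[< integralOver (intr : int -> F) x >]].

Fact is_algint_subring : subring_closed is_algint.
Proof.
split=> [|x y /asboolP hx /asboolP hy|x y /asboolP hx /asboolP hy];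
  apply/asboolP.
- exact: integral1.
- exact: integral_sub.
- exact: integral_mul.
Qed.

HB.instance Definition _ :=
  GRing.isSubringClosed.Build F is_algint is_algint_subring.

Record ring_of_integers := RingOfIntegers {
  ring_of_integers_val : F;
  _ : ring_of_integers_val \in is_algint }.

HB.instance Definition _ := [isSub for ring_of_integers_val].
HB.instance Definition _ := [Choice of ring_of_integers by <:].
HB.instance Definition _ :=
  [SubChoice_isSubComNzRing of ring_of_integers by <:].

End IntegersOfNumberField.

Section NumberField.
Variable F : fieldExtType rat.
Local Notation O := (ring_of_integers F).

(* idealr_closed includes 1 \notin P.                                         *)
Definition prime_ideals : set (set O) :=
  [set P : set O | [/\ idealr_closed (fun x => x \in P),
                       prime_idealr_closed (fun x => x \in P)
                     & exists2 x, P x & x != 0]].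

(* #(O/P), counting the cosets x + P.                                         *)
Definition residue_card (P : set O) : nat :=
  #|` fset_set (range (fun x : O => [set y | P (y - x)]))|.

(* Fractional ideals are represented by their underlying subsets of F.        *)
Definition unit_ideal : set F := range (val : O -> F).

Definition fracmul (A B : set F) : set F :=
  [set x | exists2 s : seq (F * F),
     (forall ab, ab \in s -> A ab.1 /\ B ab.2)
     & x = \sum_(ab <- s) ab.1 * ab.2].

Definition fracinv (A : set F) : set F :=
  [set x | forall a, A a -> unit_ideal (x * a)].

Definition fracexp (A : set F) (z : int) : set F :=
  match z with
  | Posz n => iter n (fracmul A) unit_ideal
  | Negz n => iter n.+1 (fracmul (fracinv A)) unit_ideal
  end.

Definition field_trace (x : F) : rat :=
  \tr (passmx.mxof (vbasis {:F}) (vbasis {:F}) (amull x)).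

Definition codifferent : set F :=
  [set x | forall y, unit_ideal y -> field_trace (x * y) \is a Num.int].

Definition different : set F := fracinv codifferent.

Definition integral_basis (w : (\dim {:F}).-tuple F) : Prop :=
  basis_of {:F} w /\ forall x, unit_ideal x <-> inIntSpan w x.

(* The value does not depend on the integral basis; 0 is never reached, as    *)
(* integral bases exist.                                                      *)
Definition discriminant : rat :=
  xget 0 [set d | exists2 w : (\dim {:F}).-tuple F, integral_basis w
                  & d = \det (\matrix_(i < \dim {:F}, j < \dim {:F})
                             field_trace (w`_i * w`_j))].

End NumberField.

Arguments prime_ideals F : clear implicits.
Arguments unit_ideal F : clear implicits.
Arguments codifferent F : clear implicits.
Arguments different F : clear implicits.
Arguments discriminant F : clear implicits.

Section ArakelovDivisors.
Variables (R : realType) (F : fieldExtType rat).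

Definition embeddings : set (F -> R[i]) :=
  range (fun s : {rmorphism F -> R[i]} => (s : F -> R[i])).

Definition real_embedding (s : F -> R[i]) : Prop :=
  forall x, complex.Im (s x) = 0.

Definition conj_embedding (s : F -> R[i]) : F -> R[i] := fun x => conjc (s x).

(* Phi consists of all the real embeddings and of exactly one embedding from  *)
(* each pair of conjugate nonreal ones.                                       *)
Definition infinite_primes (Phi : set (F -> R[i])) : Prop :=
  [/\ Phi `<=` embeddings,
      (forall s, embeddings s -> real_embedding s -> Phi s)
    & forall s, embeddings s -> ~ real_embedding s ->
        (Phi s <-> ~ Phi (conj_embedding s))].

Section FixedInfinitePrimes.
Variable Phi : set (F -> R[i]).

(* The finite part is the formal sum of the x_P P; the infinite part is the   *)
(* family of the x_s. The group structure is the one of the product.          *)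
Definition arakelov_divisor : Type :=
  ({freeg (prime_ideals F) / int} * (Phi -> R))%type.

HB.instance Definition _ := GRing.Zmodule.on arakelov_divisor.

Implicit Type D : arakelov_divisor.

Definition degree D : R :=
  \sum_(P <- dom D.1) ln (residue_card (val P))%:R * (coeff P D.1)%:~R
  + \sum_(s \in [set: Phi]) D.2 s.

Definition ideal_of D : set F :=
  \big[@fracmul F / unit_ideal F]_(P <- dom D.1)
     fracexp [set val x | x in val P] (- coeff P D.1).

Definition sqnorm D (f : F) : R :=
  \sum_(s \in [set s : Phi | real_embedding (val s)])
     Normc.normc (val s f) ^+ 2 * expR (- 2 * D.2 s)
  + \sum_(s \in [set s : Phi | ~ real_embedding (val s)])
     2 * Normc.normc (val s f) ^+ 2 * expR (- D.2 s).

(* k0 and h0 take values in \bar R: k0 D = +oo (hence h0 D = +oo) if and only *)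
(* if the series diverges.                                                    *)
Definition k0 D : \bar R :=
  \esum_(f in ideal_of D) (expR (- pi * sqnorm D f))%:E.

Definition h0 D : \bar R := lne (k0 D).

(* There is exactly one such divisor, so that the default 0 is never reached. *)
Definition canonical_divisor : arakelov_divisor :=
  xget 0 [set K : arakelov_divisor |
            ideal_of K = fracinv (different F) /\ forall s, K.2 s = 0].

End FixedInfinitePrimes.
End ArakelovDivisors.

(* Main.v *)
(* Choose a Z-basis b of the fractional ideal I of D and let V be the matrix of
   the e_j(b_i), e_j running over all embeddings of F. Then ||f||_D^2, for f in I,
   is the positive definite quadratic form in the coordinates of f whose Gram
   matrix is G = V W V^*, W being the diagonal matrix of the weights given by the
   x_sigma. The ideal of kappa - D is the dual of I for the trace form and, in the
   dual basis, its quadratic form has Gram matrix G^-1. Hence the statement is the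
   logarithm of the theta identity

     sqrt (det G) * sum_(x in Z^n) exp (- pi G[x]) = sum_(y in Z^n) exp (- pi G^-1[y])

   since det G = |disc b| * det W and disc b = Delta * prod_P #(O/P)^(-2 x_P).

   The theta identity follows by induction on n, completing the square in the
   first variable, from its one-variable case with arbitrary real
   characteristics. The latter is obtained without integration, as in Polya's
   proof: evaluating sums of binomial coefficients over an arithmetic progression
   by means of roots of unity gives a finite Poisson formula, and dominated
   convergence of series turns it into the theta identity.

   On the arithmetic side, a fractional ideal A is invertible because of
   Dedekind's Prague theorem (if f g has integral coefficients, so have all the
   products f_i g_j), and disc (A P) = #(O/P)^2 disc A because the O-module A/AP
   is isomorphic to O/P, the index of a sublattice being a determinant by the
   Smith normal form. *)
From HB Require Import structures.
Require Import Defs.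
From mathcomp Require Import all_boot all_order all_algebra all_field.
From mathcomp Require Import complex.
From mathcomp Require Import finmap freeg.
From mathcomp Require Import all_classical all_reals all_analysis.
From mathcomp Require Import zify ring lra.

Set Implicit Arguments.
Unset Strict Implicit.
Unset Printing Implicit Defensive.

Import Order.TTheory GRing.Theory Num.Theory.
Import numFieldNormedType.Exports.

Local Open Scope classical_set_scope.
Local Open Scope ring_scope.

(** * Summable families of reals *)

(** Completing the square shifts the first variable by a real linear form in the others and couples
    it to their phases. This is why the one-variable identity needs arbitrary real characteristics,
    although the final application has none. A free phase [c] lets real cosines do the work of
    complex characters. The finite formula leaves a central binomial coefficient in the limit. Its
    asymptotics are not computed by Stirling or Wallis: the case [g = 1] is self-dual with a
    positive sum, and this forces the limit. Since [k0] is extended-real valued, convergence belongs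
    to the claim, so every identity is carried together with its summability. On the arithmetic side
    [canonical_divisor] is chosen by [xget]. It means something only once the codifferent is known
    to be a product of prime powers, hence the existence of factorizations for all fractional
    ideals. The weights are [exp (-2 x_s)] at a real embedding and [exp (- x_s)] at each of two
    conjugate ones; with them [det W = exp (-2 sum x_s)], the infinite part of the degree. *)

Section HasSum.
Variable R : realType.
Implicit Types T : choiceType.

(* Absolute summability: \esum is meant for nonnegative terms, hence f = u - v. *)
Definition has_sum T (f : T -> R) (s : R) :=
  exists u v : T -> R, exists U V : R,
  [/\ (forall x, 0 <= u x) /\ (forall x, 0 <= v x),
      forall x, f x = u x - v x,
      \esum_(x in setT) (u x)%:E = U%:E,
      \esum_(x in setT) (v x)%:E = V%:E & s = U - V].

Lemma eq_has_sum T (f g : T -> R) s : f =1 g -> has_sum f s -> has_sum g s.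
Proof. by move=> /funext ->. Qed.

Lemma has_sum_ge0E T (f : T -> R) s : (forall x, 0 <= f x) ->
  \esum_(x in setT) (f x)%:E = s%:E -> has_sum f s.
Proof.
move=> f0 fs; exists f, (fun=> 0), s, 0; split => //.
- by move=> x; rewrite subr0.
- by rewrite esum1.
- by rewrite subr0.
Qed.

(** Two decompositions [u - v = u' - v'] give [u + v' = u' + v], an equality of nonnegative families
    to which additivity of [\esum] applies. *)
Lemma has_sum_unique T (f : T -> R) s t : has_sum f s -> has_sum f t -> s = t.
Proof.
move=> [u [v [U [V [[u0 v0] f1 eU eV ->]]]]] [u' [v' [U' [V' [[u'0 v'0] f2 eU' eV' ->]]]]].
have : (\esum_(x in setT) ((u x)%:E + (v' x)%:E) = \esum_(x in setT) ((u' x)%:E + (v x)%:E))%E.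
  apply: eq_esum => x _; rewrite -!EFinD; congr EFin.
  by have := f1 x; rewrite f2; lra.
rewrite esumD; [|by move=> *; rewrite lee_fin..].
rewrite esumD; [|by move=> *; rewrite lee_fin..].
rewrite eU eV eU' eV' -!EFinD => -[]; lra.
Qed.

Lemma has_sum_esum T (f : T -> R) s : (forall x, 0 <= f x) -> has_sum f s ->
  \esum_(x in setT) (f x)%:E = s%:E.
Proof.
move=> f0 [u [v [U [V [[u0 v0] f1 eU eV ->]]]]].
have : (\esum_(x in setT) ((f x)%:E + (v x)%:E) = \esum_(x in setT) ((u x)%:E))%E.
  by apply: eq_esum => x _; rewrite -!EFinD f1 subrK.
rewrite esumD; [|by move=> *; rewrite lee_fin..].
rewrite eU eV; case: (esum _ _) => [r [<-]||] //=.
by rewrite addrK.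
Qed.

Lemma has_sum_ge0 T (f : T -> R) s : (forall x, 0 <= f x) -> has_sum f s -> 0 <= s.
Proof.
move=> f0 /(has_sum_esum f0) fs.
by rewrite -lee_fin -fs; apply: esum_ge0 => x _; rewrite lee_fin.
Qed.

Lemma has_sumD T (f g : T -> R) s t : has_sum f s -> has_sum g t ->
  has_sum (fun x => f x + g x) (s + t).
Proof.
move=> [u [v [U [V [[u0 v0] f1 eU eV ->]]]]] [u' [v' [U' [V' [[u'0 v'0] f2 eU' eV' ->]]]]].
exists (fun x => u x + u' x), (fun x => v x + v' x), (U + U'), (V + V'); split.
- by split => x; apply: addr_ge0.
- by move=> x; rewrite f1 f2; lra.
- under eq_esum do rewrite EFinD.
  by rewrite esumD ?eU ?eU' // => *; rewrite lee_fin.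
- under eq_esum do rewrite EFinD.
  by rewrite esumD ?eV ?eV' // => *; rewrite lee_fin.
- by lra.
Qed.

Lemma has_sumN T (f : T -> R) s : has_sum f s -> has_sum (fun x => - f x) (- s).
Proof.
move=> [u [v [U [V [[u0 v0] f1 eU eV ->]]]]].
exists v, u, V, U; split => //; last by rewrite opprB.
by move=> x; rewrite f1 opprB.
Qed.

Lemma has_sumB T (f g : T -> R) s t : has_sum f s -> has_sum g t ->
  has_sum (fun x => f x - g x) (s - t).
Proof. by move=> fs /has_sumN; exact: has_sumD. Qed.

Lemma has_sum0 T : has_sum (fun _ : T => 0) 0.
Proof. by apply: has_sum_ge0E => //; rewrite esum1. Qed.

(** Finite partial sums give one inequality for every factor; the converse is the same inequality
    for [c^-1]. *)
Lemma esum_scale T (f : T -> R) (c U : R) : 0 <= c -> (forall x, 0 <= f x) ->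
  \esum_(x in setT) (f x)%:E = U%:E -> \esum_(x in setT) (c * f x)%:E = (c * U)%:E.
Proof.
have le (g : T -> R) (d : R) (W : R) : 0 <= d -> (forall x, 0 <= g x) ->
    \esum_(x in setT) (g x)%:E = W%:E ->
    (\esum_(x in setT) (d * g x)%:E <= (d * W)%:E)%E.
  move=> d0 g0 gW; apply: ge_ereal_sup => _ [A [finA _] <-].
  rewrite fsumEFin // lee_fin -mulr_fsumr.
  apply: ler_wpM2l => //; rewrite -lee_fin -gW -fsumEFin //.
  by apply: ereal_sup_ubound; exists A.
move=> c0 f0 fU; apply/eqP; rewrite eq_le le //=.
have [->|cn0] := eqVneq c 0.
  by rewrite mul0r; apply: esum_ge0 => *; rewrite mul0r.
have cgt : 0 < c by rewrite lt_neqAle eq_sym cn0.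
have cf0 x : 0 <= c * f x by exact: mulr_ge0.
have := le _ _ _ c0 f0 fU.
have : (0 <= \esum_(x in setT) (c * f x)%:E)%E.
  by apply: esum_ge0 => x _; rewrite lee_fin.
case E : (esum _ _) => [r||] // _ _.
have := le _ c^-1 _ _ cf0 E.
under eq_esum do rewrite mulKf //.
rewrite fU !lee_fin invr_ge0 => /(_ c0).
by rewrite ler_pdivlMl.
Qed.

Lemma has_sumZ T (f : T -> R) s c : has_sum f s -> has_sum (fun x => c * f x) (c * s).
Proof.
wlog c0 : f s c / 0 <= c.
  move=> H fs; have [/H|cn] := leP 0 c; first exact.
  rewrite -mulrNN; apply: (@eq_has_sum _ (fun x => - c * - f x)).
    by move=> x; rewrite mulrNN.
  by apply: H; [lra|exact: has_sumN].
move=> [u [v [U [V [[u0 v0] f1 eU eV ->]]]]].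
exists (fun x => c * u x), (fun x => c * v x), (c * U), (c * V); split.
- by split => x; apply: mulr_ge0.
- by move=> x; rewrite f1 mulrBr.
- exact: esum_scale.
- exact: esum_scale.
- by rewrite mulrBr.
Qed.

Lemma has_sum_reindex T T' (e : T -> T') (f : T' -> R) s : bijective e ->
  has_sum (f \o e) s <-> has_sum f s.
Proof.
move=> [e' ee' e'e].
have key (S S' : choiceType) (h : S -> S') (h' : S' -> S) (g : S' -> R) r :
   cancel h h' -> cancel h' h -> has_sum g r -> has_sum (g \o h) r.
  move=> hh' h'h [u [v [U [V [[u0 v0] f1 eU eV ->]]]]].
  have bh : set_bij setT setT h.
    by rewrite setTT_bijective; exists h'.
  exists (u \o h), (v \o h), U, V; split => //.
  - by split=> x /=.
  - by move=> x /=.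
  - rewrite -eU; apply/esym.
    exact: (reindex_esum _ _ _ (fun x => (u x)%:E)).
  - rewrite -eV; apply/esym.
    exact: (reindex_esum _ _ _ (fun x => (v x)%:E)).
split; last exact: key.
move=> /(key _ _ e' e _ _ e'e ee'); apply: eq_has_sum => x /=.
by rewrite e'e.
Qed.

Lemma has_sum_le_ex T (f g : T -> R) s : (forall x, 0 <= f x <= g x) ->
  has_sum g s -> exists2 t, has_sum f t & t <= s.
Proof.
move=> fg gs.
have f0 x : 0 <= f x by case/andP: (fg x).
have g0 x : 0 <= g x by case/andP: (fg x) => /le_trans; apply.
have := has_sum_esum g0 gs.
have : (\esum_(x in setT) (f x)%:E <= \esum_(x in setT) (g x)%:E)%E.
  by apply: le_esum => x _; rewrite lee_fin; case/andP: (fg x).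
have : (0 <= \esum_(x in setT) (f x)%:E)%E by apply: esum_ge0 => x _; rewrite lee_fin.
case E : (esum _ _) => [t||] //= _ + gE; rewrite gE // lee_fin => ts.
by exists t => //; apply: has_sum_ge0E.
Qed.

Lemma has_sum_le T (f g : T -> R) s t : (forall x, f x <= g x) ->
  has_sum f s -> has_sum g t -> s <= t.
Proof.
move=> fg fs gt; rewrite -subr_ge0.
by apply: has_sum_ge0 (has_sumB gt fs) => x; rewrite subr_ge0.
Qed.

Lemma has_sum_dominated T (f g : T -> R) s : (forall x, `|f x| <= g x) ->
  has_sum g s -> exists2 t, has_sum f t & `|t| <= s.
Proof.
move=> fg gs.
(* The shifted family [g + f] lies between 0 and [2 g], which reduces the signed case to comparison
   of nonnegative families. *)
have [t ft _] : exists2 t, has_sum (fun x => g x + f x) t & t <= s *+ 2.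
  apply: (has_sum_le_ex (g := fun x => g x + g x)); last exact: has_sumD.
  by move=> x; have := fg x; rewrite ler_norml => /andP[]; lra.
have {}ft : has_sum f (t - s).
  by apply: eq_has_sum (has_sumB ft gs) => x; lra.
exists (t - s) => //; rewrite ler_norml; apply/andP; split.
  apply: has_sum_le (has_sumN gs) ft => x.
  by have := fg x; rewrite ler_norml => /andP[].
apply: has_sum_le ft gs => x.
by have := fg x; rewrite ler_norml => /andP[].
Qed.

Lemma has_sum_fsum T (f : T -> R) (A : {fset T}) :
  (forall x, x \notin A -> f x = 0) -> has_sum f (\sum_(x <- A) f x).
Proof.
move=> fA.
have key (h : T -> R) : (forall x, 0 <= h x) -> (forall x, x \notin A -> h x = 0) ->
    \esum_(x in setT) (h x)%:E = (\sum_(x <- A) h x)%:E.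
  move=> h0 hA.
  have -> : \esum_(x in setT) (h x)%:E = \esum_(x in [set` A]) (h x)%:E.
    rewrite [RHS]esum_mkcond; apply: eq_esum => x _.
    by case: ifPn => // /negP; rewrite in_setE /= => /negP /hA ->.
  rewrite esum_fset //; last by move=> *; rewrite lee_fin.
  by rewrite fsumEFin // fsbig_finite // set_fsetK.
pose u x := f x + `|f x|.
exists u, (fun x => `|f x|), (\sum_(x <- A) u x), (\sum_(x <- A) `|f x|); split.
- by split=> x //; rewrite /u -lerBlDr sub0r lerNnormlW.
- by move=> x; rewrite /u addrK.
- by apply: key => x; rewrite /u; [rewrite -lerBlDr sub0r lerNnormlW|move=> /fA ->; rewrite normr0 addr0].
- by apply: key => x // /fA ->; rewrite normr0.
- by rewrite -sumrB; apply: eq_bigr => x _; rewrite /u addrK.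
Qed.

Lemma has_sum_ge_term T (f : T -> R) s t : (forall x, 0 <= f x) -> has_sum f s -> f t <= s.
Proof.
move=> f0 fs; pose h x := if x == t then f x else 0.
have -> : f t = \sum_(x <- [fset t]%fset) h x by rewrite big_seq_fset1 /h eqxx.
apply: has_sum_le (has_sum_fsum _) fs => x; rewrite /h; first by case: ifP.
by rewrite inE => /negbTE ->.
Qed.

Lemma has_sum_tonelli T T' (f : T * T' -> R) (g : T -> R) s : (forall x, 0 <= f x) ->
  (forall a, has_sum (fun b => f (a, b)) (g a)) -> has_sum g s -> has_sum f s.
Proof.
move=> f0 fg gs; apply: has_sum_ge0E => //.
have g0 a : 0 <= g a by apply: has_sum_ge0 (fg a) => b.
rewrite -(has_sum_esum g0 gs).
have := @esum_esum R T T' setT (fun=> setT) (fun a b => (f (a, b))%:E).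
rewrite (_ : setT `*`` _ = setT); last by apply/seteqP.
move=> H; transitivity (\esum_(k in [set: T * T']) (f (k.1, k.2))%:E).
  by apply: eq_esum => -[].
rewrite -H; last by move=> *; rewrite lee_fin.
by apply: eq_esum => a _; rewrite (has_sum_esum _ (fg a)).
Qed.

Lemma has_sum_fubini T T' (f : T * T' -> R) s : has_sum f s ->
  exists2 g : T -> R, (forall a, has_sum (fun b => f (a, b)) (g a)) & has_sum g s.
Proof.
have key (u : T * T' -> R) U : (forall x, 0 <= u x) ->
    \esum_(x in setT) (u x)%:E = U%:E ->
    exists2 g : T -> R, (forall a, 0 <= g a /\ \esum_(b in setT) (u (a, b))%:E = (g a)%:E) &
      \esum_(x in setT) (g x)%:E = U%:E.
  move=> u0 uU.
  have H : \esum_(a in [set: T]) \esum_(b in [set: T']) (u (a, b))%:E = U%:E.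
    rewrite -uU (@esum_esum R T T' setT (fun=> setT) (fun a b => (u (a, b))%:E)).
      rewrite (_ : setT `*`` _ = setT); last by apply/seteqP.
      by apply: eq_esum => -[].
    by move=> *; rewrite lee_fin.
  have E0 a : (0 <= \esum_(b in [set: T']) (u (a, b))%:E)%E.
    by apply: esum_ge0 => *; rewrite lee_fin.
  have Efin a : \esum_(b in [set: T']) (u (a, b))%:E \is a fin_num.
    have : (\esum_(b in [set: T']) (u (a, b))%:E <= U%:E)%E.
      rewrite -H -[leLHS](esum_set1 (a := fun a => \esum_(b in [set: T']) (u (a, b))%:E)) //.
      rewrite esum_mkcond; apply: le_esum => i _; case: ifP => // _.
    by have := E0 a; case: (esum _ _).
  exists (fun a => fine (\esum_(b in [set: T']) (u (a, b))%:E)).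
    by move=> a; rewrite fineK //; split => //; apply: fine_ge0.
  by rewrite -H; apply: eq_esum => a _; rewrite fineK.
move=> [u [v [U [V [[u0 v0] f1 eU eV ->]]]]].
have [g gE gU] := key _ _ u0 eU.
have [h hE hV] := key _ _ v0 eV.
exists (fun a => g a - h a).
  move=> a; exists (fun b => u (a, b)), (fun b => v (a, b)), (g a), (h a); split => //.
  - by case: (gE a).
  - by case: (hE a).
exists g, h, U, V; split => //.
by split=> a; [case: (gE a)|case: (hE a)].
Qed.

Lemma has_sum_iter T T' (f : T * T' -> R) (g : T -> R) s : has_sum f s ->
  (forall a, has_sum (fun b => f (a, b)) (g a)) -> has_sum g s.
Proof.
move=> /has_sum_fubini[h fh hs] fg; apply: eq_has_sum hs => a.
exact: has_sum_unique (fh a) (fg a).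
Qed.

Lemma has_sum_swap T T' (f : T * T' -> R) s : has_sum f s ->
  has_sum (fun x : T' * T => f (x.2, x.1)) s.
Proof.
move=> fs; apply/(has_sum_reindex (e := fun x : T' * T => (x.2, x.1))).
  by exists (fun x : T * T' => (x.2, x.1)) => -[].
by [].
Qed.

Lemma has_sum_tail T (f : T -> R) s e : (forall x, 0 <= f x) -> has_sum f s -> 0 < e ->
  exists A : {fset T}, s - e < \sum_(x <- A) f x.
Proof.
move=> f0 fs e0.
have : ((s - e)%:E < \esum_(x in setT) (f x)%:E)%E.
  by rewrite (has_sum_esum f0 fs) lte_fin; lra.
move=> /ereal_sup_gt [_ [A [finA _] <-]].
rewrite fsumEFin // lte_fin fsbig_finite // => H.
by exists (fset_set A).
Qed.

Lemma tannery T (f : nat -> T -> R) (h g : T -> R) (s : nat -> R) G :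
  (forall n x, `|f n x| <= g x) -> has_sum g G ->
  (forall x, f ^~ x @ \oo --> h x) -> (forall n, has_sum (f n) (s n)) ->
  exists2 t, has_sum h t & s @ \oo --> t.
Proof.
move=> fg gG fh fs.
have hg x : `|h x| <= g x.
  have H : (fun n => `|f n x|) @ \oo --> `|h x| by apply: cvg_norm; exact: fh.
  rewrite -(cvg_lim _ H) //; apply: limr_le; first by apply: cvgP H.
  by near=> n; exact: fg.
have [t ht _] := has_sum_dominated hg gG.
exists t => //.
pose d n x := `|f n x - h x|.
have d2 n x : 0 <= d n x <= 2 * g x.
  rewrite normr_ge0 /=; apply: le_trans (ler_normB _ _) _.
  by have := fg n x; have := hg x; lra.
have dc x : d ^~ x @ \oo --> 0.
  rewrite -(normr0 R); apply: cvg_norm; rewrite -(subrr (h x)).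
  by apply: cvgB; [exact: fh|exact: cvg_cst].
apply/cvgrPdist_lt => e e0.
have g0 x : 0 <= g x by apply: le_trans (hg x).
(* The finite set [A] will carry all of [G] but [e / 4]. Off [A] the differences are at most [2 g],
   hence sum to less than [e / 2]; on [A] their finite sum is eventually below [e / 4]. *)
have e4 : 0 < e / 4 by lra.
have [A GA] := has_sum_tail g0 gG e4.
have dA : (fun n => \sum_(x <- A) d n x) @ \oo --> 0.
  rewrite [X in _ --> X](_ : 0 = \sum_(x <- A) 0); last by rewrite big1.
  by apply: cvg_big => [|x _]; [exact: add_continuous|exact: dc].
move/cvgrPdist_lt: dA => /(_ _ e4) dA.
near=> n.
have [dn dnE _] := has_sum_le_ex (d2 n) (has_sumZ 2 gG).
have sub : `|t - s n| <= dn.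
  rewrite ler_norml; apply/andP; split.
    apply: has_sum_le (has_sumN dnE) (has_sumB ht (fs n)) => x.
    by rewrite lerNl opprB ler_norm.
  apply: has_sum_le (has_sumB ht (fs n)) dnE => x.
  by rewrite /d distrC ler_norm.
apply: le_lt_trans sub _.
pose cutA (u : T -> R) x := if x \in A then u x else 0.
have cutE u : has_sum (cutA u) (\sum_(x <- A) u x).
  rewrite (_ : \sum_(x <- A) u x = \sum_(x <- A) cutA u x); last first.
    by rewrite big_seq [RHS]big_seq; apply: eq_bigr => x xA; rewrite /cutA xA.
  by apply: has_sum_fsum => x /negbTE xA; rewrite /cutA xA.
apply: (@le_lt_trans _ _ (\sum_(x <- A) d n x + 2 * (G - \sum_(x <- A) g x))).
  apply: has_sum_le dnE (has_sumD (cutE _) (has_sumZ 2 (has_sumB gG (cutE g)))) => x.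
  by rewrite /cutA; case: ifP => _; have := d2 n x; lra.
have : `|0 - \sum_(x <- A) d n x| < e / 4 by near: n.
rewrite sub0r normrN => /(le_lt_trans (ler_norm _)).
lra.
Unshelve. all: by end_near.
Qed.

End HasSum.

(** * A finite Poisson formula for binomial weights *)

Section Trig.
Variable R : realType.

(** Real part of the binomial expansion of [(e^(it) + e^(-it))^N e^(ic)]. The free phase makes the
    induction work: Pascal's rule replaces [c] by [c - t] and [c + t]. *)
Lemma sum_bin_cos N (t c : R) :
  \sum_(i < N.+1) 'C(N, i)%:R * cos ((2 * i%:R - N%:R) * t + c) = (2 * cos t) ^+ N * cos c.
Proof.
elim: N c => [|N IH] c.
  by rewrite big_ord_recl big_ord0 bin0 expr0 addr0 !mul1r mulr0 subr0 mul0r add0r.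
have -> : \sum_(i < N.+2) 'C(N.+1, i)%:R * cos ((2 * i%:R - N.+1%:R) * t + c) =
    \sum_(i < N.+1) 'C(N, i)%:R * cos ((2 * i%:R - N%:R) * t + (c - t)) +
    \sum_(i < N.+1) 'C(N, i)%:R * cos ((2 * i%:R - N%:R) * t + (c + t)).
  have E1 (i : 'I_N.+1) : cos ((2 * i%:R - N%:R) * t + (c - t)) =
      cos ((2 * i%:R - N.+1%:R) * t + c) by congr cos; rewrite -natr1; ring.
  have E2 (i : 'I_N.+1) : cos ((2 * i%:R - N%:R) * t + (c + t)) =
      cos ((2 * i.+1%:R - N.+1%:R) * t + c) by congr cos; rewrite -!natr1; ring.
  under [X in _ = X + _]eq_bigr do rewrite E1.
  under [X in _ = _ + X]eq_bigr do rewrite E2.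
  rewrite big_ord_recl [X in _ = X + _]big_ord_recl /= !bin0 -!addrA; congr (_ + _).
  rewrite (eq_bigr (fun i : 'I_N.+1 => 'C(N, i.+1)%:R * cos ((2 * i.+1%:R - N.+1%:R) * t + c) +
     'C(N, i)%:R * cos ((2 * i.+1%:R - N.+1%:R) * t + c))); last first.
    by move=> i _; rewrite binS natrD mulrDl.
  rewrite big_split /=; congr (_ + _).
  by rewrite big_ord_recr /= bin_small // mul0r addr0.
rewrite !IH cosB cosD exprS; ring.
Qed.

Lemma cosD2piz (x : R) (m : int) : cos (x + 2 * pi * m%:~R) = cos x.
Proof.
have E (y : R) : 2 * pi * y = pi *+ 2 * y by rewrite mulr_natl.
have key (n : nat) y : cos (y + 2 * pi * n%:R) = cos y :> R.
  by rewrite -(periodicn (@cosD2pi R) n y) E mulr_natr.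
case: m => n; first by rewrite -pmulrn key.
by rewrite NegzE mulrNz mulrN -[x in RHS](subrK (2 * pi * n.+1%:R)) key.
Qed.

(** Multiplying by [2 sin (t / 2)] makes the sum telescope, as for the Dirichlet kernel. *)
Lemma sum_cos_arith (l : nat) (t c : R) :
  2 * sin (t / 2) * \sum_(i < l) cos (i%:R * t + c) =
  sin (l%:R * t + (c - t / 2)) - sin (c - t / 2).
Proof.
elim: l => [|l IH]; first by rewrite big_ord0 mul0r add0r mulr0 subrr.
rewrite big_ord_recr mulrDr IH /=.
have -> : l.+1%:R * t + (c - t / 2) = (l%:R * t + c) + t / 2 by rewrite -natr1; field.
have -> : l%:R * t + (c - t / 2) = (l%:R * t + c) - t / 2 by ring.
rewrite [sin (l%:R * t + c - t / 2)]sinB [sin (_ + t / 2)]sinD; ring.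
Qed.

Lemma sin2E (x : R) : 2 * sin x ^+ 2 = 1 - cos (2 * x).
Proof. by rewrite [2 * x]mulr_natl cos_mulr2n sin2cos2; ring. Qed.

Lemma sin_pi_frac_neq0 (l : nat) (j : int) : (0 < l)%N -> ~~ (l %| j)%Z ->
  sin (pi * (j%:~R / l%:R)) != 0 :> R.
Proof.
move=> l0 jl.
have l0' : 0 < l%:R :> R by rewrite ltr0n.
have pi0 := pi_gt0 R.
have key (r : int) : 0 < r -> r < l%:Z -> sin (pi * (r%:~R / l%:R)) != 0 :> R.
  move=> r0 rl; apply: lt0r_neq0; apply: sin_gt0_pi.
  have r0' : 0 < r%:~R :> R by rewrite ltr0z.
  have rl' : r%:~R < l%:R :> R by rewrite pmulrn ltr_int.
  rewrite mulr_gt0 ?divr_gt0 //=.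
  by rewrite -[ltRHS]mulr1 ltr_pM2l // ltr_pdivrMr // mul1r.
have lz : (l%:Z != 0) by lia.
have r0 : 0 < (j %% l)%Z.
  rewrite lt_neqAle modz_ge0 // andbT eq_sym.
  by apply: contraNneq jl => jl0; apply/dvdz_mod0P.
have rl : (j %% l)%Z < l by apply: ltz_pmod; rewrite ltz_nat.
(* Reducing [j] modulo [l] may change the sign of the sine but not its square, which [sin2E]
   expresses through a cosine of period [2 pi]. *)
apply: contraNneq (key _ r0 rl) => s0.
rewrite -sqrf_eq0 -(mulrI_eq0 _ (mulfI (_ : 2 != 0 :> R))) ?pnatr_eq0 //.
rewrite sin2E -(cosD2piz _ (j %/ l)%Z).
have -> : 2 * (pi * ((j %% l)%Z%:~R / l%:R)) + 2 * pi * (j %/ l)%Z%:~R =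
    2 * (pi * (j%:~R / l%:R)) :> R.
  rewrite [in RHS](divz_eq j l); move: (j %/ l)%Z (j %% l)%Z => q r.
  by rewrite intrD intrM -pmulrn; field; lra.
by rewrite -sin2E s0 expr0n mulr0.
Qed.

(** Orthogonality of the characters modulo [l], in real form and with a phase. *)
Lemma sum_cos_roots (l : nat) (j : int) (c : R) : (0 < l)%N ->
  \sum_(i < l) cos (i%:R * (2 * pi * (j%:~R / l%:R)) + c) =
  if (l %| j)%Z then l%:R * cos c else 0.
Proof.
move=> l0; have l0' : l%:R != 0 :> R by rewrite pnatr_eq0 -lt0n.
case: ifPn => [/dvdzP[q ->]|jl].
  rewrite (eq_bigr (fun=> cos c)) ?sumr_const ?card_ord ?mulr_natl // => i _.
  rewrite -[RHS](cosD2piz _ (q * i)%R) addrC !intrM -!pmulrn; congr (cos (_ + _)).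
  by field.
set t := 2 * pi * _.
have s0 : 2 * sin (t / 2) != 0.
  rewrite mulf_neq0 ?pnatr_eq0 //.
  have -> : t / 2 = pi * (j%:~R / l%:R) by rewrite /t; field.
  exact: sin_pi_frac_neq0.
apply: (mulfI s0); rewrite sum_cos_arith mulr0.
have -> : l%:R * t = 2 * pi * j%:~R by rewrite /t; field.
by rewrite -!cosBpihalf -addrA [2 * pi * _ + _]addrC cosD2piz subrr.
Qed.

Lemma has_sum_inj (T T' : choiceType) (e : T -> T') (f : T' -> R) s : injective e ->
  (forall y, ~ range e y -> f y = 0) -> has_sum f s -> has_sum (f \o e) s.
Proof.
move=> inj_e f0 fs.
have bij : set_bij setT (range e) e.
  by split=> [x _|x y _ _ /inj_e //|y [x _ <-]]; exists x.
have key (h : T' -> R) r : (forall y, 0 <= h y) -> (forall y, ~ range e y -> h y = 0) ->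
    has_sum h r -> has_sum (h \o e) r.
  move=> h0 hr /(has_sum_esum h0) hs; apply: has_sum_ge0E => [x|]; first exact: h0.
  rewrite -hs -(reindex_esum setT (range e) e (fun y => (h y)%:E)) //.
  rewrite esum_mkcond; apply: eq_esum => y _; case: ifPn => // /negP.
  by rewrite in_setE => /hr ->.
have [u [v [U [V [[u0 v0] f1 eU eV _]]]]] := fs.
have [t ft _] : exists2 t, has_sum (fun y => `|f y|) t & t <= U + V.
  apply: (@has_sum_le_ex _ _ _ (fun y => u y + v y)).
    move=> y; rewrite normr_ge0 f1 /=; apply: le_trans (ler_normB _ _) _.
    by rewrite !ger0_norm.
  by apply: has_sumD; exact: has_sum_ge0E.
(* The nonnegative case is applied to [f + |f|] and to [|f|], both of which vanish off the range of
   [e]. *)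
have H1 : has_sum ((fun y => f y + `|f y|) \o e) (s + t).
  apply: key => [y|y /f0 ->|]; last exact: has_sumD.
    by have := lerNnormlW (lexx `|f y|); lra.
  by rewrite normr0 addr0.
have H2 : has_sum ((fun y => `|f y|) \o e) t.
  by apply: key => // y /f0 ->; rewrite normr0.
have := has_sumB H1 H2; rewrite addrK; apply: eq_has_sum => x /=.
by rewrite addrK.
Qed.

Lemma has_sum_finite (I : finType) (T : choiceType) (e : I -> T) (f : T -> R) :
  injective e -> (forall y, (forall i, y != e i) -> f y = 0) ->
  has_sum f (\sum_i f (e i)).
Proof.
move=> inj_e f0.
pose A := seq_fset tt [seq e i | i <- enum I].
have -> : \sum_i f (e i) = \sum_(y <- A) f y.
  rewrite -big_enum -(big_map e xpredT f); apply: perm_big.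
  apply: uniq_perm; rewrite ?map_inj_uniq ?enum_uniq //.
    by rewrite -enumT enum_uniq.
  by move=> y; rewrite seq_fsetE.
apply: has_sum_fsum => y yA; apply: f0 => i.
by apply: contraNneq yA => ->; rewrite seq_fsetE map_f ?mem_enum.
Qed.

(** The substitution [j = i - n] in [sum_bin_cos]. By symmetry the coefficient depends on [|j|]
    only, and it vanishes for [|j| > n], so the sum may run over all integers. *)
Lemma has_sum_bin_cos n (t c : R) :
  has_sum (fun j : int => 'C(n.*2, n + `|j|)%:R * cos (2 * j%:~R * t + c))
    ((2 * cos t) ^+ n.*2 * cos c).
Proof.
pose e (i : 'I_n.*2.+1) : int := i%:Z - n%:Z.
rewrite -sum_bin_cos [X in has_sum _ X](_ : _ = \sum_i
    'C(n.*2, n + `|e i|)%:R * cos (2 * (e i)%:~R * t + c)).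
  apply: (has_sum_finite (e := e)) => [i j /addIr[/val_inj] //|j jA].
  rewrite bin_small ?mul0r // ltnNge; apply/negP => jn.
  have jn2 : (absz (j + n%:Z)%R < n.*2.+1)%N by move: (j : int) jn => {jA}j; lia.
  by have /eqP[] := jA (Ordinal jn2); rewrite /e /=; lia.
apply: eq_bigr => i _; have := ltn_ord i; rewrite ltnS => i2n; congr (_%:R * cos (_ * _ + _)).
  have [le_ni|lt_in] := leqP n i.
    by congr 'C(_, _); rewrite /e; lia.
  by rewrite -bin_sub //; congr 'C(_, _); rewrite /e; lia.
rewrite /e intrB -!pmulrn -[n.*2%:R]/(n.*2%:R : R) (_ : n.*2%:R = n%:R + n%:R :> R); first ring.
by rewrite -natrD addnn.
Qed.

(* Finite Poisson summation: the binomial weights are summed over an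
   arithmetic progression by averaging over the l-th roots of unity. *)
Lemma has_sum_bin_poisson n p (s : int) (b c : R) (l := p.*2.+1) :
  has_sum (fun m : int => 'C(n.*2, n + absz (m * l%:Z - s)%R)%:R * cos (2 * pi * m%:~R * b + c))
    (l%:R^-1 * \sum_(i < l) (2 * cos (pi * ((i%:R - p%:R + b) / l%:R))) ^+ n.*2 *
        cos (2 * pi * s%:~R * ((i%:R - p%:R + b) / l%:R) + c)).
Proof.
have l0 : l%:R != 0 :> R by rewrite pnatr_eq0.
pose x (i : 'I_l) : R := (i%:R - p%:R + b) / l%:R.
have H : has_sum (fun j : int => l%:R^-1 * \sum_(i < l)
     'C(n.*2, n + `|j|)%:R * cos (2 * j%:~R * (pi * x i) + (2 * pi * s%:~R * x i + c)))
   (l%:R^-1 * \sum_(i < l) (2 * cos (pi * x i)) ^+ n.*2 * cos (2 * pi * s%:~R * x i + c)).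
  apply: has_sumZ; elim: (index_enum _) => [|i r IH].
    by rewrite big_nil; apply: eq_has_sum (has_sum0 _ _) => j; rewrite big_nil.
  rewrite big_cons; apply: eq_has_sum (has_sumD (has_sum_bin_cos n (pi * x i) (2 * pi * s%:~R * x i + c)) IH) => j.
  by rewrite big_cons.
(* Summing over [i] first kills every [j] with [j + s] not divisible by [l]; the survivors are
   [j = m l - s]. *)
pose f (j : int) := if (l %| (j + s))%Z then
    'C(n.*2, n + `|j|)%:R * cos (2 * pi * ((j + s)%:~R / l%:R) * b + c) else 0.
have {}H : has_sum f (l%:R^-1 * \sum_(i < l) (2 * cos (pi * x i)) ^+ n.*2 * cos (2 * pi * s%:~R * x i + c)).
  apply: eq_has_sum H => j.
  rewrite -mulr_sumr.
  under eq_bigr => i _.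
    have -> : 2 * j%:~R * (pi * x i) + (2 * pi * s%:~R * x i + c) =
      i%:R * (2 * pi * ((j + s)%:~R / l%:R)) + ((b - p%:R) * (2 * pi * ((j + s)%:~R / l%:R)) + c).
      by rewrite /x intrD; field.
  over.
  rewrite sum_cos_roots // /f; case: ifP => [/dvdzP[q ->]|_]; last by rewrite !mulr0.
  (* The indices are centred at [p], which shifts the angle by [2 pi q p], a whole number of
     periods. *)
  rewrite -[in RHS](cosD2piz _ (- (q * p%:Z))) mulrCA mulKf //; congr (_ * cos _).
  by rewrite intrN !intrM -!pmulrn; field.
have := has_sum_inj (e := fun m : int => m * l%:Z - s) _ _ H.
rewrite /x; move=> H'; apply: (eq_has_sum _ (H' _ _)) => [m /=|m m' /addIr|y].
- by rewrite /f subrK dvdz_mull // intrM -pmulrn mulfK.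
- by apply: mulIf.
- move=> yr; rewrite /f; case: ifP => // /dvdzP[q yE]; case: yr; exists q => //.
  by rewrite -yE addrK.
Qed.

End Trig.

(** * Asymptotics of binomial coefficients *)

Section Bounds.
Variable R : realType.

(** The mean value theorem gives [sin y = y cos z] with [z] between 0 and [y], where [cos z] lies
    between [cos y] and 1. *)
Lemma sin2_bounds (y : R) : `|y| <= pi / 2 ->
  y ^+ 2 * cos y ^+ 2 <= sin y ^+ 2 <= y ^+ 2.
Proof.
wlog y0 : y / 0 <= y.
  move=> H; have [/H//|yn] := leP 0 y; rewrite -normrN => /H.
  rewrite cosN sinN !sqrrN; apply; lra.
rewrite ger0_norm // => ypi.
have pi0 := pi_gt0 R.
have sc : {within `[0, y], continuous (sin : R -> R)}.
  by apply: continuous_subspaceT => x; exact: continuous_sin.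
have [z zI] := MVT_segment y0 (fun x _ => is_derive_sin x) sc.
rewrite sin0 !subr0 => ->; rewrite exprMn mulrC.
move: zI; rewrite in_itv /= => /andP[z0 zy].
have cz : cos y <= cos z by rewrite leNgt ltr_cos ?in_itv /= -?leNgt //; apply/andP; split; lra.
have cy0 : 0 <= cos y by apply: cos_ge0_pihalf; apply/andP; split; lra.
have y2 := sqr_ge0 y.
rewrite ler_wpM2r //= ?lerXn2r ?nnegrE //; last lra.
rewrite -[leRHS]mul1r ler_wpM2r // expr_le1 ?cos_le1 //; lra.
Qed.

(** This is [1 + v <= expR v] at [v = u / (1 - u)], for which [1 + v = 1 / (1 - u)]. *)
Lemma expR_lower (u : R) : u < 1 -> expR (- (u / (1 - u))) <= 1 - u.
Proof.
move=> u1; rewrite expRN -[leRHS]invrK lef_pV2 ?posrE ?expR_gt0 ?invr_gt0 ?subr_gt0 //.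
apply: le_trans (expR_ge1Dx _).
by rewrite le_eqVlt; apply/orP; left; apply/eqP; field; lra.
Qed.

Lemma expR_upper (u : R) : 1 - u <= expR (- u).
Proof. exact: expR_ge1Dx. Qed.

Lemma cos_pow_le (y : R) n : `|y| <= pi / 2 -> 0 <= cos y ^+ n.*2 <= expR (- (n%:R * y ^+ 2 / 2)).
Proof.
move=> ypi; have pi0 := pi_gt0 R.
have cy0 : 0 <= cos y by apply: cos_ge0_pihalf; rewrite -ler_norml.
rewrite exprn_ge0 //=.
have y2 : `|y / 2| <= pi / 2 by rewrite normrM (ger0_norm (_ : 0 <= 2^-1)) ?invr_ge0 //; lra.
have /andP[H _] := sin2_bounds y2.
have S := sin2E (y / 2); have C := cos2Dsin2 (y / 2).
have E : 2 * (y / 2) = y by field.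
rewrite E in S.
have cyle : cos y <= 1 - y ^+ 2 / 4.
  (* Since [cos y >= 0], the half angle satisfies [cos (y / 2) ^+ 2 >= 1 / 2]. *)
  have : (y / 2) ^+ 2 * 2^-1 <= (y / 2) ^+ 2 * cos (y / 2) ^+ 2.
    by rewrite ler_wpM2l ?sqr_ge0 //; lra.
  by rewrite !exprMn in H *; lra.
have {}cyle : cos y <= expR (- (y ^+ 2 / 4)) by apply: le_trans cyle (expR_upper _).
apply: le_trans (lerXn2r n.*2 cy0 (expR_ge0 _) cyle) _.
rewrite -expRM_natl le_eqVlt; apply/orP; left; apply/eqP; congr expR.
by rewrite -addnn natrD; field.
Qed.

Lemma bin_step n j : (n + j.+1)%:R * 'C(n.*2, n + j.+1)%:R =
   (n - j)%:R * 'C(n.*2, n + j)%:R :> R.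
Proof.
rewrite -!natrM; congr _%:R.
by rewrite addnS mul_bin_left -addnn subnDl.
Qed.

Lemma bin_ratio n j : 'C(n.*2, n + j.+1)%:R =
   (n - j)%:R / (n%:R + j%:R + 1) * 'C(n.*2, n + j)%:R :> R.
Proof.
have -> : n%:R + j%:R + 1 = (n + j.+1)%:R :> R by rewrite -natrD natr1 addnS.
by rewrite mulrAC -bin_step mulrAC mulfV ?mul1r // pnatr_eq0 addnS.
Qed.

(** Consecutive ratios are [1 - (2 j + 1) / (n + j + 1)], and the odd numbers add up to a square.
    Replacing the earlier denominators by the last and largest one weakens the bound. In [bin_lower]
    the denominators decrease to [n - j], and again the last one is the safe choice. *)
Lemma bin_upper n j : (j <= n)%N ->
  'C(n.*2, n + j)%:R <= expR (- (j%:R ^+ 2 / (n%:R + j%:R))) * 'C(n.*2, n)%:R :> R.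
Proof.
elim: j => [|j IH] jn; first by rewrite expr0n /= mul0r oppr0 expR0 mul1r addn0.
have n0 : 0 < n%:R :> R by rewrite ltr0n; lia.
have j0 : 0 <= j%:R :> R by [].
have nj : 0 < (n%:R + j%:R + 1 : R) by lra.
have -> : 'C(n.*2, n + j.+1)%:R = (n - j)%:R / (n%:R + j%:R + 1) * 'C(n.*2, n + j)%:R :> R.
  exact: bin_ratio.
have -> : (n - j)%:R / (n%:R + j%:R + 1) = 1 - (2 * j%:R + 1) / (n%:R + j%:R + 1) :> R.
  by rewrite natrB ?(ltnW jn) //; field; lra.
apply: le_trans (ler_wpM2l _ (IH (ltnW jn))) _.
  rewrite subr_ge0 ler_pdivrMr // mul1r.
  by have : (j.+1%:R <= n%:R :> R) by [rewrite ler_nat]; rewrite -natr1; lra.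
rewrite mulrA ler_wpM2r //; apply: le_trans (ler_wpM2r (expR_ge0 _) (expR_upper _)) _.
rewrite -expRD ler_expR -opprD lerN2 -natr1 addrA.
have -> : (j%:R + 1) ^+ 2 = (2 * j%:R + 1) + j%:R ^+ 2 :> R by ring.
rewrite mulrDl lerD2l ler_wpM2l ?sqr_ge0 // lef_pV2 ?posrE; lra.
Qed.

Lemma bin_lower n j : (j < n)%N ->
  expR (- (j%:R ^+ 2 / (n%:R - j%:R))) * 'C(n.*2, n)%:R <= 'C(n.*2, n + j)%:R :> R.
Proof.
elim: j => [|j IH] jn; first by rewrite expr0n /= mul0r oppr0 expR0 mul1r addn0.
have n0 : 0 < n%:R :> R by rewrite ltr0n; lia.
have j0 : 0 <= j%:R :> R by [].
have nj : 0 < (n%:R + j%:R + 1 : R) by lra.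
have jn' : j%:R + 2 <= n%:R :> R by rewrite -natrD ler_nat; lia.
have -> : 'C(n.*2, n + j.+1)%:R = (n - j)%:R / (n%:R + j%:R + 1) * 'C(n.*2, n + j)%:R :> R.
  exact: bin_ratio.
have -> : (n - j)%:R / (n%:R + j%:R + 1) = 1 - (2 * j%:R + 1) / (n%:R + j%:R + 1) :> R.
  by rewrite natrB ?(ltnW (ltnW jn)) //; field; lra.
set u := (2 * j%:R + 1) / _.
have u1 : u < 1 by rewrite ltr_pdivrMr // mul1r; lra.
apply: le_trans (ler_wpM2l _ (IH (ltnW jn))); last by rewrite subr_ge0 ltW.
rewrite mulrA ler_wpM2r //; apply: le_trans (ler_wpM2r (expR_ge0 _) (expR_lower u1)).
rewrite -expRD ler_expR -opprD lerN2 -natr1.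
have -> : u / (1 - u) = (2 * j%:R + 1) / (n%:R - j%:R) by rewrite /u; field; lra.
rewrite -mulrDl.
have -> : 2 * j%:R + 1 + j%:R ^+ 2 = (j%:R + 1) ^+ 2 :> R by ring.
rewrite ler_wpM2l ?sqr_ge0 // lef_pV2 ?posrE; lra.
Qed.

Lemma cvg_expR (f : nat -> R) a : f @ \oo --> a ->
  (fun n => expR (f n)) @ \oo --> expR a.
Proof. by apply: continuous_cvg; exact: continuous_expR. Qed.

Lemma cvg_cos (f : nat -> R) a : f @ \oo --> a ->
  (fun n => cos (f n)) @ \oo --> cos a.
Proof. by apply: continuous_cvg; exact: continuous_cos. Qed.

Lemma cvg_pow_expR (u : nat -> R) (L : R) : (forall n, 0 <= u n) ->
  u @ \oo --> 0 -> (fun n => n.+1%:R * u n) @ \oo --> L ->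
  (fun n => (1 - u n) ^+ n.+1) @ \oo --> expR (- L).
Proof.
move=> u0 uc nuc.
have ul : \forall n \near \oo, u n < 1 by exact: (cvgr_lt 0 uc).
apply: (squeeze_cvgr (f := fun n => expR (- (n.+1%:R * u n * (1 - u n)^-1)))
   (h := fun n => expR (- (n.+1%:R * u n)))).
- near=> n.
  have un : u n < 1 by near: n.
  rewrite -mulrA -mulrN !expRM_natl; apply/andP; split.
    by rewrite lerXn2r ?nnegrE ?expR_ge0 ?subr_ge0 ?(ltW un) ?expR_lower.
  rewrite -mulrN expRM_natl.
  by rewrite lerXn2r ?nnegrE ?expR_ge0 ?subr_ge0 ?(ltW un) ?expR_upper.
- apply: cvg_expR.
  apply: cvgN; rewrite -[L]mulr1; apply: cvgM => //.
  have H1 : (fun n => 1 - u n) @ \oo --> (1 - 0 : R) by apply: cvgB => //; exact: cvg_cst.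
  by rewrite subr0 in H1; rewrite -[X in _ --> X]invr1; apply: cvgV H1; rewrite oner_eq0.
- apply: cvg_expR.
  exact: cvgN.
Unshelve. all: by end_near.
Qed.

(** From [(m - 2 t)^2 >= 0] follows [2 (m - t)^2 >= m^2 - 2 t^2], and [m^2 >= |m|] for integers. The
    resulting geometric majorant is uniform in [t], as [tannery] requires. *)
Lemma expR_shift_bound (d t K : R) (m : int) : 0 < d -> `|t| <= K ->
  expR (- (d * (m%:~R - t) ^+ 2)) <= expR (d * K ^+ 2) * expR (- (d / 2)) ^+ absz m.
Proof.
move=> d0 tK; rewrite -expRM_natl -expRD ler_expR.
have tK2 : t ^+ 2 <= K ^+ 2 by rewrite -real_normK ?num_real // lerXn2r ?nnegrE // (le_trans _ tK).
have m2 : (absz m)%:R <= m%:~R ^+ 2 :> R.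
  rewrite -[m%:~R ^+ 2]real_normK ?num_real // -intr_norm -abszE -pmulrn -natrX ler_nat.
  by case: (absz m) => // k; rewrite expnS expn1 leq_pmulr.
have : 0 <= (m%:~R - 2 * t) ^+ 2 by exact: sqr_ge0.
have -> : (m%:~R - 2 * t) ^+ 2 = 2 * (m%:~R - t) ^+ 2 - m%:~R ^+ 2 + 2 * t ^+ 2 by ring.
move=> H.
have H2 : d / 2 * ((absz m)%:R - 2 * K ^+ 2) <= d / 2 * (2 * (m%:~R - t) ^+ 2).
  by apply: ler_wpM2l; lra.
lra.
Qed.

Lemma has_sum_geometric_int (r : R) : 0 <= r < 1 ->
  exists s, has_sum (fun m : int => r ^+ absz m) s.
Proof.
move=> /andP[r0 r1].
have H : has_sum (fun n : nat => r ^+ n) (1 - r)^-1.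
  apply: has_sum_ge0E => [n|]; first exact: exprn_ge0.
  rewrite -nneseries_esumT; last by move=> n; rewrite lee_fin exprn_ge0.
  apply/cvg_lim => //; rewrite -[(1 - r)^-1]mul1r.
  have rn : `|r| < 1 by rewrite ger0_norm.
  apply: cvg_EFin; first by near=> n; rewrite sumEFin.
  have := @cvg_geometric_series R 1 r rn.
  apply: cvg_trans; apply: near_eq_cvg; near=> n => /=.
  by rewrite sumEFin; apply: eq_bigr => i _; rewrite /= mul1r.
(* Integers are coded by sign and absolute value. The pair [(true, 0)] codes no integer, so [F] is
   set to 0 there. *)
pose F (x : bool * nat) := if ~~ x.1 || (0 < x.2)%N then r ^+ x.2 else 0.
have [S FS _] : exists2 S, has_sum F S & S <= 2 * (1 - r)^-1.
  apply: (@has_sum_le_ex _ _ _ (fun x : bool * nat => r ^+ x.2)).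
    by move=> x; rewrite /F; case: ifP; rewrite ?lexx ?exprn_ge0.
  apply: (has_sum_tonelli (g := fun=> (1 - r)^-1)) => [x|b|].
  - exact: exprn_ge0.
  - exact: H.
  - have := @has_sum_finite R bool bool id (fun=> (1 - r)^-1) (fun _ _ => id).
    by rewrite sumr_const card_bool mulr_natl; apply => y /(_ y); rewrite eqxx.
exists S.
apply: (eq_has_sum (f := F \o (fun m : int => (m < 0, absz m)))).
  by case=> n; rewrite /F /= ?ltz_nat.
apply: has_sum_inj FS => [|[b n] bn].
  by move=> m m' [] + ?; lia.
rewrite /F /=; case: ifP => // H1; case: bn.
exists (if b then - (n%:Z) else n%:Z) => //.
by case: b H1 => /=; [case: n => // n _; congr (_, _); lia|move=> _; congr (_, _); lia].
Unshelve. all: by end_near.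
Qed.

End Bounds.

(** * The theta identity in one variable *)

Section Theta1.
Variable R : realType.

(** Real part of [e^(ic)] times a Gaussian centred at [a] and twisted by the character of frequency
    [b]; varying [c] recovers the imaginary part as well. *)
Definition theta_shift (g a b c : R) (m : int) : R :=
  expR (- (pi * g * (m%:~R - a) ^+ 2)) * cos (2 * pi * m%:~R * b + c).

(** Poisson transform of [theta_shift]: up to the factor [Num.sqrt g], term [k] is the Fourier
    integral of the twisted Gaussian at frequency [k + b]. *)
Definition theta_dual (g a b c : R) (k : int) : R :=
  expR (- (pi / g * (k%:~R + b) ^+ 2)) * cos (2 * pi * a * (k%:~R + b) + c).

Definition central_weight (n : nat) : R :=
  Num.sqrt n.+1%:R * 'C(n.+1.*2, n.+1)%:R / 2 ^+ n.+1.*2.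

Section Limit.
Variables (g : R) (g0 : 0 < g).

Let rt (n : nat) : R := Num.sqrt n.+1%:R.
Let Q : R := Num.sqrt (pi * g).
(* l n is odd and l n / sqrt (n + 1) tends to sqrt (pi g). *)
Let p (n : nat) : nat := Num.truncn (rt n * Q / 2).
Let l (n : nat) : nat := (p n).*2.+1.
Let q (n : nat) : R := (l n)%:R / rt n.

Lemma rt_gt0 n : 0 < rt n. Proof. by rewrite sqrtr_gt0. Qed.

Lemma rt_sqr n : rt n ^+ 2 = n.+1%:R. Proof. by rewrite sqr_sqrtr. Qed.

Lemma Q_gt0 : 0 < Q. Proof. by rewrite sqrtr_gt0 mulr_gt0 ?pi_gt0. Qed.

Lemma Q_sqr : Q ^+ 2 = pi * g.
Proof. by rewrite sqr_sqrtr // mulr_ge0 ?pi_ge0 ?ltW. Qed.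

Lemma l_gt0 n : 0 < (l n)%:R :> R. Proof. by rewrite ltr0n. Qed.

Lemma l_itv n : (l n)%:R - 1 <= rt n * Q < (l n)%:R + 1.
Proof.
have x0 : 0 <= rt n * Q / 2 by rewrite divr_ge0 // mulr_ge0 // ltW ?rt_gt0 ?Q_gt0.
have := truncn_itv x0; rewrite -/(p n) -[(p n).+1%:R]natr1 => /andP[H1 H2].
have -> : (l n)%:R = 2 * (p n)%:R + 1 :> R by rewrite /l -natr1 -muln2 natrM mulrC.
by apply/andP; split; lra.
Qed.

Lemma q_gt0 n : 0 < q n. Proof. by rewrite divr_gt0 ?l_gt0 ?rt_gt0. Qed.

Lemma lqE n : (l n)%:R = q n * rt n.
Proof. by rewrite divfK // gt_eqF // rt_gt0. Qed.

(** From [l >= 1] one gets [rt Q <= l + 1 <= 2 l]. This bound and [q_upper] hold for every [n],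
    which makes the majorants of [A] and [F] independent of [n]. *)
Lemma q_lower n : Q / 2 <= q n.
Proof.
rewrite ler_pdivlMr ?rt_gt0 // mulrAC ler_pdivrMr // [Q * _]mulrC.
have := l_itv n => /andP[_]; have : 1 <= (l n)%:R :> R by rewrite ler1n.
lra.
Qed.

Lemma rt_ge1 n : 1 <= rt n.
Proof. by rewrite -sqrtr1 ler_sqrt // ler1n. Qed.

Lemma q_upper n : q n <= Q + 1.
Proof.
rewrite ler_pdivrMr ?rt_gt0 // mulrDl mul1r [Q * _]mulrC.
have := l_itv n => /andP[]; have := rt_ge1 n; lra.
Qed.

Lemma cvg_rtV : (fun n => (rt n)^-1) @ \oo --> (0 : R).
Proof.
rewrite -[X in _ --> X](sqrtr0 R).
have H : (fun n => n.+1%:R^-1 : R) @ \oo --> (0 : R) by exact: cvg_harmonic.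
have -> : (fun n => (rt n)^-1) = (fun n => Num.sqrt (n.+1%:R^-1 : R)).
  by apply/funext => n; rewrite sqrtrV.
by apply: continuous_cvg H; exact: sqrt_continuous.
Qed.

Lemma cvg_q : q @ \oo --> Q.
Proof.
apply: (squeeze_cvgr (f := fun n => Q - (rt n)^-1) (h := fun n => Q + (rt n)^-1)).
- near=> n; have r0 := rt_gt0 n; have /andP[l1 l2] := l_itv n.
  apply/andP; split.
    rewrite ler_pdivlMr // mulrBl mulVf ?gt_eqF //; lra.
  rewrite ler_pdivrMr // mulrDl mulVf ?gt_eqF //; lra.
- by rewrite -[X in _ --> X]subr0; apply: cvgB cvg_rtV; exact: cvg_cst.
- by rewrite -[X in _ --> X]addr0; apply: cvgD cvg_rtV; exact: cvg_cst.
Unshelve. all: by end_near.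
Qed.

Lemma cvg_lV : (fun n => ((l n)%:R)^-1) @ \oo --> (0 : R).
Proof.
have -> : (fun n => ((l n)%:R)^-1) = (fun n => (q n)^-1 * (rt n)^-1).
  by apply/funext => n; rewrite lqE invfM.
rewrite -[X in _ --> X](mulr0 Q^-1); apply: cvgM cvg_rtV.
by apply: cvgV cvg_q; rewrite gt_eqF // Q_gt0.
Qed.

Variables (a b c : R).
Hypothesis b2 : `|b| <= 2^-1.

(** The finite formula only allows integer shifts, so the real shift [a] is approximated by
    [t = s / l]. *)
Let s (n : nat) : int := Num.floor (a * (l n)%:R).

Let t (n : nat) : R := (s n)%:~R / (l n)%:R.

Lemma t_itv n : a - (l n)%:R^-1 <= t n <= a.
Proof.
have /andP[H1 H2] := floor_itv (a * (l n)%:R); have l0 := l_gt0 n.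
rewrite intrD in H2; apply/andP; split; last by rewrite ler_pdivrMr.
rewrite ler_pdivlMr // mulrBl mulVf ?gt_eqF //.
by rewrite lerBlDr ltW.
Qed.

Lemma cvg_t : t @ \oo --> a.
Proof.
apply: (squeeze_cvgr (f := fun n => a - (l n)%:R^-1) (h := fun=> a)).
- by near=> n; exact: t_itv.
- by rewrite -[X in _ --> X]subr0; apply: cvgB cvg_lV; exact: cvg_cst.
- exact: cvg_cst.
Unshelve. all: by end_near.
Qed.

Lemma t_le n : `|t n| <= `|a| + 1.
Proof.
have /andP[H1 H2] := t_itv n.
have : (l n)%:R^-1 <= 1 :> R by rewrite invf_le1 ?ler1n ?l_gt0.
by have := ler_norm a; have := ler_norm (- a); rewrite normrN ler_norml => *; apply/andP; split; lra.
Qed.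

Let B0 (n : nat) : R := 'C(n.+1.*2, n.+1)%:R.
Let kappa (n : nat) : R := (l n)%:R * B0 n / 2 ^+ n.+1.*2.

Lemma B0_gt0 n : 0 < B0 n.
Proof. by rewrite ltr0n bin_gt0 -addnn leq_addr. Qed.

(** Left side of [has_sum_bin_poisson] for [n.+1], divided by the central binomial coefficient so
    that each term has a Gaussian limit. *)
Let A (n : nat) (m : int) : R :=
  'C(n.+1.*2, n.+1 + absz (m * (l n)%:Z - s n)%R)%:R / B0 n * cos (2 * pi * m%:~R * b + c).

Let x n (k : int) : R := (k%:~R + b) / (l n)%:R.

(** Right side of the finite formula with [k = i - p], freed from its power of 2 (kept in [kappa])
    and extended by zero to all integers, so that [tannery] applies. *)
Let F (n : nat) (k : int) : R := if (absz k <= p n)%N then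
  cos (pi * x n k) ^+ n.+1.*2 * cos (2 * pi * (s n)%:~R * x n k + c) else 0.

Let rho n := \sum_(i < l n) F n (i%:Z - (p n)%:Z).

Lemma F_sum n : has_sum (F n) (rho n).
Proof.
apply: (has_sum_finite (e := fun i : 'I_(l n) => i%:Z - (p n)%:Z)) => [i j /addIr[/val_inj] //|k kA].
rewrite /F; case: ifP => // kp.
have kl : (absz (k + (p n)%:Z)%R < l n)%N by move: (k : int) kp => {kA}k; rewrite /l; lia.
by have /eqP[] := kA (Ordinal kl) => /=; lia.
Qed.

Lemma A_sum n : has_sum (A n) (rho n / kappa n).
Proof.
have := has_sum_bin_poisson n.+1 (p n) (s n) b c.
move=> /(has_sumZ (B0 n)^-1); rewrite -/(l n) => H.
have -> : rho n / kappa n = (B0 n)^-1 * ((l n)%:R^-1 * \sum_(i < l n)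
   (2 * cos (pi * ((i%:R - (p n)%:R + b) / (l n)%:R))) ^+ n.+1.*2 *
   cos (2 * pi * (s n)%:~R * ((i%:R - (p n)%:R + b) / (l n)%:R) + c)).
  rewrite (_ : \sum_(i < l n) _ = 2 ^+ n.+1.*2 * rho n).
    have B := B0_gt0 n; have l0 := l_gt0 n.
    have e0 : 2 ^+ n.+1.*2 != 0 :> R by rewrite expf_neq0 // pnatr_eq0.
    by rewrite /kappa; field; rewrite e0 !gt_eqF.
  rewrite mulr_sumr; apply: eq_bigr => i _.
  rewrite /F ifT; last by have := ltn_ord i; rewrite /l; lia.
  by rewrite exprMn /x intrB -!pmulrn mulrA.
by apply: eq_has_sum H => m; rewrite /A mulrA [_^-1 * _]mulrC.
Qed.

Let j (n : nat) (m : int) : nat := absz (m * (l n)%:Z - s n)%R.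

Lemma jE n m : (j n m)%:R = `|m%:~R - t n| * (l n)%:R.
Proof.
have l0 := l_gt0 n.
rewrite -[X in _ * X]ger0_norm ?ltW // -normrM mulrBl divfK ?gt_eqF //.
by rewrite pmulrn abszE intr_norm intrB intrM -pmulrn.
Qed.

(** With [N = n.+1] and [j <= N], [j^2 / (N + j) >= j^2 / (2 N) = (m - t)^2 q^2 / 2], and
    [q >= Q / 2] yields the constant [Q^2 / 8]. For [j > N] the coefficient is zero. *)
Lemma A_bound n m : `|A n m| <=
  expR (Q ^+ 2 / 8 * (`|a| + 1) ^+ 2) * expR (- (Q ^+ 2 / 8 / 2)) ^+ absz m.
Proof.
have B := B0_gt0 n; have Q0 := Q_gt0.
apply: (@le_trans _ _ (expR (- (Q ^+ 2 / 8 * (m%:~R - t n) ^+ 2)))); last first.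
  by apply: expR_shift_bound (t_le n); rewrite divr_gt0 // exprn_gt0.
rewrite /A normrM -[leRHS]mulr1; apply: ler_pM => //; last exact: cos_max.
rewrite ger0_norm ?divr_ge0 ?(ltW B) // ler_pdivrMr // -/(j n m).
have [jn|nj] := leqP (j n m) n.+1; last first.
  by rewrite bin_small ?mulr_ge0 ?expR_ge0 ?(ltW B) // -addnn ltn_add2l.
apply: le_trans (bin_upper _ jn) _.
rewrite ler_wpM2r ?(ltW B) // ler_expR lerN2.
have n0 : 0 < n.+1%:R :> R by rewrite ltr0n.
apply: (@le_trans _ _ ((j n m)%:R ^+ 2 / (2 * n.+1%:R))); last first.
  have jn' : (j n m)%:R <= n.+1%:R :> R by rewrite ler_nat.
  have j0 : 0 <= (j n m)%:R :> R by [].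
  rewrite ler_wpM2l ?sqr_ge0 // lef_pV2 ?posrE ?mulr_gt0 //; lra.
have r0 := rt_gt0 n.
have -> : (j n m)%:R ^+ 2 / (2 * n.+1%:R) = (m%:~R - t n) ^+ 2 * (q n ^+ 2 / 2).
  rewrite -(rt_sqr n) jE lqE exprMn real_normK ?num_real //; move: (q n) (rt n) r0 => u v v0; field.
  by rewrite gt_eqF.
rewrite mulrC ler_wpM2l ?sqr_ge0 //.
have := q_lower n => qQ.
have : (Q / 2) ^+ 2 <= q n ^+ 2 by rewrite lerXn2r ?nnegrE // ltW ?q_gt0 ?divr_gt0.
rewrite exprMn; lra.
Qed.

(** Here [z = j / rt] tends to [|m - a| Q], and the exponents of [bin_lower] and [bin_upper] become
    [z^2 / (1 - z / rt)] and [z^2 / (1 + z / rt)], with the common limit [pi g (m - a)^2]. *)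
Lemma A_cvg m : (fun n => A n m) @ \oo --> theta_shift g a b c m.
Proof.
pose z n : R := `|m%:~R - t n| * q n.
have zc : z @ \oo --> `|m%:~R - a| * Q.
  by apply: cvgM cvg_q; apply: cvg_norm; apply: cvgB cvg_t; exact: cvg_cst.
have zr : (fun n => z n / rt n) @ \oo --> (0 : R).
  by rewrite -[X in _ --> X](mulr0 (`|m%:~R - a| * Q)); apply: cvgM zc cvg_rtV.
have zr1 : \forall n \near \oo, z n / rt n < 1 by exact: (cvgr_lt 0 zr).
have jz n : (j n m)%:R = z n * rt n by rewrite jE lqE mulrA.
have E : pi * g * (m%:~R - a) ^+ 2 = (`|m%:~R - a| * Q) ^+ 2.
  by rewrite exprMn Q_sqr real_normK ?num_real // mulrC.
have z2 : (fun n => z n ^+ 2) @ \oo --> (`|m%:~R - a| * Q) ^+ 2.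
  by rewrite expr2; under eq_fun do rewrite expr2; apply: cvgM.
apply: cvgM; last exact: cvg_cst.
rewrite E.
apply: (squeeze_cvgr (f := fun n => expR (- (z n ^+ 2 / (1 - z n / rt n))))
   (h := fun n => expR (- (z n ^+ 2 / (1 + z n / rt n))))).
- near=> n.
  have r0 := rt_gt0 n.
  have n0 : 0 < n.+1%:R :> R by rewrite ltr0n.
  have zn1 : z n / rt n < 1 by near: n.
  have z0 : 0 <= z n / rt n := divr_ge0 (mulr_ge0 (normr_ge0 _) (ltW (q_gt0 n))) (ltW r0).
  have nE : n.+1%:R = rt n * rt n by rewrite -rt_sqr expr2.
  have jn : (j n m < n.+1)%N.
    by move: (zn1); rewrite ltr_pdivrMr // mul1r => zn2; rewrite -(ltr_nat R) jz nE ltr_pM2r.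
  rewrite ler_pdivlMr ?B0_gt0 // ler_pdivrMr ?B0_gt0 //.
  pose u := z n / rt n; have zE : z n = u * rt n by rewrite divfK // gt_eqF.
  have u1 : u < 1 := zn1; have u0 : 0 <= u := z0.
  have P1 : 0 < (1 + u) * (rt n * rt n) by rewrite !mulr_gt0 //; lra.
  have P2 : 0 < (1 - u) * (rt n * rt n) by rewrite !mulr_gt0 // subr_gt0.
  have := bin_lower R jn; have := bin_upper R (ltnW jn).
  have -> : (j n m)%:R ^+ 2 / (n.+1%:R + (j n m)%:R) = z n ^+ 2 / (1 + z n / rt n).
    by rewrite -/u jz nE zE; field; rewrite !gt_eqF //; lra.
  have -> : (j n m)%:R ^+ 2 / (n.+1%:R - (j n m)%:R) = z n ^+ 2 / (1 - z n / rt n).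
    by rewrite -/u jz nE zE; field; rewrite !gt_eqF //; lra.
  by move=> -> ->.
- apply: cvg_expR; apply: cvgN; rewrite -[X in _ --> X]divr1; apply: cvgM => //.
  have H1 : (fun n => 1 - z n / rt n) @ \oo --> (1 - 0 : R) by apply: cvgB zr; exact: cvg_cst.
  by rewrite subr0 in H1; apply: cvgV H1; rewrite oner_eq0.
- apply: cvg_expR; apply: cvgN; rewrite -[X in _ --> X]divr1; apply: cvgM => //.
  have H1 : (fun n => 1 + z n / rt n) @ \oo --> (1 + 0 : R) by apply: cvgD zr; exact: cvg_cst.
  by rewrite addr0 in H1; apply: cvgV H1; rewrite oner_eq0.
Unshelve. all: by end_near.
Qed.

Let y n k := pi * x n k.

(** Here [|b| <= 1/2] and [l = 2 p + 1] meet: [|k + b| <= p + 1/2 = l / 2], so the angle stays where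
    the cosine is nonnegative. *)
Lemma y_small n k : (absz k <= p n)%N -> `|y n k| <= pi / 2.
Proof.
move=> kp; have l0 := l_gt0 n.
rewrite /y normrM ger0_norm ?pi_ge0 // ler_wpM2l ?pi_ge0 // /x normrM normfV normr_nat ler_pdivrMr //.
have kp' : (absz k)%:R <= (p n)%:R :> R by rewrite ler_nat.
have kE : (absz k)%:R = `|k%:~R| :> R by rewrite pmulrn abszE intr_norm.
have -> : (l n)%:R = 2 * (p n)%:R + 1 :> R by rewrite /l -natr1 -muln2 natrM mulrC.
apply: le_trans (ler_normD _ _) _; rewrite -kE.
by move: b2 kp'; lra.
Qed.

Lemma ny2 n k : n.+1%:R * y n k ^+ 2 = pi ^+ 2 * (k%:~R + b) ^+ 2 / q n ^+ 2.
Proof.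
rewrite /y /x lqE -(rt_sqr n); have := q_gt0 n; have := rt_gt0 n.
by move: (q n) (rt n) => u v u0 v0; field; rewrite !gt_eqF.
Qed.

(** By [cos_pow_le] the exponent is half of [ny2], and [q <= Q + 1] removes [n] from it. The shift
    is [- b], bounded by [1/2]. *)
Lemma F_bound n k : `|F n k| <=
  expR (pi ^+ 2 / (2 * (Q + 1) ^+ 2) * (2^-1) ^+ 2) *
  expR (- (pi ^+ 2 / (2 * (Q + 1) ^+ 2) / 2)) ^+ absz k.
Proof.
have Q0 := Q_gt0; have pi0 := pi_gt0 R.
have Q1 : 0 < (Q + 1) ^+ 2 by rewrite exprn_gt0 // addr_gt0.
have d0 : 0 < pi ^+ 2 / (2 * (Q + 1) ^+ 2) by apply: divr_gt0; [exact: exprn_gt0|exact: mulr_gt0].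
rewrite /F; case: ifP => kp; last first.
  by rewrite normr0 mulr_ge0 // ?exprn_ge0 // expR_ge0.
apply: (@le_trans _ _ (expR (- (pi ^+ 2 / (2 * (Q + 1) ^+ 2) * (k%:~R - - b) ^+ 2)))); last first.
  by apply: expR_shift_bound; rewrite ?normrN.
have /andP[c0 c1] := cos_pow_le n.+1 (y_small kp).
rewrite normrM -[leRHS]mulr1; apply: ler_pM => //; last exact: cos_max.
rewrite ger0_norm //; apply: le_trans c1 _; rewrite ny2 opprK ler_expR lerN2.
have -> : pi ^+ 2 / (2 * (Q + 1) ^+ 2) * (k%:~R + b) ^+ 2 =
   pi ^+ 2 * (k%:~R + b) ^+ 2 * ((Q + 1) ^+ 2)^-1 / 2 by field; rewrite gt_eqF // addr_gt0.
apply: ler_wpM2r => //; apply: ler_wpM2l.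
  by apply: mulr_ge0; exact: sqr_ge0.
have q0 := q_gt0 n; have Q2 : 0 < Q + 1 by rewrite addr_gt0.
rewrite lef_pV2 ?posrE ?exprn_gt0 //.
by apply: lerXn2r; rewrite ?nnegrE ?q_upper // ltW // addr_gt0.
Qed.

(** The even power of the cosine is [(1 - sin^2)^(n.+1)], and [n.+1 sin^2] has the same limit as
    [ny2], namely [pi / g (k + b)^2] because [Q^2 = pi g]. *)
Lemma F_cvg k : F ^~ k @ \oo --> theta_dual g a b c k.
Proof.
have yc : y ^~ k @ \oo --> (0 : R).
  rewrite -[X in _ --> X](mulr0 pi); apply: cvgM; first exact: cvg_cst.
  rewrite -[X in _ --> X](mulr0 (k%:~R + b)); apply: cvgM; first exact: cvg_cst.
  exact: cvg_lV.
have lk : \forall n \near \oo, ((l n)%:R^-1 : R) < ((absz k).*2.+1%:R)^-1.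
  by apply: (cvgr_lt 0 cvg_lV); rewrite invr_gt0.
have L : (fun n => n.+1%:R * y n k ^+ 2) @ \oo --> pi / g * (k%:~R + b) ^+ 2.
  have -> : pi / g * (k%:~R + b) ^+ 2 = pi ^+ 2 * (k%:~R + b) ^+ 2 / Q ^+ 2.
    by rewrite Q_sqr; have := pi_gt0 R; move: (pi : R) g0 => w u v; field; rewrite !gt_eqF.
  rewrite (_ : (fun n => _) = (fun n => pi ^+ 2 * (k%:~R + b) ^+ 2 / q n ^+ 2)); last first.
    by apply/funext => n; exact: ny2.
  apply: cvgM; first exact: cvg_cst.
  apply: cvgV; first by rewrite expf_neq0 // gt_eqF // Q_gt0.
  by rewrite expr2; under eq_fun do rewrite expr2; apply: cvgM cvg_q cvg_q.
have U0 : (fun n => sin (y n k) ^+ 2) @ \oo --> (0 : R).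
  have -> : 0 = sin 0 * sin 0 :> R by rewrite sin0 mul0r.
  under eq_fun do rewrite expr2.
  by apply: cvgM; apply: continuous_cvg yc; exact: continuous_sin.
have U1 : (fun n => n.+1%:R * sin (y n k) ^+ 2) @ \oo --> pi / g * (k%:~R + b) ^+ 2.
  apply: (squeeze_cvgr (f := fun n => n.+1%:R * y n k ^+ 2 * cos (y n k) ^+ 2) (h := fun n => n.+1%:R * y n k ^+ 2)).
  - near=> n.
    have kp : (absz k <= p n)%N.
      have : ((l n)%:R^-1 : R) < ((absz k).*2.+1%:R)^-1 by near: n.
      by rewrite ltf_pV2 ?posrE // ltr_nat /l; lia.
    by have /andP[h1 h2] := sin2_bounds (y_small kp); rewrite -mulrA !ler_wpM2l.
  - rewrite -[X in _ --> X]mulr1; apply: cvgM => //.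
    have -> : 1 = cos 0 * cos 0 :> R by rewrite cos0 mul1r.
    by under eq_fun do rewrite expr2; apply: cvgM; exact: cvg_cos.
  - exact: L.
have H := cvg_pow_expR (fun n => sqr_ge0 _) U0 U1.
have H' : (fun n => (1 - sin (y n k) ^+ 2) ^+ n.+1 * cos (2 * pi * (s n)%:~R * x n k + c)) @ \oo -->
    theta_dual g a b c k.
  apply: cvgM => //; apply: cvg_cos; apply: cvgD; last exact: cvg_cst.
  rewrite (_ : (fun n => _) = (fun n => 2 * pi * t n * (k%:~R + b))); last first.
    by apply/funext => n; rewrite /t /x; field; rewrite gt_eqF // l_gt0.
  by apply: cvgM; [apply: cvgM cvg_t; exact: cvg_cst|exact: cvg_cst].
apply: cvg_trans H'; apply: near_eq_cvg; near=> n.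
rewrite /F ifT; last first.
  have : ((l n)%:R^-1 : R) < ((absz k).*2.+1%:R)^-1 by near: n.
  by rewrite ltf_pV2 ?posrE // ltr_nat /l; lia.
congr (_ * _); rewrite -mul2n exprM; congr (_ ^+ _).
by rewrite -(cos2Dsin2 (y n k)) addrK.
Unshelve. all: by end_near.
Qed.

(** Both sides of the finite formula pass to the limit by [tannery]. [central_weight] stays in the
    relation, since its limit is not known at this point. *)
Lemma theta_limit : exists (q' sA sF : nat -> R) (S T : R),
  [/\ has_sum (theta_shift g a b c) S, has_sum (theta_dual g a b c) T,
      q' @ \oo --> Num.sqrt (pi * g),
      sA @ \oo --> S /\ sF @ \oo --> T &
      forall n, q' n * central_weight n * sA n = sF n].
Proof.
have Q0 := Q_gt0; have pi0 := pi_gt0 R.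
have geo (d C : R) : 0 < d -> exists G, has_sum (fun m : int => C * expR (- d) ^+ absz m) G.
  move=> d0; have [|G HG] := @has_sum_geometric_int R (expR (- d)).
    by rewrite expR_ge0 /= -expR0 ltr_expR oppr_lt0.
  by exists (C * G); exact: has_sumZ.
have [G1 HG1] : exists G, has_sum (fun m : int => expR (Q ^+ 2 / 8 * (`|a| + 1) ^+ 2) *
    expR (- (Q ^+ 2 / 8 / 2)) ^+ absz m) G.
  by apply: geo; rewrite !divr_gt0 // exprn_gt0.
have [G2 HG2] : exists G, has_sum (fun m : int =>
    expR (pi ^+ 2 / (2 * (Q + 1) ^+ 2) * (2^-1) ^+ 2) *
    expR (- (pi ^+ 2 / (2 * (Q + 1) ^+ 2) / 2)) ^+ absz m) G.
  apply: geo; rewrite !divr_gt0 // ?exprn_gt0 // mulr_gt0 // exprn_gt0 //.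
  exact: addr_gt0.
have [S HS sA] := tannery A_bound HG1 A_cvg A_sum.
have [T HT sF] := tannery F_bound HG2 F_cvg F_sum.
exists q, (fun n => rho n / kappa n), rho, S, T; split => // [|n]; first exact: cvg_q.
have -> : q n * central_weight n = kappa n.
  by rewrite /central_weight /kappa lqE !mulrA.
rewrite mulrC divfK // gt_eqF //; apply: divr_gt0; last exact: exprn_gt0.
by apply: mulr_gt0; [exact: l_gt0|exact: B0_gt0].
Qed.

End Limit.

Lemma theta_shift0_gt0 g S : 0 < g -> has_sum (theta_shift g 0 0 0) S -> 0 < S.
Proof.
move=> g0 H.
have f0 (m : int) : 0 <= theta_shift g 0 0 0 m.
  by rewrite /theta_shift mulr0 addr0 cos0 mulr1 expR_ge0.
apply: (lt_le_trans _ (has_sum_ge_term 0 f0 H)).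
by rewrite /theta_shift mulr0 addr0 cos0 mulr1 expR_gt0.
Qed.

(** For [g = 1] and zero characteristics the two families coincide, so [T = S > 0]; dividing the
    relation of [theta_limit] by [q sA] determines the limit. *)
Lemma central_weight_cvg : central_weight @ \oo --> (Num.sqrt pi)^-1.
Proof.
have b2 : `|0 : R| <= 2^-1 by rewrite normr0 invr_ge0.
have [q [sA [sF [S [T [HS HT qc [sAc sFc] E]]]]]] := @theta_limit 1 ltr01 0 0 0 b2.
have TS : T = S.
  apply: has_sum_unique HT _; apply: eq_has_sum HS => m.
  by rewrite /theta_shift /theta_dual !mulr0 !mul0r divr1 mulr1 subr0 !addr0.
have S0 := theta_shift0_gt0 ltr01 HS.
have sp : 0 < Num.sqrt (pi : R) by rewrite sqrtr_gt0 pi_gt0.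
rewrite mulr1 in qc.
have qsA : (fun n => q n * sA n) @ \oo --> Num.sqrt pi * S by exact: cvgM.
have lim : (fun n => sF n / (q n * sA n)) @ \oo --> (Num.sqrt pi)^-1.
  have -> : (Num.sqrt pi)^-1 = T / (Num.sqrt pi * S) by rewrite TS; field; rewrite !gt_eqF.
  by apply: cvgM sFc _; apply: cvgV qsA; rewrite gt_eqF // mulr_gt0.
apply: cvg_trans lim; apply: near_eq_cvg; near=> n.
have qs0 : 0 < q n * sA n by near: n; apply: (cvgr_gt _ qsA); exact: mulr_gt0.
by rewrite -E [q n * _ * _]mulrAC [_ * central_weight n]mulrC mulfK // gt_eqF.
Unshelve. all: by end_near.
Qed.

Lemma theta1_half g a b c : 0 < g -> `|b| <= 2^-1 ->
  exists2 S, has_sum (theta_shift g a b c) S & has_sum (theta_dual g a b c) (Num.sqrt g * S).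
Proof.
move=> g0 b2.
have [q [sA [sF [S [T [HS HT qc [sAc sFc] E]]]]]] := @theta_limit g g0 a b c b2.
exists S => //; suff <- : T = Num.sqrt g * S by [].
have sp : 0 < Num.sqrt (pi : R) by rewrite sqrtr_gt0 pi_gt0.
have H : (fun n => q n * central_weight n * sA n) @ \oo --> Num.sqrt (pi * g) / Num.sqrt pi * S.
  by apply: cvgM sAc; apply: cvgM qc _; exact: central_weight_cvg.
rewrite (funext E) in H.
rewrite -(cvg_lim _ sFc) // (cvg_lim _ H) //.
by rewrite sqrtrM ?pi_ge0 // [_ * Num.sqrt g]mulrC mulfK // gt_eqF.
Unshelve. all: by end_near.
Qed.

Lemma theta1 g a b c : 0 < g ->
  exists2 S, has_sum (theta_shift g a b c) S & has_sum (theta_dual g a b c) (Num.sqrt g * S).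
Proof.
(* Subtracting the nearest integer [r] brings [b] into [[-1/2, 1/2]]. It changes the cosines of
   [theta_shift] by full periods and merely reindexes [theta_dual]. *)
move=> g0; pose r := Num.floor (b + 2^-1).
have /andP[r1 r2] := floor_itv (b + 2^-1); rewrite -/r intrD in r1 r2.
have b2 : `|b - r%:~R| <= 2^-1 by rewrite ler_norml; apply/andP; split; lra.
have [S HS HT] := theta1_half a c g0 b2.
exists S.
  apply: eq_has_sum HS => m; rewrite /theta_shift -[in RHS](cosD2piz _ (- (m * r))).
  by congr (_ * cos _); rewrite intrN intrM; ring.
apply/(has_sum_reindex (e := fun k => k - r)).
  by exists (fun k => k + r) => k; rewrite ?addrK ?subrK.
apply: eq_has_sum HT => k /=; rewrite /theta_dual intrB.
by congr (expR (- (_ * _ ^+ 2)) * cos (_ * _ + _)); ring.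
Qed.

End Theta1.

(** * The theta identity for positive definite forms *)

Section ThetaN.
Variable R : realType.

Definition dot n (u v : 'rV[R]_n) : R := (u *m v^T) 0 0.
Definition qf n (G : 'M[R]_n) (v : 'rV[R]_n) : R := (v *m G *m v^T) 0 0.
Definition posdef n (G : 'M[R]_n) := G^T = G /\ forall v, v != 0 -> 0 < qf G v.

Local Notation intv := (map_mx (intr : int -> R)).

Lemma dotZl n (a : R) (u v : 'rV[R]_n) : dot (a *: u) v = a * dot u v.
Proof. by rewrite /dot -scalemxAl mxE. Qed.

Lemma dotBl n (u v w : 'rV[R]_n) : dot (u - v) w = dot u w - dot v w.
Proof. by rewrite /dot mulmxBl !mxE. Qed.

Lemma dotC n (u v : 'rV[R]_n) : dot u v = dot v u.
Proof. by rewrite /dot -[u *m v^T]trmxK mxE trmx_mul trmxK. Qed.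

(** By [theta1] the sum is [1 / sqrt g] times a series of cosines in [a] with positive coefficients;
    replacing each cosine by 1 bounds it uniformly. *)
Lemma theta1_bound (g : R) : 0 < g -> exists C, forall a, exists2 S,
  has_sum (fun m : int => expR (- (pi * g * (m%:~R + a) ^+ 2))) S & S <= C.
Proof.
move=> g0; have sg : 0 < Num.sqrt g by rewrite sqrtr_gt0.
have gV : 0 < g^-1 by rewrite invr_gt0.
have [K HK _] := theta1 0 0 0 gV.
exists (K / Num.sqrt g) => a; have [S HS HT] := theta1 (- a) 0 0 g0.
exists S.
  apply: eq_has_sum HS => m; rewrite /theta_shift opprK mulr0 addr0 cos0.
  by rewrite mulr1.
rewrite ler_pdivlMr // mulrC; apply: has_sum_le HT HK => k.
rewrite /theta_dual /theta_shift !addr0 subr0 mulr0 cos0.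
by rewrite ler_wpM2l ?expR_ge0 ?cos_le1.
Qed.

Lemma dual_bound1 (g : R) : 0 < g -> exists C, forall a, exists2 S,
  has_sum (fun m : int => expR (- (pi / g * (m%:~R + a) ^+ 2))) S & S <= C.
Proof. by move=> g0; apply: theta1_bound; rewrite invr_gt0. Qed.

(* The bounds that are uniform in b make the double series in the induction on
   the dimension absolutely convergent. *)
Definition bounded_theta n (Q : 'rV[R]_n -> R) := exists C, forall b, exists2 S,
  has_sum (fun x : 'rV[int]_n => expR (- (pi * Q (intv x + b)))) S & S <= C.

(** [d] stands for the determinant of [Q]. The forms are plain functions, so that a completed square
    can be used before it is recognised as a matrix. A phase only contributes [cos c]: for an even
    [Q] the sine part is odd in [x] and cancels. *)
Definition theta_pair n (Q Q' : 'rV[R]_n -> R) (d : R) :=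
  [/\ 0 < d, bounded_theta Q, bounded_theta Q' &
    forall (b : 'rV[R]_n) c, exists S T,
    [/\ has_sum (fun x : 'rV[int]_n => expR (- (pi * Q (intv x))) * cos (2 * pi * dot b (intv x) + c)) S,
        has_sum (fun y : 'rV[int]_n => expR (- (pi * Q' (intv y + b)))) T &
        Num.sqrt d * S = T * cos c]].

Definition hd n (v : 'rV[R]_(1 + n)) : R := lsubmx v 0 0.
Definition tl n (v : 'rV[R]_(1 + n)) : 'rV[R]_n := rsubmx v.

Definition consz n (x : 'rV[int]_n * int) : 'rV[int]_(1 + n) := row_mx x.2%:M x.1.

Lemma consz_bij n : bijective (@consz n).
Proof.
exists (fun v => (rsubmx v, (lsubmx v : 'rV[int]_1) 0 0)) => [[x k]|v].
  by rewrite /consz row_mxKl row_mxKr mxE.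
by rewrite /consz /= -mx11_scalar hsubmxK.
Qed.

Lemma hd_consz n (x : 'rV[int]_n * int) b : hd (intv (consz x) + b) = x.2%:~R + hd b.
Proof. by rewrite /hd /consz map_row_mx linearD /= row_mxKl !mxE. Qed.

Lemma tl_consz n (x : 'rV[int]_n * int) b : tl (intv (consz x) + b) = intv x.1 + tl b.
Proof. by rewrite /tl /consz map_row_mx linearD /= row_mxKr. Qed.

Lemma hd_consz0 n (x : 'rV[int]_n * int) : hd (intv (consz x)) = x.2%:~R.
Proof. by rewrite -[intv _]addr0 hd_consz /hd linear0 mxE addr0. Qed.

Lemma tl_consz0 n (x : 'rV[int]_n * int) : tl (intv (consz x)) = intv x.1.
Proof. by rewrite -[intv (consz _)]addr0 tl_consz /tl linear0 addr0. Qed.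

Lemma dot_consz n (x : 'rV[int]_n * int) b :
  dot b (intv (consz x)) = hd b * x.2%:~R + dot (tl b) (intv x.1).
Proof.
rewrite /dot -[b in LHS]hsubmxK /consz map_row_mx tr_row_mx mul_row_col [LHS]mxE.
congr (_ + _); rewrite /hd mxE big_ord1 2!mxE; congr (_ * _).
by rewrite !mxE eqxx ?mulr1n.
Qed.

Section Step.
Variables (n : nat) (Q1 Q1' : 'rV[R]_n -> R) (d1 g : R) (l : 'rV[R]_n).
Hypothesis g0 : 0 < g.
Hypothesis pair1 : theta_pair Q1 Q1' d1.

Let Q (v : 'rV[R]_(1 + n)) := g * (hd v + dot l (tl v)) ^+ 2 + Q1 (tl v).
(** The inverse form of [Q] in coordinates: the dual completion of the square acts on the first
    variable alone and shears the others by [l]. *)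
Let Q' (v : 'rV[R]_(1 + n)) := (hd v) ^+ 2 / g + Q1' (tl v - hd v *: l).

Lemma bounded_step : bounded_theta Q.
Proof.
have [_ [C1 H1] _ _] := pair1.
have [Cg Hg] := theta1_bound g0.
exists (Cg * C1) => b.
have C0 : 0 <= Cg.
  have [S HS] := Hg 0; apply: le_trans; apply: has_sum_ge0 HS => *; exact: expR_ge0.
pose h x1 := sval (cid2 (Hg x1)).
have hP x1 : has_sum (fun m : int => expR (- (pi * g * (m%:~R + x1) ^+ 2))) (h x1).
  by rewrite /h; case: cid2.
have hC x1 : 0 <= h x1 <= Cg.
  rewrite {2}/h; case: cid2 => //= ? _ ->; rewrite andbT.
  by apply: has_sum_ge0 (hP x1) => *; exact: expR_ge0.
pose w (x : 'rV[int]_n) := intv x + tl b.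
have [S1 HS1 S1C] := H1 (tl b).
have [S HS SC] : exists2 S, has_sum (fun x => expR (- (pi * Q1 (w x))) * h (hd b + dot l (w x))) S & S <= Cg * S1.
  apply: has_sum_le_ex (has_sumZ Cg HS1) => x.
  have /andP[h1 h2] := hC (hd b + dot l (w x)).
  by rewrite mulr_ge0 ?expR_ge0 //= mulrC ler_wpM2r ?expR_ge0.
exists S; last by apply: le_trans SC _; rewrite ler_wpM2l.
apply/(has_sum_reindex _ _ (@consz_bij n)).
apply: has_sum_tonelli HS => [x|x] /=; first exact: expR_ge0.
apply: eq_has_sum (has_sumZ (expR (- (pi * Q1 (w x)))) (hP (hd b + dot l (w x)))) => m.
rewrite /Q hd_consz tl_consz /= -/(w x) -expRD; congr expR; ring.
Qed.

Lemma bounded_step_dual : bounded_theta Q'.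
Proof.
have [_ _ [C1 H1] _] := pair1.
have [Cg Hg] := dual_bound1 g0.
exists (C1 * Cg) => b.
have C0 : 0 <= C1.
  have [S HS] := H1 0; apply: le_trans; apply: has_sum_ge0 HS => *; exact: expR_ge0.
pose h x1 := sval (cid2 (H1 x1)).
have hP x1 : has_sum (fun x : 'rV[int]_n => expR (- (pi * Q1' (intv x + x1)))) (h x1).
  by rewrite /h; case: cid2.
have hC x1 : 0 <= h x1 <= C1.
  rewrite {2}/h; case: cid2 => //= ? _ ->; rewrite andbT.
  by apply: has_sum_ge0 (hP x1) => *; exact: expR_ge0.
have [S1 HS1 S1C] := Hg (hd b).
pose w (m : int) := tl b - (m%:~R + hd b) *: l.
have [S HS SC] : exists2 S, has_sum (fun m : int =>
   expR (- (pi / g * (m%:~R + hd b) ^+ 2)) * h (w m)) S & S <= C1 * S1.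
  apply: has_sum_le_ex (has_sumZ C1 HS1) => x.
  have /andP[h1 h2] := hC (w x).
  by rewrite mulr_ge0 ?expR_ge0 //= mulrC ler_wpM2r ?expR_ge0.
exists S; last by apply: le_trans SC _; rewrite ler_wpM2l.
apply/(has_sum_reindex _ _ (@consz_bij n)).
pose F (y : int * 'rV[int]_n) := expR (- (pi * Q' (intv (consz (y.2, y.1)) + b))).
apply: (eq_has_sum (f := fun x => F (x.2, x.1))); first by case.
apply: has_sum_swap.
apply: has_sum_tonelli HS => [x|m] /=; first exact: expR_ge0.
apply: eq_has_sum (has_sumZ (expR (- (pi / g * (m%:~R + hd b) ^+ 2))) (hP (w m))) => x.
rewrite /F /Q' hd_consz tl_consz /= -expRD; congr expR.
by rewrite /w addrA; field; rewrite gt_eqF.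
Qed.

(** Poisson summation in one variable at a time: [theta1] in the first coordinate with shift
    [- dot l x], an exchange of the two sums, then the hypothesis on [Q1] for each frequency [k]
    with characteristic [tl b - (k + hd b) l]. *)
Lemma theta_step : theta_pair Q Q' (g * d1).
Proof.
have [d0 [C1 H1] [C1' H1'] E1] := pair1.
split; [exact: mulr_gt0|exact: bounded_step|exact: bounded_step_dual|].
move=> b c.
pose f (x : 'rV[int]_n * int) := expR (- (pi * Q (intv (consz x)))) *
  cos (2 * pi * dot b (intv (consz x)) + c).
have [S HS] : exists S, has_sum f S.
  have [C HC] := bounded_step; have [S HS _] := HC 0.
  move/(has_sum_reindex _ _ (@consz_bij n)) : HS => HS.
  have [|t Ht _] := has_sum_dominated (f := f) _ HS; last by exists t; exact: Ht.
  move=> x /=; rewrite addr0 normrM ger0_norm ?expR_ge0 // -[leRHS]mulr1.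
  by rewrite ler_wpM2l ?expR_ge0 ?cos_max.
have [C HC] := bounded_step_dual; have [T HT _] := HC b.
exists S, T; split; [by apply/(has_sum_reindex _ _ (@consz_bij n))|by []|].
pose a (x : 'rV[int]_n) := - dot l (intv x).
pose cx (x : 'rV[int]_n) := 2 * pi * dot (tl b) (intv x) + c.
pose s x := sval (cid2 (theta1 (a x) (hd b) (cx x) g0)).
have sP x : has_sum (theta_shift g (a x) (hd b) (cx x)) (s x) /\
    has_sum (theta_dual g (a x) (hd b) (cx x)) (Num.sqrt g * s x).
  by rewrite /s; case: cid2.
have Hs : has_sum (fun x => expR (- (pi * Q1 (intv x))) * s x) S.
  apply: has_sum_iter HS _ => x.
  apply: eq_has_sum (has_sumZ _ (sP x).1) => m.
  rewrite /f /Q /theta_shift hd_consz0 tl_consz0 dot_consz /= mulrA -expRD /a /cx.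
  by congr (expR _ * cos _); ring.
(* The half-transformed double family, dual in the first coordinate only. Its absolute summability
   is what permits evaluating it in both orders. *)
pose h (x : 'rV[int]_n * int) := expR (- (pi * Q1 (intv x.1))) *
   expR (- (pi / g * (x.2%:~R + hd b) ^+ 2)) *
   cos (2 * pi * dot (tl b - (x.2%:~R + hd b) *: l) (intv x.1) + c).
have [Hh HhP] : exists Hh, has_sum h Hh.
  have [S1 HS1 _] := H1 0; have [Cg Hg] := dual_bound1 g0; have [S2 HS2 _] := Hg (hd b).
  have HH : has_sum (fun x : 'rV[int]_n * int => expR (- (pi * Q1 (intv x.1))) *
     expR (- (pi / g * (x.2%:~R + hd b) ^+ 2))) (S2 * S1).
    apply: has_sum_tonelli (has_sumZ S2 HS1) => [x|x].
      by rewrite mulr_ge0 ?expR_ge0.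
    by rewrite [S2 * _]mulrC; apply: eq_has_sum (has_sumZ _ HS2) => m; rewrite addr0.
  have [|t Ht _] := has_sum_dominated (f := h) _ HH; last by exists t; exact: Ht.
  move=> x; rewrite /h normrM ger0_norm ?mulr_ge0 ?expR_ge0 // -[leRHS]mulr1.
  by rewrite ler_wpM2l ?mulr_ge0 ?expR_ge0 ?cos_max.
have EH : Hh = Num.sqrt g * S.
  apply: has_sum_unique (has_sumZ (Num.sqrt g) Hs).
  apply: has_sum_iter HhP _ => x; rewrite mulrCA.
  apply: eq_has_sum (has_sumZ _ (sP x).2) => k.
  rewrite /h /theta_dual /= mulrA; congr (_ * cos _).
  by rewrite dotBl dotZl /a /cx; ring.
pose w (k : int) := tl b - (k%:~R + hd b) *: l.
pose e (k : int) := expR (- (pi / g * (k%:~R + hd b) ^+ 2)).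
pose uv k := cid (E1 (w k) c).
have uvP k : exists u v, 
    [/\ has_sum (fun x : 'rV[int]_n => expR (- (pi * Q1 (intv x))) * cos (2 * pi * dot (w k) (intv x) + c)) u,
        has_sum (fun y : 'rV[int]_n => expR (- (pi * Q1' (intv y + w k)))) v &
        Num.sqrt d1 * u = v * cos c] by exact: E1.
have {uv uvP}[u uP] := choice uvP; have {uP}[v uvP] := choice uP.
have Hu : has_sum (fun k => e k * u k) Hh.
  apply: has_sum_iter (has_sum_swap HhP) _ => k.
  have [Hk _ _] := uvP k; apply: eq_has_sum (has_sumZ (e k) Hk) => x.
  by rewrite /h /= mulrA [e k * _]mulrC.
have Hv : has_sum (fun k => e k * v k) T.
  move/(has_sum_reindex _ _ (@consz_bij n)) : HT => /has_sum_swap HT.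
  apply: has_sum_iter HT _ => k; have [_ Hk _] := uvP k.
  apply: eq_has_sum (has_sumZ (e k) Hk) => x.
  rewrite /= /Q' hd_consz tl_consz /= -expRD; congr expR.
  by rewrite /w addrA; field; rewrite gt_eqF.
rewrite sqrtrM ?(ltW g0) // mulrAC mulrC -EH.
apply: has_sum_unique (has_sumZ (Num.sqrt d1) Hu) _.
rewrite [T * _]mulrC; apply: eq_has_sum (has_sumZ (cos c) Hv) => k.
have [_ _ Ek] := uvP k.
by rewrite mulrCA [RHS]mulrCA Ek [v k * _]mulrC.
Qed.

End Step.

(** A vector [v] with [v *m G = 0] has [qf G v = 0]. *)
Lemma posdef_unit n (G : 'M[R]_n) : posdef G -> G \in unitmx.
Proof.
move=> [_ Gpos]; rewrite -row_free_unit -kermx_eq0; apply/eqP/row_matrixP => i.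
rewrite row0; apply/eqP; apply: contraT => /Gpos.
rewrite /qf; have /sub_kermxP -> : (row i (kermx G) <= kermx G)%MS by exact: row_sub.
by rewrite mul0mx mxE ltxx.
Qed.

Lemma qf_inv n (G : 'M[R]_n) v : posdef G -> qf (invmx G) v = qf G (v *m invmx G).
Proof.
move=> Gp; have Gu := posdef_unit Gp; case: Gp => Gs _.
rewrite /qf mulmxKV // trmx_mul trmx_inv Gs.
by rewrite [in RHS]mulmxA.
Qed.

Lemma qf_block n (g : R) (l : 'rV[R]_n) (G1 : 'M[R]_n) (v : 'rV[R]_(1 + n)) :
  qf (block_mx g%:M (g *: l) (g *: l^T) (G1 + g *: (l^T *m l)) : 'M[R]_(1 + n)) v =
  g * (hd v + dot l (tl v)) ^+ 2 + qf G1 (tl v).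
Proof.
rewrite /qf -[v in LHS]hsubmxK mul_row_block tr_row_mx mul_row_col.
rewrite [lsubmx v]mx11_scalar -/(hd v) -/(tl v).
set a := hd v; set w := tl v.
rewrite !mulmxDl !mulmxDr !mulmxDl.
rewrite tr_scalar_mx !mul_scalar_mx -!scalemxAl -!scalemxAr -!scalemxAl.
have E1 : w *m l^T *m a%:M = (a * dot l w)%:M.
  by rewrite mul_mx_scalar [w *m l^T]mx11_scalar -/(dot w l) dotC scale_scalar_mx.
have E2 : l *m w^T = (dot l w)%:M by rewrite [LHS]mx11_scalar.
have E3 : w *m (l^T *m l) *m w^T = (dot l w ^+ 2)%:M.
  by rewrite !mulmxA -mulmxA E2 [w *m l^T]mx11_scalar -/(dot w l) dotC -scalar_mxM expr2.
by rewrite E1 E2 E3 -scalar_mxM; move: (w *m G1 *m w^T) => m; rewrite !mxE !mulr1n; ring.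
Qed.

Lemma det_block_schur n (g : R) (l : 'rV[R]_n) (G1 : 'M[R]_n) :
  \det (block_mx g%:M (g *: l) (g *: l^T) (G1 + g *: (l^T *m l)) : 'M[R]_(1 + n)) = g * \det G1.
Proof.
have -> : (block_mx g%:M (g *: l) (g *: l^T) (G1 + g *: (l^T *m l)) : 'M[R]_(1 + n)) =
   block_mx 1%:M 0 l^T 1%:M *m block_mx g%:M (g *: l) 0 G1.
  rewrite mulmx_block !mul1mx !mul0mx !addr0 mul_mx_scalar -scalemxAr.
  by rewrite addrC.
by rewrite det_mulmx det_lblock det_ublock !det1 !mul1r det_scalar1.
Qed.

Theorem theta_posdef n (G : 'M[R]_n) : posdef G ->
  theta_pair (qf G) (qf (invmx G)) (\det G).
Proof.
elim: n G => [|n IH] G Gp.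
  have one (f : 'rV[int]_0 -> R) : has_sum f (f 0).
    have := @has_sum_finite R unit _ (fun=> 0) f; rewrite big_const card_unit /= addr0; apply.
      by move=> [] [].
    by move=> y /(_ tt); rewrite thinmx0 eqxx.
  have q0 (H : 'M[R]_0) v : qf H v = 0 by rewrite /qf thinmx0 !mul0mx mxE.
  have bt (H : 'M[R]_0) : bounded_theta (qf H).
    by exists 1 => b; eexists; first exact: one; rewrite q0 mulr0 oppr0 expR0.
  split; [by rewrite det_mx00|exact: bt|exact: bt|].
  move=> b c; exists (cos c), 1; split; last by rewrite det_mx00 sqrtr1.
    apply: eq_has_sum (one (fun=> cos c)) => x.
    by rewrite q0 mulr0 oppr0 expR0 mul1r /dot thinmx0 mul0mx mxE mulr0 add0r.
  apply: eq_has_sum (one (fun=> 1)) => x.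
  by rewrite q0 mulr0 oppr0 expR0.
have Gu := posdef_unit Gp; have [Gs Gpos] := Gp.
pose G' : 'M[R]_(1 + n) := G.
pose g := ulsubmx G' 0 0.
have g0 : 0 < g.
  have := Gpos (delta_mx 0 0); have /[swap]/[apply] : delta_mx 0 0 != 0 :> 'rV[R]_n.+1.
    by apply/eqP => /matrixP/(_ 0 0)/eqP; rewrite !mxE !eqxx oner_eq0.
  rewrite /qf -rowE trmx_delta -colE !mxE.
  by have -> : g = G 0 0 by rewrite /g !mxE; congr (G _ _); apply/val_inj.
(* Completing the square: [g] is the top left entry and [G1] the Schur complement. *)
pose l := g^-1 *: ursubmx G'.
pose G1 := drsubmx G' - g *: (l^T *m l).
have GE : G = block_mx g%:M (g *: l) (g *: l^T) (G1 + g *: (l^T *m l)) :> 'M[R]_(1 + n).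
  rewrite subrK /l [(_ *: _)^T]linearZ /= !scalerA mulfV ?gt_eqF // !scale1r -mx11_scalar.
  rewrite -[LHS](@submxK _ 1 n 1 n) trmx_ursub.
  by rewrite [G'^T](Gs : G'^T = G').
have qE v : qf G v = g * (hd v + dot l (tl v)) ^+ 2 + qf G1 (tl v) by rewrite {1}GE qf_block.
have G1p : posdef G1.
  split.
    rewrite /G1 linearB /= linearZ /= trmx_mul trmxK; congr (_ - _).
    by rewrite trmx_drsub [G'^T](Gs : G'^T = G').
  (* The first coordinate [- dot l w] makes the completed square vanish, so [qf G v] is exactly
     [qf G1 w]. *)
  move=> w w0; pose v : 'rV[R]_(1 + n) := row_mx (- dot l w)%:M w.
  have v0 : v != 0.
    by apply: contraNneq w0 => vE; rewrite -[w](row_mxKr (- dot l w)%:M) -/v vE linear0.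
  have := Gpos v v0; rewrite qE /hd /tl row_mxKl row_mxKr mxE mulr1n addNr expr0n mulr0 add0r.
  exact.
have G1u := posdef_unit G1p.
have dE : \det G = g * \det G1 by rewrite {1}GE det_block_schur.
rewrite dE.
have := theta_step l g0 (IH _ G1p).
have -> : (fun v : 'rV[R]_(1 + n) => g * (hd v + dot l (tl v)) ^+ 2 + qf G1 (tl v)) = qf G.
  by apply/funext => v; rewrite qE.
suff -> : (fun v : 'rV[R]_(1 + n) => hd v ^+ 2 / g + qf (invmx G1) (tl v - hd v *: l)) = qf (invmx G) by [].
apply/funext => v; rewrite (qf_inv _ Gp) (qf_inv _ G1p) qE.
set z : 'rV[R]_(1 + n) := v *m invmx G.
have vE : v = z *m G' by exact: esym (mulmxKV Gu v).
have GE' : G' = block_mx g%:M (g *: l) (g *: l^T) (G1 + g *: (l^T *m l)) := GE.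
(* Writing [v = z G] turns both inverse forms into the forms themselves, and the sheared tail of [v]
   is the image of [tl z] under [G1]. *)
have [hE tE] : hd v = g * (hd z + dot l (tl z)) /\ tl v - hd v *: l = tl z *m G1.
  have : v = row_mx ((g * (hd z + dot l (tl z)))%:M) (tl z *m G1 + (g * (hd z + dot l (tl z))) *: l).
    rewrite vE {1}GE' -[z in LHS]hsubmxK mul_row_block [lsubmx z]mx11_scalar -/(hd z) -/(tl z).
    rewrite mul_scalar_mx -scalemxAr [tl z *m l^T]mx11_scalar -/(dot (tl z) l) dotC.
    rewrite !scale_scalar_mx -raddfD /= [hd z * g]mulrC -mulrDr; congr row_mx.
    rewrite mul_scalar_mx mulmxDr -scalemxAr mulmxA [tl z *m l^T]mx11_scalar -/(dot (tl z) l) dotC.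
    by rewrite mul_scalar_mx addrCA scalerA scalerA -scalerDl [hd z * g]mulrC -mulrDr.
  move=> vE'; rewrite /hd /tl {1 2 3}vE' row_mxKl row_mxKr mxE mulr1n; split => //.
  by rewrite addrK.
rewrite tE hE mulmxK // -hE; congr (_ + _).
by rewrite hE; field; rewrite gt_eqF.
Qed.

End ThetaN.

(** * Embeddings, trace and discriminant *)

Section Embeddings.
Variables (F : fieldExtType rat) (C : numClosedFieldType).
Local Notation n := (\dim {:F}).

Lemma rmorph_in_alg (s : {rmorphism F -> C}) (a : rat) : s (in_alg F a) = ratr a.
Proof. exact: (fmorph_eq_rat (s \o in_alg F)). Qed.

Lemma rmorph_scale (s : {rmorphism F -> C}) (a : rat) x : s (a *: x) = ratr a * s x.
Proof. by rewrite -mulr_algl rmorphM; congr (_ * _); exact: rmorph_in_alg. Qed.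

Lemma rmorph_horner_alg (s : {rmorphism F -> C}) (p : {poly rat}) x :
  s (map_poly (in_alg F) p).[x] = (map_poly ratr p).[s x].
Proof.
rewrite -horner_map -map_poly_comp; congr _.[_].
by apply: eq_map_poly => a; exact: rmorph_in_alg.
Qed.

Lemma primitive_element : exists t : F, <<1; t>>%VS = {:F}%VS.
Proof.
have [t tE] : exists t : F, <<1 & vbasis {:F}>>%VS = <<1; t>>%VS.
  elim/last_ind: (tval (vbasis _)) => [|s x [t IH]].
    by exists 0; rewrite Fadjoin_nil Fadjoin0.
  rewrite adjoin_rcons IH.
  apply: Primitive_Element_Theorem; apply: pcharf0_separable => p.
  by have := pchar_lalg F p; rewrite Num.Theory.pchar_num.
exists t; rewrite -tE; apply/eqP; rewrite eqEsubv subvf /=.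
apply/subvP => x _; rewrite (coord_vbasis (memvf x)) memv_suml // => i _.
by rewrite memvZ // seqv_sub_adjoin // mem_nth // size_tuple.
Qed.

(** Embeddings correspond to the roots in [C] of the minimal polynomial of a primitive element [t],
    so [t] separates them. [C] is left general: [algC] serves the arithmetic and [R[i]] the
    norms. *)
Lemma embeddings_exist : exists (e : 'I_n -> {rmorphism F -> C}) (t : F),
  injective (fun i => e i t) /\ forall s : {rmorphism F -> C}, exists i, s =1 e i.
Proof.
have [t tE] := primitive_element.
pose P x : {poly rat} := projT1 (cid (polyOver1P (Fadjoin_polyOver 1 t x))).
have PE x : (map_poly (in_alg F) (P x)).[t] = x.
  rewrite /P; case: cid => p /= <-.
  by apply: Fadjoin_poly_eq; rewrite tE memvf.
have [q qE] := polyOver1P (minPolyOver 1 t).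
have q_mon : q \is monic by have := monic_minPoly 1 t; rewrite qE map_monic.
have sq : size q = n.+1.
  have := size_minPoly 1 t; rewrite qE size_map_poly => ->.
  by rewrite adjoin_degreeE tE dimv1 divn1.
have q_dvd p : (map_poly (in_alg F) p).[t] = 0 -> q %| p.
  move=> pt; rewrite -(dvdp_map (in_alg F)) -qE.
  by apply: minPoly_dvdp; [exact: alg_polyOver|exact/rootP].
pose qC := map_poly (ratr : rat -> C) q.
have qC_mon : qC \is monic by rewrite map_monic.
have [r rE] := closed_field_poly_normal qC.
rewrite (monicP qC_mon) scale1r in rE.
have sr : size r = n.
  by have := size_prod_XsubC r id; rewrite -rE size_map_poly sq => -[].
have r_uniq : uniq r.
  rewrite -separable_prod_XsubC -rE separable_map -(separable_map (in_alg F)) -qE.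
  suff: separable_element 1 t by []. apply: pcharf0_separable => p.
  by have := pchar_lalg F p; rewrite Num.Theory.pchar_num.
have ex z : z \in r -> exists s : {rmorphism F -> C}, s t = z.
  move=> zr; have qz : qC.[z] = 0 by apply/rootP; rewrite rE root_prod_XsubC.
  pose f x := (map_poly (ratr : rat -> C) (P x)).[z].
  (* A polynomial vanishing at [t] is a multiple of [q], hence vanishes at [z]. So [f x] does not
     depend on the polynomial chosen to express [x], and [f] is a ring morphism. *)
  have key p : (map_poly (in_alg F) p).[t] = 0 -> (map_poly ratr p).[z] = 0.
    by move=> /q_dvd/dvdpP[u ->]; rewrite rmorphM hornerM qz mulr0.
  have fE p : f (map_poly (in_alg F) p).[t] = (map_poly ratr p).[z].
    apply/eqP; rewrite -subr_eq0 -hornerN -hornerD -rmorphB; apply/eqP/key.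
    by rewrite rmorphB hornerD hornerN PE subrr.
  have f_add : zmod_morphism f.
    by move=> x y; rewrite -[x in LHS]PE -[y in LHS]PE -hornerN -hornerD -rmorphB fE rmorphB hornerD hornerN.
  have f_mul : monoid_morphism f.
    split=> [|x y]; last by rewrite -[x in LHS]PE -[y in LHS]PE -hornerM -rmorphM fE rmorphM hornerM.
    by have := fE 1; rewrite !rmorph1 !hornerC.
  pose fA := GRing.isZmodMorphism.Build F C f f_add.
  pose fM := GRing.isMonoidMorphism.Build F C f f_mul.
  pose fr : {rmorphism F -> C} := HB.pack f fA fM.
  exists fr; rewrite /= -/(f t).
  by have := fE 'X; rewrite !map_polyX !hornerX.
have rn (i : 'I_n) : r`_i \in r by rewrite mem_nth // sr.
pose e (i : 'I_n) := projT1 (cid (ex _ (rn i))).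
have eE i : e i t = r`_i by rewrite /e; case: cid.
exists e, t; split => [i j|s].
  by rewrite !eE => /eqP; rewrite nth_uniq ?sr // => /eqP/val_inj.
have st : s t \in r.
  rewrite -root_prod_XsubC -rE; apply/rootP.
  by rewrite -rmorph_horner_alg -qE minPolyxx rmorph0.
have it : (index (s t) r < n)%N by rewrite -sr index_mem.
exists (Ordinal it) => x.
by rewrite -[x]PE !rmorph_horner_alg eE /= nth_index.
Qed.

End Embeddings.

Section EmbeddingMatrix.
Variables (F : fieldExtType rat) (C : numClosedFieldType).
Local Notation n := (\dim {:F}).

Definition emb_mx (e : 'I_n -> {rmorphism F -> C}) (b : n.-tuple F) : 'M[C]_n :=
  \matrix_(i, j) e j b`_i.

Lemma emb_mx_mul (e : 'I_n -> {rmorphism F -> C}) (b b' : n.-tuple F) (A : 'M[rat]_n) :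
  (forall i : 'I_n, b'`_i = \sum_j A i j *: b`_j) ->
  emb_mx e b' = map_mx ratr A *m emb_mx e b.
Proof.
move=> bA; apply/matrixP => i j; rewrite !mxE bA rmorph_sum.
by apply: eq_bigr => k _; rewrite !mxE rmorph_scale.
Qed.

Variables (e : 'I_n -> {rmorphism F -> C}) (t : F).
Hypothesis e_inj : injective (fun i => e i t).

(** The Vandermonde matrix of the distinct numbers [e j t] factors through [emb_mx e b]. *)
Lemma emb_mx_unit (b : n.-tuple F) : basis_of {:F} b -> emb_mx e b \in unitmx.
Proof.
move=> bb; pose A : 'M[rat]_n := \matrix_(k, i) coord b i (t ^+ k).
have E : Vandermonde n (\row_j e j t) = map_mx ratr A *m emb_mx e b.
  apply/matrixP => k j; rewrite !mxE -rmorphXn [t ^+ k in LHS](coord_basis bb) ?memvf //.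
  by rewrite rmorph_sum; apply: eq_bigr => i _; rewrite !mxE rmorph_scale.
rewrite unitmxE unitfE; apply/eqP => d0.
have := det_Vandermonde (\row_j e j t); rewrite E det_mulmx d0 mulr0 => /esym/eqP.
rewrite prodf_seq_eq0 => /hasP[i _ /=]; rewrite prodf_seq_eq0 => /hasP[j _ /andP[ij]].
rewrite !mxE subr_eq0 => /eqP/e_inj ji.
by rewrite ji ltnn in ij.
Qed.

(** The embedding matrix conjugates multiplication by [x] into the diagonal matrix of the
    [e j x]. *)
Lemma trace_emb x : ratr (field_trace x) = \sum_j e j x.
Proof.
pose b := vbasis {:F}; have bb : basis_of {:F} b := vbasisP _.
have Vu := emb_mx_unit bb; set V := emb_mx e b in Vu.
pose M := passmx.mxof b b (amull x).
have E : map_mx ratr M *m V = V *m diag_mx (\row_j e j x).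
  apply/matrixP => i j; rewrite mul_mx_diag !mxE -rmorphM.
  have -> : b`_i * x = \sum_k M i k *: b`_k.
    rewrite mulrC [LHS](coord_basis bb) ?memvf //; apply: eq_bigr => k _; congr (_ *: _).
    by rewrite /M mxE /= passmx.vecof_delta lfunE /= mxE.
  by rewrite rmorph_sum; apply: eq_bigr => k _; rewrite !mxE rmorph_scale.
rewrite /field_trace -/b -/M -trace_map_mx -[map_mx _ _](mulmxK Vu) E.
rewrite -mulmxA mxtrace_mulC mulmxKV // mxtrace_diag.
by apply: eq_bigr => j _; rewrite mxE.
Qed.

Definition disc (b : n.-tuple F) : rat :=
  \det (\matrix_(i < n, j < n) field_trace (b`_i * b`_j)).

Lemma disc_emb (b : n.-tuple F) : ratr (disc b) = \det (emb_mx e b) ^+ 2.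
Proof.
rewrite /disc -det_map_mx expr2 -[X in _ = _ * X]det_tr -det_mulmx; congr (\det _).
apply/matrixP => i j; rewrite !mxE [LHS]trace_emb.
by apply: eq_bigr => k _; rewrite !mxE rmorphM.
Qed.

Lemma basis_of_disc (b : n.-tuple F) : basis_of {:F} b = (disc b != 0).
Proof.
apply/idP/idP => [bb|d0].
  apply/eqP => d0; have := disc_emb b; rewrite d0 rmorph0 => /esym/eqP.
  by rewrite expf_eq0 /= -[_ == 0]negbK -unitfE -unitmxE emb_mx_unit.
have Vu : emb_mx e b \in unitmx.
  rewrite unitmxE unitfE; apply: contraNneq d0 => d0.
  by have := disc_emb b; rewrite d0 expr0n => /eqP; rewrite fmorph_eq0.
rewrite basisEfree size_tuple leqnn andbT subvf andbT.
apply/freeP => c c0.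
suff : \row_i (ratr (c i) : C) = 0.
  by move=> /rowP r0 i; have /eqP := r0 i; rewrite !mxE fmorph_eq0 => /eqP.
apply: (can_inj (mulmxK Vu)); rewrite mul0mx; apply/rowP => j.
rewrite !mxE -[RHS](rmorph0 (e j)) -c0 rmorph_sum; apply: eq_bigr => i _.
by rewrite !mxE rmorph_scale.
Qed.

Lemma disc_mul (b b' : n.-tuple F) (A : 'M[rat]_n) :
  (forall i : 'I_n, b'`_i = \sum_j A i j *: b`_j) -> disc b' = \det A ^+ 2 * disc b.
Proof.
move=> /(emb_mx_mul e) bA; apply: (fmorph_inj (ratr : rat -> C)).
rewrite [LHS]disc_emb bA det_mulmx exprMn det_map_mx rmorphM rmorphXn; congr (_ * _).
exact: esym (disc_emb b).
Qed.

End EmbeddingMatrix.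

(** * Algebraic integers and their traces *)

Section Integers.
Variable F : fieldExtType rat.
Implicit Type x : F.

Lemma algintP x : reflect (integralOver (intr : int -> F) x) (x \in @is_algint F).
Proof. exact: asboolP. Qed.

Lemma unit_idealP x : unit_ideal F x <-> x \in @is_algint F.
Proof.
split=> [[[y yP] _ <-] //|xP]; first by exists (RingOfIntegers xP).
Qed.

Lemma algint_int (z : int) : (z%:~R : F) \in @is_algint F.
Proof. by apply: rpred_int. Qed.

(** In [algC] the trace is a sum of roots of one monic integer polynomial, and a rational algebraic
    integer is an integer. *)
Lemma trace_algint x : x \in @is_algint F -> field_trace x \is a Num.int.
Proof.
move=> /algintP[p p_mon /rootP px].
have [e [t [e_inj _]]] := embeddings_exist F algC.
have : (ratr (field_trace x) : algC) \in Aint.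
  rewrite (trace_emb e_inj); apply: rpred_sum => j _.
  apply: (@root_monic_Aint (map_poly intr p)).
  - apply/rootP; rewrite -(rmorph0 (e j)) -px -horner_map -map_poly_comp.
    congr _.[_]; apply: eq_map_poly => z /=; exact: esym (rmorph_int _ _).
  - exact: monic_map.
  - by apply/polyOverP => i; rewrite coef_map /=; apply: intr_int.
move=> /(Cint_rat_Aint (Crat_rat _)) /intrP[z zE]; apply/intrP; exists z.
by apply: (fmorph_inj (ratr : rat -> algC)); rewrite [LHS]zE [RHS]rmorph_int.
Qed.

End Integers.

(** * Fractional ideals *)

Section IntegralPolynomials.
Variable K : fieldType.
Local Notation integral := (integralOver (intr : int -> K)).

(** With [c] the leading coefficient and [d] the degree, [c^(d-1) p(x) = g(c x)] for a monic [g]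
    with integral coefficients; the top coefficient 1 is set apart because [d - 1 - i] would be
    negative there. *)
Lemma integral_lead_coef_root (p : {poly K}) (x : K) :
  (forall i, integral p`_i) -> root p x -> integral (lead_coef p * x).
Proof.
move=> ip px; have [->|p0] := eqVneq p 0.
  by rewrite lead_coef0 mul0r; exact: mxpoly.integral0.
set c := lead_coef p; pose d := (size p).-1.
have sp : size p = d.+1 by rewrite prednK // lt0n size_poly_eq0.
have d0 : (0 < d)%N.
  have := root_size_gt1 p0 px; rewrite sp; lia.
pose E i := if i == d then 1 else c ^+ (d.-1 - i) * p`_i.
pose g := \poly_(i < d.+1) E i.
have Ed : E d = 1 by rewrite /E eqxx.
have g_mon : g \is monic.
  by rewrite monicE lead_coef_poly ?Ed ?oner_eq0.
have ic : integral c by rewrite /c lead_coefE.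
have icn m : integral (c ^+ m).
  elim: m => [|m IH]; first exact: integral1.
  by rewrite exprS; apply: integral_mul.
apply: (integral_root_monic g_mon).
  rewrite /root horner_poly; apply/eqP.
  have -> : \sum_(i < d.+1) E i * (c * x) ^+ i = c ^+ d.-1 * p.[x].
    rewrite horner_coef sp mulr_sumr; apply: eq_bigr => i _.
    rewrite /E exprMn; have := ltn_ord i; rewrite ltnS leq_eqVlt => /orP[/eqP->|id].
      rewrite eqxx mul1r mulrA; congr (_ * _).
      by rewrite -{1}(prednK d0) exprSr /c lead_coefE -/d.
    rewrite ltn_eqF // mulrACA -exprD.
    by congr (_ ^+ _ * _); lia.
  by rewrite (rootP px) mulr0.
apply/integral_poly => i; rewrite coef_poly; case: ifP => _; last exact: mxpoly.integral0.
rewrite /E; case: ifP => _; first exact: integral1.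
exact: integral_mul.
Qed.

(** If [c] is the leading coefficient of [h], then [c] and [c x] are integral by
    [integral_lead_coef_root], so the leading term of [h] can be removed without losing the
    hypothesis. *)
Lemma integral_divXsubC (h : {poly K}) (x : K) :
  (forall i, integral (('X - x%:P) * h)`_i) ->
  (forall i, integral h`_i) /\ (forall i, integral (x * h`_i)).
Proof.
move=> ih; suff H i : integral h`_i.
  split=> // i; have -> : x * h`_i = ('X * h)`_i - (('X - x%:P) * h)`_i.
    by rewrite mulrBl coefB coefCM opprB addrC subrK.
  apply: integral_sub => //; rewrite coefXM; case: ifP => // _; exact: mxpoly.integral0.
elim: {h}(size h) {-2}h (leqnn (size h)) ih i => [|m IH] h.
  by rewrite leqn0 size_poly_eq0 => /eqP-> _ i; rewrite coef0; exact: mxpoly.integral0.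
move=> sh ih; have [->|h0] := eqVneq h 0 => [i|]; first by rewrite coef0; exact: mxpoly.integral0.
set c := lead_coef h; pose d := (size h).-1.
have sd : size h = d.+1 by rewrite prednK // lt0n size_poly_eq0.
have lc : lead_coef (('X - x%:P) * h) = c by rewrite lead_coef_monicM // monicXsubC.
have ic : integral c by rewrite -lc lead_coefE.
have icx : integral (c * x).
  by rewrite -lc; apply: integral_lead_coef_root => //; rewrite rootM root_XsubC eqxx.
pose h' := h - c *: 'X^d.
have sh' : (size h' <= m)%N.
  apply/leq_sizeP => j mj; rewrite /h' coefB coefZ coefXn.
  have [->|jd] := eqVneq j d; first by rewrite mulr1 /c lead_coefE -/d subrr.
  rewrite mulr0 subr0 nth_default // sd ltn_neqAle eq_sym jd /=.
  by apply: leq_trans mj; rewrite -ltnS -sd.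
have icX j k (a : K) : integral a -> integral (a *: 'X^k)`_j.
  by move=> ia; rewrite coefZ coefXn; apply: integral_mul => //; exact: integral_nat.
have ih' j : integral h'`_j.
  apply: IH => // k.
  have -> : ('X - x%:P) * h' = ('X - x%:P) * h - c *: 'X^(d.+1) + (c * x) *: 'X^d.
    rewrite /h' mulrBr -addrA; congr (_ + _).
    by rewrite mulrBl opprB [RHS]addrC exprS -!scalerAr mul_polyC scalerA.
  rewrite coefD coefB; apply: integral_add; last exact: icX.
  by apply: integral_sub => //; exact: icX.
move=> i; have -> : h`_i = h'`_i + (c *: 'X^d)`_i by rewrite -coefD subrK.
by apply: integral_add => //; exact: icX.
Qed.

(* Peel off the roots of f: if (X - a) f g is integral, so are f g and a f g. *)
Lemma dedekind_prague_split (r : seq K) (f g : {poly K}) (c : K) :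
  f = c *: \prod_(a <- r) ('X - a%:P) ->
  (forall i, integral (f * g)`_i) -> forall i j, integral (f`_i * g`_j).
Proof.
elim: r f g c => [|a r IH] f g c.
  rewrite big_nil => -> ifg i j; rewrite coefZ coef1.
  case: eqP => _; last by rewrite mulr0 mul0r; exact: mxpoly.integral0.
  by rewrite mulr1; have := ifg j; rewrite -scalerAl mul1r coefZ.
rewrite big_cons; set h := \prod_(b <- r) _ => fE ifg i j.
have [H1 H2] : (forall i, integral ((c *: h) * g)`_i) /\ (forall i, integral (((a * c) *: h) * g)`_i).
  have [|H1 H2] := @integral_divXsubC ((c *: h) * g) a.
    by move=> k; have := ifg k; rewrite fE mulrA -scalerAr.
  by split=> // k; have := H2 k; rewrite -coefZ scalerAl scalerA.
have := IH _ _ _ erefl H1; have := IH _ _ _ erefl H2.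
move=> {}H2 {}H1.
have -> : f`_i = ('X * (c *: h))`_i - ((a * c) *: h)`_i.
  by rewrite -coefB fE scalerAr mulrBl mul_polyC scalerA.
rewrite mulrBl; apply: integral_sub => //.
by rewrite coefXM; case: ifP => // _; rewrite mul0r; exact: mxpoly.integral0.
Qed.

End IntegralPolynomials.

Section FracIdeals.
Variable F : fieldExtType rat.
Local Notation n := (\dim {:F}).
Implicit Types (x y : F) (b w : n.-tuple F) (A B M : set F).

Lemma algint_emb (C : fieldType) (e : {rmorphism F -> C}) x :
  integralOver (intr : int -> C) (e x) <-> x \in @is_algint F.
Proof.
have H p : (map_poly intr p).[e x] = e (map_poly intr p).[x].
  rewrite -horner_map -map_poly_comp; congr _.[_]; apply: eq_map_poly => z /=.
  exact: esym (rmorph_int _ _).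
split=> [[p mp /rootP px]|/algintP[p mp /rootP px]].
  apply/algintP; exists p => //; apply/rootP.
  by apply: (fmorph_inj e); rewrite rmorph0 -H.
by exists p => //; apply/rootP; rewrite H px rmorph0.
Qed.

Lemma dim_gt0 : (0 < n)%N.
Proof.
rewrite lt0n dimv_eq0; apply/negP => /eqP f0.
by have := memvf (1 : F); rewrite f0 memv0 oner_eq0.
Qed.

(** Integrality can be tested after an embedding into [algC], where [f] splits. *)
Lemma dedekind_prague (f g : {poly F}) :
  (forall i, (f * g)`_i \in @is_algint F) -> forall i j, f`_i * g`_j \in @is_algint F.
Proof.
move=> ifg i j; have [e _] := embeddings_exist F algC.
pose e0 := e (Ordinal dim_gt0).
apply/(algint_emb e0); rewrite rmorphM -!coef_map.
have [r rE] := closed_field_poly_normal (map_poly e0 f).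
apply: (dedekind_prague_split rE) => k.
by rewrite -rmorphM coef_map; apply/algint_emb.
Qed.

Lemma intF_inj : injective (intr : int -> F).
Proof.
move=> a b; rewrite -!(rmorph_int (in_alg F)) => /(fmorph_inj (in_alg F)).
exact: intr_inj.
Qed.

Lemma intF_eq0 (m : int) : (m%:~R == 0 :> F) = (m == 0).
Proof. by rewrite -(inj_eq intF_inj). Qed.

Lemma algint_denom x : exists2 m : int, m != 0 & m%:~R * x \in @is_algint F.
Proof.
have [q qE] := polyOver1P (minPolyOver 1 x).
have [p [a a0 pE]] := rat_poly_scale q.
have px : root (map_poly (intr : int -> F) p) x.
  apply/rootP; have : (minPoly 1 x).[x] = 0 by exact: minPolyxx.
  rewrite qE pE map_polyZ -map_poly_comp hornerZ => /eqP.
  rewrite mulf_eq0 fmorph_eq0 invr_eq0 intr_eq0 (negbTE a0) /= => /eqP <-.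
  by congr _.[_]; apply: eq_map_poly => z; exact: esym (rmorph_int (in_alg F) z).
have p0 : p != 0.
  apply: contraTneq (monic_minPoly 1 x) => p0.
  by rewrite qE pE p0 !rmorph0 scaler0 rmorph0 monicE lead_coef0 eq_sym oner_eq0.
exists (lead_coef p); first by rewrite lead_coef_eq0.
have -> : (lead_coef p)%:~R = lead_coef (map_poly (intr : int -> F) p).
  by rewrite lead_coef_map_inj //; exact: intF_inj.
apply/algintP/integral_lead_coef_root => // i.
by rewrite coef_map; apply: (integral_id (intr : {rmorphism int -> F})).
Qed.

Definition subgrp M := M 0 /\ forall x y, M x -> M y -> M (x - y).

Lemma subgrpN M x : subgrp M -> M x -> M (- x).
Proof. by case=> M0 MB Mx; rewrite -sub0r; apply: MB. Qed.

Lemma subgrpD M x y : subgrp M -> M x -> M y -> M (x + y).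
Proof. by move=> sM Mx My; rewrite -[y]opprK; apply: sM.2 => //; exact: subgrpN. Qed.

Lemma subgrp_sum M (I : Type) (r : seq I) (P : pred I) (f : I -> F) : subgrp M ->
  (forall i, P i -> M (f i)) -> M (\sum_(i <- r | P i) f i).
Proof.
move=> sM fM; apply: big_ind => //; first by case: sM.
by move=> x y; exact: subgrpD.
Qed.

Lemma subgrpMz M x (z : int) : subgrp M -> M x -> M (x *~ z).
Proof.
move=> sM Mx; have H (k : nat) : M (x *+ k).
  by elim: k => [|k IH]; [case: sM|rewrite mulrS; apply: subgrpD].
by case: z => k /=; [exact: H|apply: (@subgrpN M _ sM); exact: H].
Qed.

Definition omodule M := subgrp M /\ forall o x, o \in @is_algint F -> M x -> M (o * x).

(** The common denominator [m] takes the place of finite generation; [fideal_basis] derives a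
    Z-basis from it. *)
Definition fideal A := [/\ omodule A, exists2 x, A x & x != 0 &
  exists2 m : int, m != 0 & forall x, A x -> m%:~R * x \in @is_algint F].

Lemma span_subgrp b M : subgrp M -> (forall i : 'I_n, M b`_i) -> forall x, inIntSpan b x -> M x.
Proof. by move=> sM Mb _ [a ->]; apply: (@subgrp_sum M) => // i _; exact: subgrpMz. Qed.

Lemma inIntSpan_nth b (i : 'I_n) : inIntSpan b b`_i.
Proof.
exists [ffun j => (j == i)%:Z]; rewrite (bigD1 i) //= ffunE eqxx mulr1z big1 ?addr0 //.
by move=> j /negbTE ji; rewrite ffunE ji mulr0z.
Qed.

Lemma det_row_replace (m : nat) (A : 'M[rat]_m) i :
  (forall j k, j != i -> A j k = (j == k)%:R) -> \det A = A i i.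
Proof.
move=> AE; rewrite (expand_det_col A i) (bigD1 i) //= big1 ?addr0; last first.
  by move=> j ji; rewrite AE // (negbTE ji) mul0r.
rewrite /cofactor addnn -mul2n exprM sqrrN !expr1n mul1r.
rewrite (_ : row' i (col' i A) = 1%:M) ?det1 ?mulr1 //.
apply/matrixP => j k; rewrite !mxE AE ?(inj_eq lift_inj) //.
by rewrite eq_sym neq_lift.
Qed.

(* A tuple of minimal nonzero |disc| is a Z-basis: a non-integral coordinate
   could be replaced by its fractional part. *)
Lemma int_basis_exists M (D : int) (b0 : n.-tuple F) :
  subgrp M -> D != 0 ->
  (forall b, (forall i : 'I_n, M b`_i) -> D%:~R * disc b \is a Num.int) ->
  (forall i : 'I_n, M b0`_i) -> disc b0 != 0 ->
  exists2 b : n.-tuple F, basis_of {:F} b & forall x, M x <-> inIntSpan b x.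
Proof.
move=> sM D0 MD Mb0 db0.
have [e [t [e_inj _]]] := embeddings_exist F algC.
have DQ : D%:~R != 0 :> rat by rewrite intr_eq0.
pose P (k : nat) := `[< exists b, [/\ forall i : 'I_n, M b`_i, disc b != 0 & `|D%:~R * disc b| = k%:R] >].
have exP b : (forall i : 'I_n, M b`_i) -> disc b != 0 -> exists2 k, P k & `|D%:~R * disc b| = k%:R.
  move=> Mb db; have /intrP[z zE] := MD b Mb.
  have zE' : `|D%:~R * disc b| = (absz z)%:R by rewrite zE -intr_norm -abszE -pmulrn.
  by exists (absz z) => //; apply/asboolP; exists b.
have ex0 : exists k, P k by have [k Pk _] := exP b0 Mb0 db0; exists k.
have [k /asboolP[b [Mb db bk]] kmin] := ex_minnP ex0.
have bb : basis_of {:F} b by rewrite (basis_of_disc e_inj).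
exists b => // x; split; last exact: span_subgrp.
move=> Mx; pose c i := coord b i x; pose z i := Num.floor (c i).
have xE : x = \sum_(i < n) c i *: b`_i by rewrite {1}(coord_basis bb (memvf x)).
suff cz i : c i = (z i)%:~R.
  exists [ffun i => z i]; rewrite {1}xE; apply: eq_bigr => i _.
  by rewrite ffunE cz -scaler_int.
apply/eqP; rewrite -subr_eq0; apply/negP => /negP f0.
pose y := x - b`_i *~ z i.
pose b' : n.-tuple F := [tuple if j == i then y else b`_j | j < n].
have b'E (j : 'I_n) : b'`_j = if j == i then y else b`_j.
  by rewrite -tnth_nth tnth_mktuple.
have Mb' (j : 'I_n) : M b'`_j.
  by rewrite b'E; case: ifP => // _; apply: sM.2 => //; exact: subgrpMz.
pose A : 'M[rat]_n := \matrix_(j, l) if j == i then c l - (z i)%:~R *+ (l == i) else (j == l)%:R.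
have AE (j : 'I_n) : b'`_j = \sum_l A j l *: b`_l.
  rewrite b'E; under eq_bigr do rewrite mxE; case: eqP => [_|_].
    rewrite (eq_bigr (fun l : 'I_n => c l *: b`_l - ((z i)%:~R *+ (l == i)) *: b`_l)); last first.
      by move=> l _; rewrite scalerBl.
    rewrite sumrB -xE; congr (_ - _); rewrite (bigD1 i) //= eqxx mulr1n big1 ?addr0 ?scaler_int //.
    by move=> l /negbTE ->; rewrite mulr0n scale0r.
  rewrite (bigD1 j) //= eqxx scale1r big1 ?addr0 // => l /negbTE lj.
  by rewrite eq_sym lj scale0r.
have dA : \det A = c i - (z i)%:~R.
  rewrite (@det_row_replace _ _ i); first by rewrite mxE eqxx.
  by move=> j l ji; rewrite mxE (negbTE ji).
have db' : disc b' = (c i - (z i)%:~R) ^+ 2 * disc b by rewrite (disc_mul e_inj AE) dA.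
have db'0 : disc b' != 0 by rewrite db' mulf_neq0 // expf_neq0.
have [k' Pk' k'E] := exP b' Mb' db'0.
have := kmin _ Pk'; rewrite leqNgt => /negP; apply.
rewrite -(ltr_nat rat) -k'E -bk db' mulrCA normrM.
have f1 : 0 <= c i - (z i)%:~R < 1.
  have /andP[] := floor_itv (c i); rewrite -/(z i) intrD => *.
  by apply/andP; split; lra.
rewrite -[ltRHS]mul1r ltr_pM2r ?normr_gt0 ?mulf_neq0 //.
rewrite normrX ger0_norm ?(andP f1).1 //.
by rewrite expr_lt1 ?(andP f1).2 // (andP f1).1.
Qed.

End FracIdeals.

Section FracIdealProducts.
Variable F : fieldExtType rat.
Local Notation n := (\dim {:F}).
Local Notation O := (unit_ideal F).
Implicit Types (x y : F) (b w : n.-tuple F) (A B M : set F).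

Lemma disc_scale_tuple b b' (x : F) : (forall i : 'I_n, b'`_i = x * b`_i) ->
  disc b != 0 -> x != 0 -> disc b' != 0.
Proof.
have [e [t [e_inj _]]] := embeddings_exist F algC.
rewrite -!(basis_of_disc e_inj) => bb' bb x0.
have Vu := emb_mx_unit e_inj bb.
rewrite (basis_of_disc e_inj); apply/eqP => d0.
have := disc_emb e_inj b'; rewrite d0 rmorph0 => /esym/eqP.
rewrite expf_eq0 /=.
have -> : emb_mx e b' = emb_mx e b *m diag_mx (\row_j e j x).
  by apply/matrixP => i j; rewrite mul_mx_diag !mxE bb' rmorphM mulrC.
rewrite det_mulmx mulf_eq0 det_diag => /orP[].
  by rewrite -[_ == 0]negbK -unitfE -unitmxE Vu.
by rewrite prodf_seq_eq0 => /hasP[j _ /=]; rewrite mxE fmorph_eq0 (negbTE x0).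
Qed.

Lemma integral_basis_tuple : exists2 b : n.-tuple F, disc b != 0 &
  forall i : 'I_n, b`_i \in @is_algint F.
Proof.
have [e [t [e_inj _]]] := embeddings_exist F algC.
pose v := vbasis {:F}.
pose m (i : 'I_n) := s2val (cid2 (algint_denom v`_i)).
have m0 i : m i != 0 by rewrite /m; case: cid2.
have mi i : (m i)%:~R * v`_i \in @is_algint F by rewrite /m; case: cid2.
pose b : n.-tuple F := [tuple (m i)%:~R * v`_i | i < n].
have bE (i : 'I_n) : b`_i = (m i)%:~R * v`_i by rewrite -tnth_nth tnth_mktuple.
exists b => [|i]; last by rewrite bE.
pose A : 'M[rat]_n := diag_mx (\row_i (m i)%:~R).
have AE (i : 'I_n) : b`_i = \sum_j A i j *: v`_j.
  rewrite bE mulrzl (bigD1 i) //= !mxE eqxx mulr1n scaler_int big1 ?addr0 // => j /negbTE ji.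
  by rewrite !mxE eq_sym ji mulr0n scale0r.
rewrite (disc_mul e_inj AE) mulf_neq0 ?expf_neq0 //.
  rewrite det_diag; apply/prodf_neq0 => i _.
  by rewrite mxE intr_eq0.
by rewrite -(basis_of_disc e_inj); exact: vbasisP.
Qed.

Lemma fideal_basis A : fideal A ->
  exists2 b : n.-tuple F, basis_of {:F} b & forall x, A x <-> inIntSpan b x.
Proof.
move=> [[sA oA] [x Ax x0] [m m0 mA]].
have [e [t [e_inj _]]] := embeddings_exist F algC.
have [w dw wi] := integral_basis_tuple.
pose b0 : n.-tuple F := [tuple x * w`_i | i < n].
have b0E (i : 'I_n) : b0`_i = x * w`_i by rewrite -tnth_nth tnth_mktuple.
apply: (@int_basis_exists F A (m ^+ n * m ^+ n) b0) => //.
- by rewrite mulf_neq0 // expf_neq0.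
- move=> b Ab.
  (* Scaling the tuple by [m] multiplies its discriminant by [m^(2n)] and makes its entries
     algebraic integers, whose traces are integers. *)
  have -> : (m ^+ n * m ^+ n)%:~R * disc b =
      \det (\matrix_(i < n, j < n) field_trace ((m%:~R * b`_i) * (m%:~R * b`_j))).
    rewrite /disc intrM rmorphXn /= -expr2 -exprM mulnC exprM -detZ.
    congr (\det _); apply/matrixP => i j; rewrite !mxE.
    have [e2 [t2 [e2_inj _]]] := embeddings_exist F algC.
    apply: (fmorph_inj (ratr : rat -> algC)); rewrite [RHS](trace_emb e_inj).
    rewrite rmorphM /= [X in _ * X](trace_emb e_inj) rmorphXn /= rmorph_int mulr_sumr.
    apply: eq_bigr => k _; rewrite !rmorphM !rmorph_int; ring.
  apply: rpred_sum => s _; apply: rpredM; first by rewrite rpredX ?rpredN ?rpred1.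
  apply: rpred_prod => i _; rewrite mxE; apply: trace_algint.
  by apply: rpredM; exact: mA.
- by move=> i; rewrite b0E mulrC; apply: oA => //; exact: wi.
- exact: disc_scale_tuple b0E dw x0.
Qed.

Lemma omodule_O : omodule O.
Proof.
split; first split.
- by apply/unit_idealP; exact: rpred0.
- by move=> x y /unit_idealP xO /unit_idealP yO; apply/unit_idealP; exact: rpredB.
- by move=> o x oO /unit_idealP xO; apply/unit_idealP; exact: rpredM.
Qed.

Lemma fideal_O : fideal O.
Proof.
split; first exact: omodule_O.
  by exists 1; rewrite ?oner_eq0 //; apply/unit_idealP; exact: rpred1.
by exists 1 => // x /unit_idealP; rewrite mul1r.
Qed.

Lemma fracmul_gen A B x y : A x -> B y -> fracmul A B (x * y).
Proof.
move=> Ax By; exists [:: (x, y)]; last by rewrite big_seq1.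
by move=> ab; rewrite inE => /eqP ->.
Qed.

Lemma fracmul_sub A B M : subgrp M -> (forall x y, A x -> B y -> M (x * y)) ->
  fracmul A B `<=` M.
Proof.
move=> sM AB _ [s sAB ->]; rewrite big_seq; apply: subgrp_sum => // ab /sAB[Aa Bb].
exact: AB.
Qed.

Lemma omodule_fracmul A B : omodule A -> omodule (fracmul A B).
Proof.
move=> [sA oA]; split; first split.
- by exists [::] => //; rewrite big_nil.
- move=> _ _ [s sAB ->] [s' s'AB ->].
  exists (s ++ [seq (- ab.1, ab.2) | ab <- s']).
    move=> ab; rewrite mem_cat => /orP[/sAB //|/mapP[ab' /s'AB[Aa Bb] ->]] /=.
    by split => //; apply: subgrpN.
  rewrite big_cat /= big_map; congr (_ + _); rewrite -sumrN.
  by apply: eq_bigr => ab _; rewrite mulNr.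
- move=> o _ oO [s sAB ->].
  exists [seq (o * ab.1, ab.2) | ab <- s].
    by move=> ab /mapP[ab' /sAB[Aa Bb] ->] /=; split => //; exact: oA.
  by rewrite big_map mulr_sumr; apply: eq_bigr => ab _; rewrite mulrA.
Qed.

Lemma fracmulC A B : fracmul A B = fracmul B A.
Proof.
suff H A' B' : fracmul A' B' `<=` fracmul B' A' by apply/seteqP; split.
move=> _ [s sAB ->]; exists [seq (ab.2, ab.1) | ab <- s].
  by move=> ab /mapP[ab' /sAB[? ?] ->].
by rewrite big_map; apply: eq_bigr => ab _; rewrite mulrC.
Qed.

Lemma subgrp_fracmul A B : omodule A -> subgrp (fracmul A B).
Proof. by move=> /(omodule_fracmul B)[]. Qed.

Lemma subgrp_transl M (c : F) : subgrp M -> subgrp ([set x | M (x * c)] : set F).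
Proof.
move=> sM; split=> /=; first by rewrite mul0r; case: sM.
by move=> x y; rewrite mulrBl; exact: sM.2.
Qed.

Lemma fracmulA A B M : omodule A -> omodule B -> omodule M ->
  fracmul A (fracmul B M) = fracmul (fracmul A B) M.
Proof.
move=> oA oB oM; apply/seteqP; split; last first.
  apply: fracmul_sub; first exact: subgrp_fracmul.
  move=> x z ABx Mz; apply: (fracmul_sub (M := [set x | fracmul A (fracmul B M) (x * z)])) ABx.
    by apply: subgrp_transl; exact: subgrp_fracmul.
  by move=> a c Aa Bc /=; rewrite -mulrA; do 2?apply: fracmul_gen.
apply: fracmul_sub; first by apply: subgrp_fracmul; exact: omodule_fracmul.
move=> a y Aa BMy.
have := @fracmul_sub B M [set y | fracmul (fracmul A B) M (y * a)].
move=> /(_ (subgrp_transl _ (subgrp_fracmul _ (omodule_fracmul _ oA)))) H.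
rewrite mulrC; apply: (H _ _ BMy) => c z Bc Mz /=.
by rewrite mulrC mulrA; do 2?apply: fracmul_gen.
Qed.

Lemma fracmul1 A : omodule A -> fracmul O A = A.
Proof.
move=> [sA oA]; apply/seteqP; split.
  by apply: fracmul_sub => // x y /unit_idealP xO; exact: oA.
move=> x Ax; rewrite -[x]mul1r; apply: fracmul_gen => //.
by apply/unit_idealP; exact: rpred1.
Qed.

Lemma fideal_fracmul A B : fideal A -> fideal B -> fideal (fracmul A B).
Proof.
move=> [oA [x Ax x0] [m m0 mA]] [oB [y By y0] [k k0 kB]].
split; first exact: omodule_fracmul.
  by exists (x * y); rewrite ?mulf_neq0 //; exact: fracmul_gen.
exists (m * k); first by rewrite mulf_neq0.
move=> z ABz; apply/unit_idealP; rewrite mulrC.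
apply: (fracmul_sub (M := [set z | O (z * (m * k)%:~R)])) ABz.
  by apply: subgrp_transl; case: omodule_O.
move=> a c Aa Bc /=; apply/unit_idealP.
have -> : a * c * (m * k)%:~R = (m%:~R * a) * (k%:~R * c) by rewrite intrM; ring.
by apply: rpredM; [exact: mA|exact: kB].
Qed.

Lemma omodule_fracinv A : omodule (fracinv A).
Proof.
have [sO oO] := omodule_O.
split; first split.
- by move=> a Aa; rewrite mul0r; case: sO.
- by move=> x y xA yA a Aa; rewrite mulrBl; apply: sO.2; [exact: xA|exact: yA].
- by move=> o x oo xA a Aa; rewrite -mulrA; apply: oO => //; exact: xA.
Qed.

Lemma fideal_fracinv A : fideal A -> fideal (fracinv A).
Proof.
move=> [oA [x Ax x0] [m m0 mA]]; split; first exact: omodule_fracinv.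
  by exists m%:~R; rewrite ?intF_eq0 // => a Aa; apply/unit_idealP; exact: mA.
have [k k0 kx] := algint_denom x^-1; exists k => // y yA.
have -> : k%:~R * y = (k%:~R * x^-1) * (y * x) by field.
by apply: rpredM => //; apply/unit_idealP; exact: yA.
Qed.

End FracIdealProducts.

(** * Invertibility of fractional ideals *)

Section Invertible.
Variable F : fieldExtType rat.
Local Notation n := (\dim {:F}).
Local Notation O := (unit_ideal F).
Implicit Types (x y : F) (b w : n.-tuple F) (A B M : set F).

(** [M] is the matrix of multiplication by [f] on [F[X]] over [rat[X]], so [h = \det M] is the norm
    of [f]. As [\adj M *m M] is scalar, applying [\adj M] to the coordinates of 1 yields the
    cofactor [g]. *)
Lemma multiple_over_rat (f : {poly F}) : f != 0 ->
  exists (g : {poly F}) (h : {poly rat}), h != 0 /\ f * g = map_poly (in_alg F) h.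
Proof.
move=> f0; have [e [t [e_inj _]]] := embeddings_exist F algC.
pose w := vbasis {:F}; have wb : basis_of {:F} w := vbasisP _.
pose M : 'M[{poly rat}]_n := \matrix_(i, k) \poly_(l < size f) coord w k (f`_l * w`_i).
pose up (p : {poly rat}) := map_poly (in_alg F) p.
have ME (i : 'I_n) : f * (w`_i)%:P = \sum_k up (M i k) * (w`_k)%:P.
  apply/polyP => l; rewrite coefMC coef_sum.
  under eq_bigr do rewrite coefMC coef_map mxE coef_poly /=.
  case: ltnP => lf; last first.
    by rewrite nth_default // mul0r big1 // => k _; rewrite scale0r mul0r.
  rewrite [LHS](coord_basis wb) ?memvf //; apply: eq_bigr => k _.
  by rewrite mulr_algl.
pose a : 'rV[rat]_n := \row_k coord w k 1.
pose aP : 'rV[{poly rat}]_n := map_mx polyC a.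
pose y := aP *m \adj M.
pose g := \sum_k up (y 0 k) * (w`_k)%:P.
exists g, (\det M); split.
  apply/eqP => d0.
  (* Over [algC] the matrix becomes diagonal with the conjugates of [f] as entries, none of which is
     zero. *)
  pose upC := map_poly (ratr : rat -> algC).
  have E : map_mx upC M *m map_mx polyC (emb_mx e w) =
     map_mx polyC (emb_mx e w) *m diag_mx (\row_j map_poly (e j) f).
    apply/matrixP => i j; rewrite mul_mx_diag !mxE.
    transitivity (map_poly (e j) (f * (w`_i)%:P)); last first.
      by rewrite rmorphM /= map_polyC mulrC.
    rewrite ME rmorph_sum; apply: eq_bigr => k _; rewrite !mxE [RHS]rmorphM /= map_polyC /=.
    congr (_ * _); rewrite /upC /up -map_poly_comp; apply: eq_map_poly => q.
    exact: esym (rmorph_in_alg (e j) q).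
  have := congr1 determinant E; rewrite !det_mulmx det_map_mx d0 rmorph0 mul0r.
  move=> /esym/eqP; rewrite mulf_eq0 det_map_mx polyC_eq0 det_diag => /orP[].
    by rewrite -[_ == 0]negbK -unitfE -unitmxE (emb_mx_unit e_inj wb).
  rewrite prodf_seq_eq0 => /hasP[j _ /=]; rewrite mxE map_poly_eq0.
  by rewrite (negbTE f0).
rewrite mulr_sumr.
have -> : \sum_k f * (up (y 0 k) * (w`_k)%:P) = \sum_l up ((y *m M) 0 l) * (w`_l)%:P.
  under eq_bigr do rewrite mulrCA ME mulr_sumr.
  rewrite exchange_big /=; apply: eq_bigr => l _.
  rewrite mxE /up rmorph_sum mulr_suml; apply: eq_bigr => k _.
  by rewrite rmorphM mulrA.
rewrite /y -mulmxA mul_adj_mx mul_mx_scalar.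
have one : 1 = \sum_k (in_alg F (a 0 k)) * w`_k.
  rewrite [LHS](coord_basis wb) ?memvf //; apply: eq_bigr => k _.
  by rewrite mxE mulr_algl.
have oneP : 1 = \sum_k (in_alg F (a 0 k))%:P * (w`_k)%:P :> {poly F}.
  rewrite -polyC1 one rmorph_sum; apply: eq_bigr => k _; exact: polyCM.
rewrite -[RHS]mulr1 [X in _ = _ * X]oneP mulr_sumr; apply: eq_bigr => k _.
by rewrite !mxE /up rmorphM /= map_polyC /= mulrA.
Qed.

(** By Bezout the content is an integer combination of the coefficients; for a primitive polynomial
    this puts 1 into the subgroup. *)
Lemma mem_zcontents (S : set int) (p : {poly int}) :
  S 0 -> (forall x y : int, S x -> S y -> S (x - y)) -> (forall i, S p`_i) -> S (zcontents p).
Proof.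
move=> S0 SB Sp.
have SN (x : int) : S x -> S (- x) by move=> Sx; rewrite -sub0r; apply: SB.
have SD (x y : int) : S x -> S y -> S (x + y) by move=> Sx Sy; rewrite -[y]opprK; apply: SB => //; apply: SN.
have SM (z x : int) : S x -> S (z * x).
  move=> Sx; rewrite mulrC -mulrzz.
  have SMn (k : nat) : S (x *+ k) by elim: k => [//|k IH]; rewrite mulrS; apply: SD.
  by case: z => k; [exact: SMn|apply: (SN (x *+ k.+1)); exact: SMn].
rewrite /zcontents; apply: (SM).
have Sabs (x : int) : S x -> S `|x|%N%:Z.
  by move=> Sx; rewrite abszE; case: (ger0P x) => // _; exact: SN.
apply: (big_ind (fun k : nat => S k%:Z)) => // [k l Sk Sl|i _]; last exact: Sabs.
have [u [v uvE]] := Bezoutz k%:Z l%:Z.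
have -> : (gcdn k l)%:Z = gcdz k%:Z l%:Z by [].
by rewrite -uvE; apply: SD; exact: SM.
Qed.

(* With A = <b_0, ..., b_{n-1}> and f = sum b_i X^i, a multiple f g that is a
   primitive integer polynomial shows that the coefficients of g lie in the
   inverse of A and that A times its inverse contains 1. *)
Lemma fracmulV A : fideal A -> fracmul A (fracinv A) = O.
Proof.
move=> fA; have [oA [x0 Ax0 x00] _] := fA; have [b bb bA] := fideal_basis fA.
have [sAI oAI] : omodule (fracmul A (fracinv A)) by exact: omodule_fracmul.
apply/seteqP; split.
  apply: fracmul_sub; first by case: (omodule_O F).
  by move=> x y Ax /(_ x Ax); rewrite mulrC.
pose f := \poly_(i < n) b`_i.
have fE (i : 'I_n) : f`_i = b`_i by rewrite coef_poly ltn_ord.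
have f0 : f != 0.
  apply: contraNneq x00 => f0; have /bA[c ->] := Ax0; apply/eqP.
  by rewrite big1 // => i _; rewrite -fE f0 coef0 mul0rz.
have [g [h [h0 fg]]] := multiple_over_rat f0.
have [p [a a0 hE]] := rat_poly_scale h.
have p0 : p != 0 by apply: contraNneq h0 => p0; rewrite hE p0 rmorph0 scaler0.
pose q := zprimitive p; pose c : rat := a%:~R^-1 * (zcontents p)%:~R.
have c0 : c != 0 by rewrite mulf_neq0 ?invr_eq0 ?intr_eq0 ?zcontents_eq0.
have hE' : h = c *: map_poly intr q.
  by rewrite hE {1}[p]zpolyEprim map_polyZ scalerA.
pose g' := (in_alg F c)^-1 *: g.
have fg' : f * g' = map_poly (intr : int -> F) q.
  rewrite /g' -scalerAr fg hE' map_polyZ scalerA mulVf ?fmorph_eq0 // scale1r -map_poly_comp.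
  by apply: eq_map_poly => z; exact: (rmorph_int (in_alg F)).
have prague := @dedekind_prague F f g'.
have {}prague i j : f`_i * g'`_j \in @is_algint F.
  apply: prague => k; rewrite fg' coef_map; exact: algint_int.
have g'A j : fracinv A g'`_j.
  move=> y /bA; move: y; apply: span_subgrp.
    have [sO _] := omodule_O F; split; first by rewrite mulr0; case: sO.
    by move=> y z; rewrite mulrBr; exact: sO.2.
  by move=> i; rewrite -fE mulrC; apply/unit_idealP; exact: prague.
have Ab i : A f`_i.
  have [lt_in|le_ni] := ltnP i n; last by rewrite nth_default ?(leq_trans (size_poly _ _)) //; case: oA => -[].
  by rewrite (fE (Ordinal lt_in)); apply/bA; exact: inIntSpan_nth.
have one : fracmul A (fracinv A) 1.
  have := @mem_zcontents (fun z => fracmul A (fracinv A) z%:~R) q.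
  rewrite zcontents_primitive p0; apply.
  - by case: sAI.
  - by move=> u v Su Sv; rewrite intrB; exact: sAI.2.
  - move=> k; have -> : (q`_k)%:~R = (f * g')`_k :> F by rewrite fg' coef_map.
    rewrite coefM; apply: subgrp_sum => // i _; apply: fracmul_gen; [exact: Ab|exact: g'A].
by move=> x /unit_idealP xO; rewrite -[x]mulr1; exact: oAI.
Qed.

End Invertible.

(** * Lattices and indices *)

Section Index.
Variable F : fieldExtType rat.
Local Notation n := (\dim {:F}).
Implicit Types (x y : F) (a b w : n.-tuple F) (A B : set F).

Definition zbasis A b := basis_of {:F} b /\ forall x, A x <-> inIntSpan b x.

Definition has_disc A (d : rat) := exists2 b, zbasis A b & d = disc b.

Definition lincomb b (v : 'rV[int]_n) : F := \sum_(i < n) b`_i *~ v 0 i.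

Lemma zbasisP A b x : zbasis A b -> A x <-> exists v, x = lincomb b v.
Proof.
move=> [_ bA]; split=> [/bA[a ->]|[v ->]].
  by exists (\row_i a i); apply: eq_bigr => i _; rewrite mxE.
by apply/bA; exists [ffun i => v 0 i]; apply: eq_bigr => i _; rewrite ffunE.
Qed.

Lemma lincombB b u v : lincomb b (u - v) = lincomb b u - lincomb b v.
Proof. by rewrite /lincomb -sumrB; apply: eq_bigr => i _; rewrite !mxE mulrzBr. Qed.

Lemma lincomb_inj b : basis_of {:F} b -> injective (lincomb b).
Proof.
move=> bb u v uv; apply/rowP => i.
have H (m : 'rV[int]_n) : coord b i (lincomb b m) = (m 0 i)%:~R.
  rewrite /lincomb; under eq_bigr do rewrite -scaler_int.
  by rewrite coord_sum_free ?(basis_free bb).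
by apply: (@intr_inj rat); rewrite -!H uv.
Qed.

Lemma lincomb_mul a b (M : 'M[int]_n) v : (forall i : 'I_n, a`_i = lincomb b (row i M)) ->
  lincomb a v = lincomb b (v *m M).
Proof.
move=> aE; rewrite /lincomb; under eq_bigr do rewrite aE /lincomb mulrz_suml.
rewrite exchange_big /=; apply: eq_bigr => j _; rewrite mxE mulrz_sumr.
by apply: eq_bigr => i _; rewrite mxE -mulrzA mulrC.
Qed.

Lemma zbasis_sub A B a b : zbasis A a -> zbasis B b -> A `<=` B ->
  exists M : 'M[int]_n, forall i : 'I_n, a`_i = lincomb b (row i M).
Proof.
move=> aA bB AB.
have H (i : 'I_n) : exists v, a`_i = lincomb b v.
  by apply/(zbasisP _ bB)/AB/aA.2; exact: inIntSpan_nth.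
have [v vE] := choice H; exists (\matrix_i v i) => i.
by rewrite rowK vE.
Qed.

Lemma disc_lincomb a b (M : 'M[int]_n) : (forall i : 'I_n, a`_i = lincomb b (row i M)) ->
  disc a = (\det M)%:~R ^+ 2 * disc b.
Proof.
move=> aE; have [e [t [e_inj _]]] := embeddings_exist F algC.
rewrite -det_map_mx; apply: (disc_mul e_inj) => i.
by rewrite aE; apply: eq_bigr => j _; rewrite !mxE scaler_int.
Qed.

Lemma zbasis_disc_neq0 A b : zbasis A b -> disc b != 0.
Proof.
by move=> [bb _]; have [e [t [e_inj _]]] := embeddings_exist F algC; rewrite -(basis_of_disc e_inj).
Qed.

Lemma int_unit_sqr (u : int) : u \is a GRing.unit -> u%:~R ^+ 2 = 1 :> rat.
Proof. by move=> /orP[]/eqP->; rewrite ?intrN ?sqrrN expr1n. Qed.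

Lemma int_unit_abs (u : int) : u \is a GRing.unit -> `|u|%N = 1%N.
Proof. by move=> /orP[]/eqP->. Qed.

(** The two change-of-basis matrices are inverse over the integers, so their determinants are 1 or
    -1. *)
Lemma has_disc_unique A d d' : has_disc A d -> has_disc A d' -> d = d'.
Proof.
move=> [a aA ->] [b bA ->].
have [M aE] := zbasis_sub aA bA (@subset_refl _ A).
have [N bE] := zbasis_sub bA aA (@subset_refl _ A).
rewrite (disc_lincomb aE) int_unit_sqr ?mul1r //.
have MN : M *m N = 1%:M.
  apply/row_matrixP => i; apply: (lincomb_inj aA.1).
  rewrite row_mul -(lincomb_mul _ bE) -aE row1 /lincomb (bigD1 i) //= mxE !eqxx mulr1z.
  by rewrite big1 ?addr0 // => j /negbTE ji; rewrite mxE ji andbF mulr0z.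
apply/unitrP; exists (\det N).
by rewrite mulrC -det_mulmx MN det1.
Qed.

(** A complete system of representatives of [B] modulo [A]. The index is read off as the cardinal of
    the finite type [I], which is independent of the choice. *)
Definition residues B A (I : finType) (r : I -> F) :=
  [/\ forall i, B (r i), forall x, B x -> exists i, A (x - r i) &
      forall i j, A (r i - r j) -> i = j].

Lemma residues_card B A (I I' : finType) (r : I -> F) (r' : I' -> F) : subgrp A ->
  residues B A r -> residues B A r' -> #|I| = #|I'|.
Proof.
move=> sA.
suff H (J J' : finType) (s : J -> F) (s' : J' -> F) :
    residues B A s -> residues B A s' -> (#|J| <= #|J'|)%N.
  by move=> r1 r2; apply/eqP; rewrite eqn_leq (H _ _ _ _ r1 r2) (H _ _ _ _ r2 r1).
move=> [sB sC sI] [s'B s'C s'I].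
have H i : exists j, A (s i - s' j) by apply: s'C.
have [f fP] := choice H; apply: (leq_card f) => i j ij.
apply: sI; have := sA.2 _ _ (fP i) (fP j); rewrite ij.
by rewrite opprB addrA subrK.
Qed.

Lemma residues_exist A B a b (M : 'M[int]_n) : zbasis A a -> zbasis B b ->
  (forall i : 'I_n, a`_i = lincomb b (row i M)) ->
  exists (I : finType) (r : I -> F), residues B A r /\ #|I| = absz (\det M).
Proof.
move=> aA bB aE.
have dM0 : \det M != 0.
  have := zbasis_disc_neq0 aA; rewrite (disc_lincomb aE) mulf_eq0 expf_eq0 /= intr_eq0.
  by rewrite negb_or => /andP[].
have [L Lu [R Ru [d _ ME]]] := int_Smith_normal_form M.
set D := (X in L *m X) in ME.
have uDE (u : 'rV[int]_n) i : (u *m D) 0 i = u 0 i * d`_i.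
  rewrite mxE (bigD1 i) //= mxE eqxx mulr1n big1 ?addr0 // => j /negbTE ji.
  by rewrite mxE val_eqE ji mulr0.
have dD : \det D = \prod_(i < n) d`_i.
  have -> : D = diag_mx (\row_i d`_i).
    by apply/matrixP => i j; rewrite !mxE val_eqE.
  by rewrite det_diag; apply: eq_bigr => i _; rewrite mxE.
have absM : absz (\det M) = (\prod_(i < n) absz (d`_i)%R)%N.
  rewrite ME !det_mulmx !abszM dD.
  have absU (U : 'M[int]_n) : U \in unitmx -> absz (\det U) = 1%N.
    by rewrite unitmxE; exact: int_unit_abs.
  rewrite (absU L) // (absU R) // mul1n muln1.
  by apply: (big_morph absz abszM).
have d0 (i : 'I_n) : d`_i != 0.
  apply: contraNneq dM0 => di0; rewrite -absz_eq0 absM (bigD1 i) //= di0.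
  by rewrite mul0n.
have aE' (v : 'rV[int]_n) : lincomb a v = lincomb b (v *m M) by exact: lincomb_mul.
(* In the basis of [B] transformed by [R], the sublattice [A] consists of the vectors whose
   coordinate [i] is divisible by [d_i]; reduction modulo each [d_i] gives the representatives. *)
pose be (v : 'rV[int]_n) := lincomb b (v *m R).
have beB u v : be (u - v) = be u - be v by rewrite /be mulmxBl lincombB.
have Bbe x : B x <-> exists v, x = be v.
  split=> [/(zbasisP _ bB)[v ->]|[v ->]]; last by apply/(zbasisP _ bB); exists (v *m R).
  by exists (v *m invmx R); rewrite /be mulmxKV.
have Abe v : A (be v) <-> exists u : 'rV[int]_n, v = u *m D.
  split=> [/(zbasisP _ aA)[u]|[u ->]].
    rewrite aE' ME !mulmxA => /(lincomb_inj bB.1)/(can_inj (mulmxK Ru)) ->.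
    by exists (u *m L).
  by apply/(zbasisP _ aA); exists (u *m invmx L); rewrite aE' ME !mulmxA mulmxKV.
pose I := {dffun forall i : 'I_n, 'I_(absz (d`_i)%R)}.
pose r (f : I) := be (\row_i (f i : nat)%:Z).
exists I, r; split; last first.
  rewrite card_dep_ffun absM foldrE big_map big_enum /=.
  by apply: eq_bigr => i _; rewrite card_ord.
split=> [f|x /Bbe[v ->]|f g].
- by apply/Bbe; eexists.
- pose vi i := v 0 i.
  have lt_mod i : (absz (vi i %% d`_i)%Z < absz (d`_i)%R)%N.
    by have := ltz_mod (vi i) (d0 i); have := modz_ge0 (vi i) (d0 i); lia.
  exists [ffun i => Ordinal (lt_mod i)]; rewrite /r -beB; apply/Abe.
  exists (\row_i (vi i %/ d`_i)%Z); apply/rowP => i.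
  rewrite uDE !mxE ffunE /= -/(vi i) {1}(divz_eq (vi i) d`_i).
  by have := modz_ge0 (vi i) (d0 i); move: (vi i %% d`_i)%Z => k k0; rewrite gez0_abs // addrK.
rewrite /r -beB => /Abe[u /rowP uE]; apply/ffunP => i; apply/val_inj => /=.
have := uE i; rewrite uDE !mxE; have := ltn_ord (f i); have := ltn_ord (g i).
move: (nat_of_ord (f i)) (nat_of_ord (g i)) (u 0 i) => k l z.
move: (d`_i) => c lt_l lt_k E.
(* Two remainders below [|c|] differ by less than [|c|], so the multiplier of [c] is zero. *)
have z0 : z = 0.
  by apply/eqP; apply: contraT => z0; nia.
by move: E; rewrite z0 mul0r; lia.
Qed.

End Index.

(** * Prime ideals *)

Section Primes.
Variable F : fieldExtType rat.
Local Notation n := (\dim {:F}).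
Local Notation O := (unit_ideal F).
Local Notation OT := (ring_of_integers F).
Implicit Types (x y : F) (a b w : n.-tuple F) (A B Q : set F).

Lemma fideal_omodule A : fideal A -> omodule A. Proof. by case. Qed.
Lemma fideal_subgrp A : fideal A -> subgrp A. Proof. by case=> -[]. Qed.
Local Hint Resolve fideal_omodule fideal_subgrp fideal_O fideal_fracmul fideal_fracinv : core.

Lemma O1 : O 1. Proof. by apply/unit_idealP; exact: rpred1. Qed.

Lemma fracmulS A B Q : omodule A -> B `<=` Q -> fracmul A B `<=` fracmul A Q.
Proof.
move=> oA BQ; apply: fracmul_sub; first exact: subgrp_fracmul.
by move=> x y Ax /BQ Qy; exact: fracmul_gen.
Qed.

Lemma fracmulVK A B : fideal A -> fideal B -> fracmul (fracinv A) (fracmul A B) = B.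
Proof.
move=> fA fB; rewrite fracmulA; auto.
by rewrite (fracmulC (fracinv A)) fracmulV // fracmul1; auto.
Qed.

Lemma fracmulKV A B : fideal A -> fideal B -> fracmul A (fracmul (fracinv A) B) = B.
Proof.
move=> fA fB; rewrite fracmulA; auto.
by rewrite fracmulV // fracmul1; auto.
Qed.

Lemma fracmulI A B Q : fideal A -> fideal B -> fideal Q ->
  fracmul A B `<=` fracmul A Q -> B `<=` Q.
Proof.
move=> fA fB fQ /(@fracmulS (fracinv A)); rewrite !fracmulVK //.
by apply; auto.
Qed.

Lemma has_disc_ex A : fideal A -> exists d, has_disc A d.
Proof. by move=> /fideal_basis[b bb bA]; exists (disc b), b. Qed.

Definition val_set (P : set OT) : set F := [set val x | x in P].

Lemma val_setE (P : set OT) (x : OT) : val_set P (val x) <-> P x.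
Proof. by split=> [[y Py /val_inj <-]|Px] //; exists x. Qed.

Lemma val_set_sub (P : set OT) : val_set P `<=` O.
Proof. by move=> _ [x _ <-]; exists x. Qed.

(** Prime ideals seen as subsets of [F], where the operations on fractional ideals apply to them;
    being nonzero is part of [fideal]. *)
Variant prime_fideal Q : Prop := PrimeFideal of fideal Q & Q `<=` O & ~ Q 1 &
  (forall x y, O x -> O y -> Q (x * y) -> Q x \/ Q y).

Lemma prime_ideals_prime_fideal (P : set OT) : prime_ideals F P -> prime_fideal (val_set P).
Proof.
move=> [[P0 P1 Pid] Pp [x0 Px0 x00]].
have {P0}P0 : P 0 by move: (P0 : 0 \in P); rewrite in_setE.
have {P1}P1 : ~ P 1 by move=> P1'; move/negP: (P1 : 1 \notin P); rewrite in_setE.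
have {}Pid (a u v : OT) : P u -> P v -> P (a * u + v).
  move=> Pu Pv; have Pu' : u \in P by rewrite in_setE.
  have Pv' : v \in P by rewrite in_setE.
  by have : a * u + v \in P := Pid a u v Pu' Pv'; rewrite in_setE.
split.
- split.
  + split; first split.
    * by exists 0.
    * move=> _ _ [x Px <-] [y Py <-]; exists (x - y) => //.
      by rewrite addrC -mulN1r; exact: Pid.
    * move=> o _ oO [x Px <-].
      exists (RingOfIntegers oO * x) => //; rewrite -[_ * x]addr0; exact: Pid.
  + by exists (val x0); [exists x0|].
  + by exists 1 => // _ [x _ <-]; rewrite mul1r; case: x.
- exact: val_set_sub.
- by move=> /(val_setE P 1).
- move=> _ _ [x _ <-] [y _ <-]; rewrite !val_setE => Pxy.
  have {}Pxy : x * y \in P by rewrite in_setE; exact/(val_setE P (x * y)).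
  have : (x \in P) || (y \in P) := Pp x y Pxy.
  by move=> /orP[]; rewrite in_setE; [left|right].
Qed.

Lemma prime_fideal_prime_ideals Q : prime_fideal Q ->
  prime_ideals F [set x : OT | Q (val x)] /\ val_set [set x : OT | Q (val x)] = Q.
Proof.
move=> [[[sQ oQ] [x Qx x0] _] QO Q1 Qp].
have E : val_set [set x : OT | Q (val x)] = Q.
  apply/seteqP; split=> [_ [y Qy <-] //|y Qy].
  by have [z _ zy] := QO _ Qy; exists z; rewrite //= zy.
pose P := [set x : OT | Q (val x)].
have inP z : (z \in P) = `[< Q (val z) >] by apply/idP/asboolP; rewrite in_setE.
have P0 : 0 \in P by rewrite inP; apply/asboolP; case: sQ.
have P1 : 1 \notin P by rewrite inP; apply/negP => /asboolP.
have Pid (a u v : OT) : u \in P -> v \in P -> a * u + v \in P.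
  rewrite !inP => /asboolP Qu /asboolP Qv; apply/asboolP; apply: (@subgrpD F Q) => //.
  by apply: oQ => //; case: a.
have Pp (u v : OT) : u * v \in P -> (u \in P) || (v \in P).
  rewrite !inP => /asboolP Quv; apply/orP.
  have [|||] := Qp (val u) (val v) _ _ Quv; first by exists u.
  - by exists v.
  - by left; apply/asboolP.
  - by right; apply/asboolP.
split=> //; split; [by split|by []|].
have [z _ zx] := QO _ Qx; exists z; rewrite /= ?zx //.
by apply: contraNneq x0 => z0; rewrite -zx z0.
Qed.

(** If [q] lies in [Q] but not in [P], then [Q J = P] with [J = Q^-1 P], and primality forces [J]
    into [P]. Cancelling [P] puts [Q^-1] inside the integers, and multiplying by [Q] gives
    [Q = O]. *)
Lemma prime_fideal_max P Q : prime_fideal P -> omodule Q -> P `<=` Q -> Q `<=` O ->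
  Q = P \/ Q = O.
Proof.
move=> [fP PO P1 Pp] oQ PQ QO.
have fQ : fideal Q.
  split=> //; first by case: fP => _ [x /PQ Qx x0] _; exists x.
  by exists 1 => // x /QO /unit_idealP; rewrite mul1r.
have [QP|] := pselect (Q `<=` P); first by left; apply/seteqP.
move=> /existsNP[q /not_implyP[Qq Pq]]; right.
pose J := fracmul (fracinv Q) P.
have fJ : fideal J by rewrite /J; auto.
have QJ : fracmul Q J = P by exact: fracmulKV.
have JO : J `<=` O.
  have -> : O = fracmul (fracinv Q) Q by rewrite fracmulC fracmulV.
  by apply: fracmulS => //; auto.
have JP : J `<=` P.
  move=> j Jj; have Pqj : P (q * j) by rewrite -QJ; exact: fracmul_gen.
  by case: (Pp q j (QO _ Qq) (JO _ Jj) Pqj).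
apply/seteqP; split=> //.
have QinvO : fracinv Q `<=` O.
  apply: (@fracmulI P) => //; auto.
  by rewrite fracmulC (fracmulC P) fracmul1 //; auto.
have := @fracmulS Q _ _ oQ QinvO; rewrite fracmulV // (fracmulC Q) fracmul1 //.
Qed.

Section DiscPrime.
Variables (P A : set F).
Hypothesis pP : prime_fideal P.
Hypothesis fA : fideal A.

Let fP : fideal P. Proof. by case: pP. Qed.
Let fAP : fideal (fracmul A P). Proof. by auto. Qed.

Lemma fracmul_prime_sub : fracmul A P `<=` A.
Proof.
case: pP => _ PO _ _; have := @fracmulS A _ _ (fideal_omodule fA) PO.
by rewrite (fracmulC A O) fracmul1; auto.
Qed.

(** Multiplication by an [a] in [A] outside [A P] induces [O/P = A/AP]. Its kernel [T] contains [P]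
    but not 1, hence equals [P]; its image [Q] satisfies that [A^-1 Q] contains [P] strictly, hence
    is [O]. *)
Lemma residues_transfer (I : finType) (r : I -> F) : residues O P r ->
  exists r' : I -> F, residues A (fracmul A P) r'.
Proof.
case: (pP) => _ PO P1 _ [rO rC rI].
have [sA oA] := fideal_omodule fA.
have [sAP oAP] := fideal_omodule fAP.
have [a /not_implyP[Aa APa]] : exists a : F, ~ (A a -> fracmul A P a).
  apply/existsNP => AP; apply: P1.
  suff : O `<=` P by apply; exact: O1.
  apply: (@fracmulI A) => //; auto.
  by rewrite (fracmulC A O) fracmul1; auto.
pose T := [set x | O x /\ fracmul A P (x * a)].
have TP : T = P.
  have oT : omodule T.
    split; first split.
    - by split; [case: (omodule_O F) => -[]|rewrite mul0r; case: sAP].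
    - move=> x y [xO xa] [yO ya]; split; first by apply: (omodule_O F).1.2.
      by rewrite mulrBl; exact: sAP.2.
    - move=> o x oo [xO xa]; split; first exact: (omodule_O F).2.
      by rewrite -mulrA; exact: oAP.
  have [| |//|TO] := prime_fideal_max pP oT.
  - by move=> x Px; split; [exact: PO|rewrite mulrC; exact: fracmul_gen].
  - by move=> x [].
  - have : T 1 by rewrite TO; exact: O1.
    by move=> [_]; rewrite mul1r.
pose Q := [set x | exists2 o, O o & fracmul A P (x - o * a)].
have oQ : omodule Q.
  split; first split.
  - exists 0; first by case: (omodule_O F) => -[].
    by rewrite mul0r subrr; case: sAP.
  - move=> x y [u oo xo] [v oo' yo]; exists (u - v); first exact: (omodule_O F).1.2.
    have -> : x - y - (u - v) * a = (x - u * a) - (y - v * a) by ring.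
    exact: sAP.2.
  - move=> u x uO [v oo xo]; exists (u * v); first exact: (omodule_O F).2.
    by rewrite -mulrA -mulrBr; exact: oAP.
have Qa : Q a by exists 1; rewrite ?mul1r ?subrr; [exact: O1|case: sAP].
have APQ : fracmul A P `<=` Q.
  by move=> x xAP; exists 0; rewrite ?mul0r ?subr0 //; case: (omodule_O F) => -[].
have QA : Q `<=` A.
  move=> x [v oo xo]; rewrite -(subrK (v * a) x); apply: (@subgrpD F A) => //.
    exact: fracmul_prime_sub.
  by apply: oA => //; apply/unit_idealP.
have fQ : fideal Q.
  split=> //; first by exists a => //; apply: contra_notN APa => /eqP ->; case: sAP.
  by case: fA => _ _ [m m0 mA]; exists m => // x /QA; exact: mA.
have QE : Q = A.
  have [|||E|E] := @prime_fideal_max P (fracmul (fracinv A) Q) pP.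
  - by auto.
  - have -> : P = fracmul (fracinv A) (fracmul A P) by rewrite fracmulVK.
    by apply: fracmulS; auto.
  - have -> : O = fracmul (fracinv A) A by rewrite fracmulC fracmulV.
    by apply: fracmulS; auto.
  - case: APa; rewrite -E fracmulKV //.
  - by rewrite -(fracmulKV fA fQ) E fracmulC fracmul1; auto.
exists (fun i => r i * a); split=> [i|x|i j].
- by apply: oA => //; apply/unit_idealP.
- move=> Ax; have [v oo xo] : Q x by rewrite QE.
  have [i oi] := rC _ oo; exists i.
  have -> : x - r i * a = (x - v * a) + a * (v - r i) by ring.
  by apply: (@subgrpD F (fracmul A P)) => //; exact: fracmul_gen.
- rewrite -mulrBl => ra; apply: rI; rewrite -TP; split=> //.
  by apply: (omodule_O F).1.2.
Qed.

End DiscPrime.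

Lemma residue_card_residues (P : set OT) (I : finType) (r : I -> F) : subgrp (val_set P) ->
  residues O (val_set P) r -> residue_card P = #|I|.
Proof.
move=> sP [rO rC rI].
have H i : exists z : OT, val z = r i by have [z _ zr] := rO i; exists z.
have [r' r'E] := choice H.
pose coset (x : OT) : set OT := [set y | P (y - x)].
have cosE (x y : OT) : P (x - y) -> coset x = coset y.
  move=> /(val_setE P (x - y)).2 Pxy; apply/seteqP; split=> z /(val_setE P _).2 Pz.
    apply/(val_setE P _).1; rewrite -(subrK x z) -addrA.
    by apply: (@subgrpD F (val_set P)).
  apply/(val_setE P _).1; have -> : val (z - x) = val (z - y) - val (x - y).
    by rewrite /=; ring.
  exact: sP.2.
pose S := seq_fset tt [seq coset (r' i) | i <- enum I].
have inj : injective (fun i => coset (r' i)).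
  move=> i j ij; apply: rI; rewrite -!r'E.
  have : coset (r' i) (r' i) by rewrite /coset /= subrr; apply/(val_setE P 0); case: sP.
  by rewrite ij => Pij; apply/(val_setE P (r' i - r' j)).
(* [fset_set] sends an infinite set to the empty one, so the set of cosets is first exhibited as the
   explicit finite set [S]. *)
have -> : residue_card P = #|` fset_set [set` S]|.
  congr (#|` fset_set _|); apply/seteqP; split.
    move=> _ [x _ <-]; have [|i xi] := rC (val x); first by exists x.
    rewrite /= seq_fsetE; apply/mapP; exists i; rewrite ?mem_enum //.
    by apply: cosE; apply/val_setE; rewrite /= r'E.
  by move=> s; rewrite /= seq_fsetE => /mapP[i _ ->]; exists (r' i).
rewrite set_fsetK size_seq_fset undup_id; last by rewrite map_inj_uniq ?enum_uniq.
by rewrite size_map -cardE.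
Qed.

(** The matrix of [A P] in [A] has determinant of absolute value the index, which
    [residues_transfer] identifies with the index of [P]; discriminants scale by its square. *)
Lemma has_disc_prime (P : set OT) A d : prime_ideals F P -> fideal A -> has_disc A d ->
  has_disc (fracmul A (val_set P)) ((residue_card P)%:R ^+ 2 * d) /\ (0 < residue_card P)%N.
Proof.
move=> /prime_ideals_prime_fideal pP fA [a aA ->].
have [fP PO _ _] := pP.
have [ob oO] : exists b, zbasis O b by have [d' [b bO _]] := has_disc_ex (fideal_O F); exists b.
have [p pPb] : exists b, zbasis (val_set P) b by have [d' [b bO _]] := has_disc_ex fP; exists b.
have [M pE] := zbasis_sub pPb oO PO.
have [I [r [rP cI]]] := residues_exist pPb oO pE.
have [r' r'P] := residues_transfer pP fA rP.
have fAP : fideal (fracmul A (val_set P)) by auto.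
have [q qAP] : exists b, zbasis (fracmul A (val_set P)) b by have [d' [b bO _]] := has_disc_ex fAP; exists b.
have [N qE] := zbasis_sub qAP aA (fracmul_prime_sub pP fA).
have [J [s [sP cJ]]] := residues_exist qAP aA qE.
rewrite (residue_card_residues (fideal_subgrp fP) rP).
rewrite (residues_card (fideal_subgrp fAP) r'P sP) cJ; split.
  exists q => //; rewrite (disc_lincomb qE); congr (_ * _).
  by rewrite pmulrn abszE intr_norm real_normK ?num_real.
rewrite absz_gt0; apply: contraTneq (zbasis_disc_neq0 qAP) => N0.
by rewrite (disc_lincomb qE) N0 expr0n mul0r eqxx.
Qed.

End Primes.

(** * The group of fractional ideals *)

Section FracIdealGroup.
Variable F : fieldExtType rat.

(* The product of fractional ideals is written additively, so that formal sums
   of primes map to it. *)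
Record fid := Fid { fid_val : set F; _ : `[< fideal fid_val >] }.

HB.instance Definition _ := [isSub for fid_val].
HB.instance Definition _ := [Choice of fid by <:].

Lemma fidP (A : fid) : fideal (val A).
Proof. by case: A => A /= /asboolP. Qed.

Definition fid0 := Fid (introT (asboolP _) (fideal_O F)).
Definition fid_opp (A : fid) := Fid (introT (asboolP _) (fideal_fracinv (fidP A))).
Definition fid_add (A B : fid) :=
  Fid (introT (asboolP _) (fideal_fracmul (fidP A) (fidP B))).

Lemma fid_addA : associative fid_add.
Proof.
move=> A B M; apply: val_inj => /=.
by apply: fracmulA; apply: fideal_omodule; exact: fidP.
Qed.

Lemma fid_addC : commutative fid_add.
Proof. by move=> A B; apply: val_inj; exact: fracmulC. Qed.

Lemma fid_add0 : left_id fid0 fid_add.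
Proof. by move=> A; apply: val_inj; apply: fracmul1; apply: fideal_omodule; exact: fidP. Qed.

Lemma fid_addN : left_inverse fid0 fid_opp fid_add.
Proof. by move=> A; apply: val_inj => /=; rewrite fracmulC; apply: fracmulV; exact: fidP. Qed.

HB.instance Definition _ := GRing.isZmodule.Build fid fid_addA fid_addC fid_add0 fid_addN.

Lemma val_fidD (A B : fid) : val (A + B) = fracmul (val A) (val B). Proof. by []. Qed.
Lemma val_fidN (A : fid) : val (- A) = fracinv (val A). Proof. by []. Qed.

Lemma fracexp_fid (A : fid) (z : int) : fracexp (val A) z = val (A *~ z).
Proof.
have H (B : fid) k : iter k (fracmul (val B)) (unit_ideal F) = val (B *+ k).
  by elim: k => [//|k IH]; rewrite iterS IH mulrS.
case: z => k; first exact: H.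
by rewrite [LHS](H (- A) k.+1) mulNrn.
Qed.

Definition prime_fid (P : prime_ideals F) : fid.
Proof.
refine (@Fid (val_set (val P)) _); apply/asboolP.
by case: (prime_ideals_prime_fideal (set_valP P)).
Defined.

(** Additivity compares sums over the supports of [D], [E] and [D + E], which differ; enlarging them
    to a common list costs only zero terms. *)
Lemma sum_dom_wide (M : zmodType) (K : choiceType) (D : {freeg K / int}) (s : seq K)
  (g : K -> int -> M) : (forall P, g P 0 = 0) -> uniq s -> {subset dom D <= s} ->
  \sum_(P <- dom D) g P (coeff P D) = \sum_(P <- s) g P (coeff P D).
Proof.
move=> g0 us sub; rewrite [RHS](bigID (fun P => P \in dom D)) /= [X in _ = _ + X]big1 ?addr0; last first.
  by move=> P PD; rewrite (coeff_outdom PD).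
rewrite -[RHS]big_filter; apply: perm_big; apply: uniq_perm; rewrite ?uniq_dom ?filter_uniq //.
by move=> P; rewrite mem_filter; case: (boolP (P \in dom D)) => // /sub ->.
Qed.

Definition fid_of (D : {freeg (prime_ideals F) / int}) : fid :=
  \sum_(P <- dom D) prime_fid P *~ - coeff P D.

Lemma fid_ofD D E : fid_of (D + E) = fid_of D + fid_of E.
Proof.
pose s := undup (dom D ++ dom E ++ dom (D + E)).
have us : uniq s by exact: undup_uniq.
have g0 P : prime_fid P *~ - 0 = 0 by rewrite oppr0 mulr0z.
rewrite /fid_of !(@sum_dom_wide _ _ _ s (fun P z => prime_fid P *~ - z)) //.
- rewrite -big_split /=; apply: eq_bigr => P _.
  by rewrite coeffD opprD mulrzDr.
- by move=> P PE; rewrite mem_undup !mem_cat PE orbT.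
- by move=> P PE; rewrite mem_undup !mem_cat PE.
- by move=> P PE; rewrite mem_undup !mem_cat PE !orbT.
Qed.

Lemma fid_of0 : fid_of 0 = 0.
Proof. by rewrite /fid_of dom0 big_nil. Qed.

Lemma fid_ofN D : fid_of (- D) = - fid_of D.
Proof. by apply/eqP; rewrite -subr_eq0 opprK -fid_ofD addNr fid_of0. Qed.

Lemma fid_ofU P z : fid_of << z *g P >> = prime_fid P *~ - z.
Proof.
rewrite /fid_of (@sum_dom_wide _ _ _ [:: P] (fun P z => prime_fid P *~ - z)) //.
- by rewrite big_seq1 coeffU eqxx mulr1.
- move=> Q; rewrite mem_dom coeffU; have [->|_] := eqVneq P Q; first by rewrite inE eqxx.
  by rewrite mulr0 eqxx.
Qed.

Lemma ideal_of_fid (R : realType) (Phi : set (F -> R[i])) (D : arakelov_divisor Phi) :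
  ideal_of D = val (fid_of D.1).
Proof.
rewrite /ideal_of /fid_of.
elim: (dom D.1) => [|P s IH]; first by rewrite !big_nil.
by rewrite !big_cons val_fidD IH -fracexp_fid.
Qed.

Local Notation O := (unit_ideal F).

Lemma has_disc_sub (A B : set F) d d' : A `<=` B -> has_disc A d -> has_disc B d' ->
  exists k : nat, [/\ (0 < k)%N, d = k%:R ^+ 2 * d' & k = 1%N -> A = B].
Proof.
move=> AB [a aA ->] [b bB ->]; have [M aE] := zbasis_sub aA bB AB.
have M0 : \det M != 0.
  apply: contraTneq (zbasis_disc_neq0 aA) => M0.
  by rewrite (disc_lincomb aE) M0 expr0n mul0r eqxx.
exists (absz (\det M)); split.
- by rewrite absz_gt0.
- by rewrite (disc_lincomb aE) pmulrn abszE intr_norm real_normK ?num_real.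
- move=> M1; have Mu : M \in unitmx.
    have : (\det M == 1) || (\det M == -1) by lia.
    by rewrite unitmxE.
  apply/seteqP; split=> // x /(zbasisP _ bB)[v ->]; apply/(zbasisP _ aA).
  by exists (v *m invmx M); rewrite (lincomb_mul _ aE) mulmxKV.
Qed.

Lemma disc_O_ex : exists2 d, has_disc O d & d != 0.
Proof.
have [d [b bO _]] := has_disc_ex (fideal_O F).
by exists (disc b); [exists b|exact: zbasis_disc_neq0 bO].
Qed.

(** A proper module [P] of minimal index between [A] and [O] is prime: if [x y] is in [P] and [x] is
    not, then [P + O x] has smaller index, so it contains 1, say [1 - u x] is in [P], and
    [y = y (1 - u x) + u x y] is in [P]. *)
Lemma prime_above (A : set F) : fideal A -> A `<=` O -> ~ A 1 ->
  exists2 P, prime_fideal P & A `<=` P.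
Proof.
move=> fA AO A1; have [d dO d0] := disc_O_ex.
pose good Q := [/\ omodule Q, A `<=` Q, Q `<=` O & ~ Q 1].
have good_fid Q : good Q -> fideal Q.
  move=> [oQ AQ QO _]; split=> //; first by case: fA => _ [x /AQ Qx x0] _; exists x.
  by exists 1 => // x /QO /unit_idealP; rewrite mul1r.
pose idx (Q : set F) (k : nat) := has_disc Q (k%:R ^+ 2 * d).
have idx_ex Q : good Q -> exists k, idx Q k.
  move=> gQ; have [e eQ] := has_disc_ex (good_fid _ gQ); have [_ _ QO _] := gQ.
  by have [k [_ E _]] := has_disc_sub QO eQ dO; exists k; rewrite /idx -E.
have ex : exists k : nat, `[< exists2 Q, good Q & idx Q k >].
  have gA : good A by split=> //; case: fA.
  by have [k Ak] := idx_ex _ gA; exists k; apply/asboolP; exists A.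
have [k /asboolP[P gP Pk] kmin] := ex_minnP ex.
have [oP AP PO P1] := gP.
exists P => //; split=> // [|x y xO yO Pxy]; first exact: good_fid.
have [Px|Px] := pselect (P x); [by left|right].
pose Q := [set z | exists2 u, O u & P (z - u * x)].
have sP := oP.1.
have PQ : P `<=` Q.
  by move=> z Pz; exists 0; rewrite ?mul0r ?subr0 //; case: (omodule_O F) => -[].
have QO : Q `<=` O.
  move=> z [u uO Pz]; rewrite -(subrK (u * x) z); apply: (subgrpD (omodule_O F).1); first exact: PO.
  by apply: (omodule_O F).2 => //; apply/unit_idealP.
have oQ : omodule Q.
  split; first split.
  - by apply: PQ; case: sP.
  - move=> z w [u uO Pz] [v vO Pw]; exists (u - v); first exact: (omodule_O F).1.2.
    have -> : z - w - (u - v) * x = (z - u * x) - (w - v * x) by ring.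
    exact: sP.2.
  - move=> c z cO [u uO Pz]; exists (c * u); first exact: (omodule_O F).2.
    by rewrite -mulrA -mulrBr; exact: oP.2.
have Qx : Q x by exists 1; [exact: O1|rewrite mul1r subrr; case: sP].
have [[u uO Pu]|Q1] := pselect (Q 1).
  have -> : y = y * (1 - u * x) + u * (x * y) by ring.
  apply: (subgrpD sP); first by apply: oP.2 => //; apply/unit_idealP.
  by apply: oP.2 => //; apply/unit_idealP.
have gQ : good Q by split=> // z /AP /PQ.
have [k' Qk'] := idx_ex _ gQ.
have [j [j0 E j1]] := has_disc_sub PQ Pk Qk'.
have kE : k = (j * k')%N.
  have : k%:R ^+ 2 = (j * k')%:R ^+ 2 :> rat.
    by apply: (mulIf d0); rewrite E natrM exprMn mulrA.
  move=> /eqP; rewrite eqrXn2 // => /eqP/eqP; rewrite eqr_nat => /eqP //.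
have k'min : (k <= k')%N by apply: kmin; apply/asboolP; exists Q.
have k0 : (0 < k)%N.
  have [b bP E'] := Pk; have := zbasis_disc_neq0 bP; rewrite -E'.
  by rewrite lt0n; apply: contraNneq => ->; rewrite expr0n mul0r.
have j1' : j = 1%N by nia.
by case: Px; rewrite (j1 j1').
Qed.

(** Strong induction on the index [k] of an integral ideal: dividing by a prime above it divides [k]
    by the size of the residue ring, which is not 1. *)
Lemma fid_of_surj (A : fid) : exists D, fid_of D = A.
Proof.
have [d dO d0] := disc_O_ex.
have main k (B : fid) : val B `<=` O -> has_disc (val B) (k%:R ^+ 2 * d) -> exists D, fid_of D = B.
  elim/ltn_ind: k B => k IH B BO Bk.
  have [B1|B1] := pselect (val B 1).
    exists 0; rewrite fid_of0; apply: val_inj; apply/seteqP; split=> //= x /unit_idealP xO.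
    by rewrite -[x]mulr1; apply: (fideal_omodule (fidP B)).2.
  have [Q pQ BQ] := prime_above (fidP B) BO B1.
  have [Pp PE] := prime_fideal_prime_ideals pQ.
  pose P : prime_ideals F := SigSub (mem_set Pp).
  have vP : val (prime_fid P) = Q by exact: PE.
  pose B' := B - prime_fid P.
  have B'O : val B' `<=` O.
    have -> : O = val (prime_fid P - prime_fid P) by rewrite subrr.
    rewrite /B' !val_fidD (fracmulC (val B)) (fracmulC (val (prime_fid P))); apply: fracmulS.
      by apply: fideal_omodule; exact: fidP.
    by rewrite vP.
  have [e Be] := has_disc_ex (fidP B').
  have [k' [k'0 eE _]] := has_disc_sub B'O Be dO.
  have [H c0] := has_disc_prime Pp (fidP B') Be.
  have BE : fracmul (val B') (val_set [set x | Q (val x)]) = val B.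
    by rewrite PE -vP -val_fidD /B' subrK.
  rewrite BE in H; set c := residue_card _ in H c0.
  have [Oc _] := has_disc_prime Pp (fideal_O F) dO.
  rewrite -/c PE fracmul1 in Oc; last by case: pQ => -[].
  have c1 : c != 1%N.
    apply/eqP => c1; have [_ QO Q1 _] := pQ; apply: Q1.
    rewrite c1 expr1n mul1r in Oc.
    have [j [_ E Ej]] := has_disc_sub QO Oc dO.
    rewrite Ej; first exact: O1.
    have : j%:R ^+ 2 = 1 ^+ 2 :> rat by apply: (mulIf d0); rewrite -E expr1n mul1r.
    by move=> /eqP; rewrite eqrXn2 // => /eqP/eqP; rewrite (eqr_nat _ j 1) => /eqP.
  have kE : k = (c * k')%N.
    have E := has_disc_unique H Bk.
    have : k%:R ^+ 2 = (c * k')%:R ^+ 2 :> rat.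
      by apply: (mulIf d0); rewrite -E eE natrM exprMn mulrA.
    by move=> /eqP; rewrite eqrXn2 // => /eqP/eqP; rewrite eqr_nat => /eqP.
  have k'k : (k' < k)%N by rewrite kE; nia.
  rewrite eE in Be; have [D DE] := IH k' k'k B' B'O Be.
  exists (D - << 1 *g P >>).
  by rewrite fid_ofD fid_ofN fid_ofU DE /B' mulrN1z opprK subrK.
have int_fid (B : fid) : val B `<=` O -> exists D, fid_of D = B.
  move=> BO; have [e Be] := has_disc_ex (fidP B).
  have [k [_ E _]] := has_disc_sub BO Be dO.
  by apply: (main k) => //; rewrite -E.
(* A general ideal is the quotient of the two integral ideals [A (m)] and [(m)]. *)
have [oA [x Ax x0] [m m0 mA]] := fidP A.
pose N : set F := [set y | exists2 u, O u & y = u * m%:~R].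
have fN : fideal N.
  split.
  - split; first split.
    + by exists 0; rewrite ?mul0r //; case: (omodule_O F) => -[].
    + move=> _ _ [u uO ->] [v vO ->]; exists (u - v); last by rewrite mulrBl.
      exact: (omodule_O F).1.2.
    + by move=> c _ cO [u uO ->]; exists (c * u); rewrite ?mulrA //; exact: (omodule_O F).2.
  - by exists m%:~R; rewrite ?intF_eq0 //; exists 1; rewrite ?mul1r //; exact: O1.
  - exists 1 => // _ [u /unit_idealP uO ->]; rewrite mul1r.
    by apply: rpredM => //; exact: algint_int.
pose B := Fid (introT (asboolP _) fN).
have [D DE] : exists D, fid_of D = B.
  apply: int_fid => _ [u uO ->]; apply/unit_idealP.
  by apply: rpredM; [apply/unit_idealP|exact: algint_int].
have [E EE] : exists E, fid_of E = A + B.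
  apply: int_fid; rewrite val_fidD; apply: fracmul_sub; first by case: (omodule_O F).
  move=> y _ Ay [u uO ->]; rewrite mulrCA mulrC; apply/unit_idealP.
  by rewrite mulrC; apply: rpredM; [apply/unit_idealP|rewrite mulrC; exact: mA].
by exists (E - D); rewrite fid_ofD fid_ofN DE EE addrK.
Qed.

End FracIdealGroup.

(** * Duality *)

Section Dual.
Variable F : fieldExtType rat.
Local Notation n := (\dim {:F}).
Local Notation O := (unit_ideal F).
Local Notation tr := (@field_trace F).
Implicit Types (x y : F) (b w : n.-tuple F) (A B : set F).

Lemma traceD x y : tr (x + y) = tr x + tr y.
Proof.
have [e [t [e_inj _]]] := embeddings_exist F algC.
apply: (fmorph_inj (ratr : rat -> algC)); rewrite rmorphD [LHS](trace_emb e_inj).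
rewrite [X in _ = X + _](trace_emb e_inj) [X in _ = _ + X](trace_emb e_inj) -big_split /=.
by apply: eq_bigr => i _; rewrite rmorphD.
Qed.

Lemma traceZ (c : rat) x : tr (c *: x) = c * tr x.
Proof.
have [e [t [e_inj _]]] := embeddings_exist F algC.
apply: (fmorph_inj (ratr : rat -> algC)); rewrite rmorphM [LHS](trace_emb e_inj).
rewrite [X in _ = _ * X](trace_emb e_inj) mulr_sumr.
by apply: eq_bigr => i _; rewrite rmorph_scale.
Qed.

Lemma trace0 : tr 0 = 0.
Proof. by rewrite -(scale0r (0 : F)) traceZ mul0r. Qed.

Lemma trace_sum (I : Type) (r : seq I) (f : I -> F) :
  tr (\sum_(i <- r) f i) = \sum_(i <- r) tr (f i).
Proof. exact: (big_morph tr traceD trace0). Qed.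

Definition trace_dual A : set F := [set x | forall a, A a -> tr (x * a) \is a Num.int].

Lemma dual_basis_exists b : basis_of {:F} b -> exists2 b' : n.-tuple F, basis_of {:F} b' &
  forall i j : 'I_n, tr (b`_i * b'`_j) = (i == j)%:R.
Proof.
have [e [t [e_inj _]]] := embeddings_exist F algC.
rewrite (basis_of_disc e_inj) => db.
pose T := \matrix_(i < n, j < n) tr (b`_i * b`_j).
have Tu : T \in unitmx by rewrite unitmxE unitfE.
pose b' : n.-tuple F := [tuple \sum_k (invmx T) j k *: b`_k | j < n].
have b'E (j : 'I_n) : b'`_j = \sum_k (invmx T) j k *: b`_k by rewrite -tnth_nth tnth_mktuple.
exists b'.
  rewrite (basis_of_disc e_inj) (disc_mul e_inj b'E) mulf_neq0 // expf_neq0 //.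
  by rewrite -unitfE -unitmxE unitmx_inv.
move=> i j; rewrite b'E mulr_sumr trace_sum eq_sym.
transitivity ((invmx T *m T) j i); last by rewrite mulVmx // mxE.
by rewrite mxE; apply: eq_bigr => k _; rewrite -scalerAr traceZ mxE [b`_k * _]mulrC.
Qed.

Lemma zbasis_trace_dual A b b' : zbasis A b -> basis_of {:F} b' ->
  (forall i j : 'I_n, tr (b`_i * b'`_j) = (i == j)%:R) -> zbasis (trace_dual A) b'.
Proof.
move=> bA bb' dual; split=> // x; split.
  move=> xA; pose c i := coord b' i x.
  have xE : x = \sum_(i < n) c i *: b'`_i by rewrite {1}(coord_basis bb' (memvf x)).
  have cE (i : 'I_n) : tr (x * b`_i) = c i.
    rewrite xE mulr_suml trace_sum (bigD1 i) //= big1 ?addr0.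
      by rewrite -scalerAl traceZ [b'`_i * _]mulrC dual eqxx mulr1.
    move=> j /negbTE ji; rewrite -scalerAl traceZ [b'`_j * _]mulrC dual eq_sym ji.
    by rewrite mulr0.
  exists [ffun i => Num.floor (c i)]; rewrite {1}xE; apply: eq_bigr => i _.
  rewrite ffunE -scaler_int; congr (_ *: _).
  have : c i \is a Num.int by rewrite -cE; apply: xA; apply/bA.2; exact: inIntSpan_nth.
  by move=> /intrP[z ->]; rewrite intrKfloor.
move=> [u ->] _ /(zbasisP _ bA)[v ->].
rewrite mulr_suml trace_sum rpred_sum // => i _; rewrite mulr_sumr trace_sum rpred_sum // => j _.
rewrite -!scaler_int -scalerAl -scalerAr !traceZ mulrC.
by rewrite [b'`_i * _]mulrC dual !rpredM ?rpred_nat ?rpred_int.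
Qed.

Lemma omodule_trace_dual A : omodule A -> omodule (trace_dual A).
Proof.
move=> [sA oA]; split; first split.
- by move=> a _; rewrite mul0r trace0 rpred0.
- move=> x y xA yA a Aa; rewrite mulrBl traceD -scaleN1r traceZ mulN1r.
  by rewrite rpredB //; [exact: xA|exact: yA].
- by move=> c x cO xA a Aa; rewrite mulrAC mulrC; apply: xA; exact: oA.
Qed.

Lemma span_denom b : exists2 m : int, m != 0 &
  forall x, inIntSpan b x -> m%:~R * x \in @is_algint F.
Proof.
pose m (i : 'I_n) := s2val (cid2 (algint_denom b`_i)).
have m0 i : m i != 0 by rewrite /m; case: cid2.
have mi i : (m i)%:~R * b`_i \in @is_algint F by rewrite /m; case: cid2.
exists (\prod_i m i); first exact/prodf_neq0.
move=> _ [c ->]; rewrite mulr_sumr rpred_sum // => i _.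
rewrite mulrzAr rpredMz // (bigD1 i) //=; move: (\prod_(j < n | _) _) => p.
have -> : (m i * p)%:~R * b`_i = p%:~R * ((m i)%:~R * b`_i) by rewrite intrM; ring.
by apply: rpredM; [exact: algint_int|exact: mi].
Qed.

Lemma fideal_trace_dual A : fideal A -> fideal (trace_dual A).
Proof.
move=> fA; have [b bb bA] := fideal_basis fA.
have [b' bb' dual] := dual_basis_exists bb.
have [_ bA'] := zbasis_trace_dual (conj bb bA) bb' dual.
have [m m0 mP] := span_denom b'.
split; first by apply: omodule_trace_dual; case: fA.
  exists b'`_(Ordinal (dim_gt0 F)); first by apply/bA'; exact: inIntSpan_nth.
  apply/eqP => b0; have := dual (Ordinal (dim_gt0 F)) (Ordinal (dim_gt0 F)).
  by rewrite b0 mulr0 trace0 eqxx => /eqP; rewrite eq_sym oner_eq0.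
by exists m => // x /bA'; exact: mP.
Qed.

Lemma codifferentE : codifferent F = trace_dual O.
Proof. by []. Qed.

(** For the inclusion from left to right, the dual is [(dual A) A^-1] times [A], and [(dual A) A]
    pairs integrally with [O]. *)
Lemma trace_dual_mul A : fideal A -> trace_dual A = fracmul (codifferent F) (fracinv A).
Proof.
move=> fA; rewrite codifferentE.
have fO := fideal_O F; have fC := fideal_trace_dual fO.
have [oA _ _] := fA; have [oC _ _] := fC.
have fAV := fideal_fracinv fA; have [oAV _ _] := fAV.
have fD := fideal_trace_dual fA; have [oD _ _] := fD.
apply/seteqP; split; last first.
  apply: fracmul_sub; first by case: oD.
  move=> x y xC yA a Aa; rewrite -mulrA; apply: xC; exact: yA.
have -> : trace_dual A = fracmul (fracmul (trace_dual A) A) (fracinv A).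
  by rewrite -fracmulA // fracmulV // fracmulC fracmul1.
rewrite !(fracmulC _ (fracinv A)); apply: fracmulS => //.
apply: fracmul_sub; first by case: oC.
move=> x a xA Aa y /unit_idealP yO; rewrite -mulrA; apply: xA.
by rewrite mulrC; apply: oA.2.
Qed.

End Dual.

(** * Ideals and discriminants of Arakelov divisors *)

Section Arakelov.
Variables (R : realType) (F : fieldExtType rat) (Phi : set (F -> R[i])).
Local Notation n := (\dim {:F}).
Local Notation O := (unit_ideal F).
Implicit Type D : arakelov_divisor Phi.

Lemma fideal_codifferent : fideal (codifferent F).
Proof. by rewrite codifferentE; apply: fideal_trace_dual; exact: fideal_O. Qed.

Definition codiff_fid : fid F := Fid (introT (asboolP _) fideal_codifferent).

Lemma fracinv_different : fracinv (different F) = codifferent F.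
Proof. by rewrite /different -[RHS]/(val codiff_fid) -[codiff_fid]opprK. Qed.

(** [fid_of_surj] applied to the codifferent shows that the set under [xget] is nonempty, which
    excludes the default value. *)
Lemma canonical_divisorP :
  fid_of (canonical_divisor Phi).1 = codiff_fid /\ forall s, (canonical_divisor Phi).2 s = 0.
Proof.
rewrite /canonical_divisor; case: xgetP => [K _ [KE K2]|H].
  by split => //; apply: val_inj; rewrite -(ideal_of_fid K) KE fracinv_different.
have [D DE] := fid_of_surj codiff_fid.
case: (H (D, fun=> 0)); split => //.
by rewrite (ideal_of_fid (D, fun=> 0)) DE fracinv_different.
Qed.

Lemma ideal_of_canonical_sub D :
  ideal_of (canonical_divisor Phi - D) = trace_dual (ideal_of D).
Proof.
have [K1 _] := canonical_divisorP.
rewrite !ideal_of_fid fid_ofD fid_ofN K1 val_fidD val_fidN trace_dual_mul //.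
exact: fidP.
Qed.

Lemma discriminantP : has_disc O (discriminant F).
Proof.
apply: (@xgetPex _ 0 [set d | has_disc O d]).
exact: has_disc_ex (fideal_O F).
Qed.

Lemma discriminant_neq0 : discriminant F != 0.
Proof. by have [w wO ->] := discriminantP; exact: zbasis_disc_neq0 wO. Qed.

Lemma residue_card_gt0 (P : prime_ideals F) : (0 < residue_card (val P))%N.
Proof.
have Pp : prime_ideals F (val P) := set_valP P.
by have [] := has_disc_prime Pp (fideal_O F) discriminantP.
Qed.

(** For a negative exponent the primes are multiplied back, and [has_disc_unique] compares the
    result with the known discriminant. *)
Lemma has_disc_fid_prime (A : fid F) d (P : prime_ideals F) (z : int) :
  has_disc (val A) d ->
  has_disc (val (A + prime_fid P *~ z)) ((residue_card (val P))%:R ^ (2 * z) * d).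
Proof.
set c : rat := _%:R; have Pp : prime_ideals F (val P) := set_valP P.
have c0 : c != 0 by rewrite pnatr_eq0 -lt0n; exact: residue_card_gt0.
have step (B : fid F) e : has_disc (val B) e -> has_disc (val (B + prime_fid P)) (c ^+ 2 * e).
  by move=> Be; have [] := has_disc_prime Pp (fidP B) Be.
have pos (B : fid F) e k : has_disc (val B) e -> has_disc (val (B + prime_fid P *+ k)) (c ^+ (2 * k) * e).
  move=> Be; elim: k => [|k IH]; first by rewrite mulr0n addr0 muln0 mul1r.
  by rewrite mulrSr addrA mulnS exprD -mulrA; exact: step.
case: z => k Ad; first exact: pos.
rewrite NegzE mulrNz.
have [e Be] := has_disc_ex (fidP (A - prime_fid P *+ k.+1)).
have := pos _ _ k.+1 Be; rewrite subrK => Ad'.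
rewrite (has_disc_unique Ad Ad') mulrA (_ : _ ^ _ = (c ^+ (2 * k.+1))^-1).
  by rewrite mulVf ?mul1r // expf_neq0.
by rewrite mulrN -exprnN.
Qed.

Lemma has_disc_ideal_of D : has_disc (ideal_of D)
  (\prod_(P <- dom D.1) (residue_card (val P))%:R ^ (2 * - coeff P D.1) * discriminant F).
Proof.
rewrite ideal_of_fid /fid_of.
elim: (dom D.1) => [|P s IH]; first by rewrite !big_nil mul1r; exact: discriminantP.
by rewrite !big_cons addrC -mulrA; exact: has_disc_fid_prime.
Qed.

Lemma dual_bases D : exists b b' : n.-tuple F,
  [/\ zbasis (ideal_of D) b, zbasis (ideal_of (canonical_divisor Phi - D)) b',
      forall i j : 'I_n, field_trace (b`_i * b'`_j) = (i == j)%:R &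
      disc b = \prod_(P <- dom D.1) (residue_card (val P))%:R ^ (2 * - coeff P D.1)
               * discriminant F].
Proof.
have [b bA bE] := has_disc_ideal_of D; have [b' bb' dual] := dual_basis_exists bA.1.
exists b, b'; split=> //; rewrite ideal_of_canonical_sub.
exact: zbasis_trace_dual bA bb' dual.
Qed.

End Arakelov.

(** * Places and Gram matrices *)

Section Places.
Variables (R : realType) (F : fieldExtType rat) (Phi : set (F -> R[i])).
Local Notation n := (\dim {:F}).
Hypothesis hPhi : infinite_primes Phi.
Variables (e : 'I_n -> {rmorphism F -> R[i]}) (t : F).
Hypothesis e_inj : injective (fun i => e i t).
Hypothesis e_surj : forall s : {rmorphism F -> R[i]}, exists i, s =1 e i.
Local Notation es j := (e j : F -> R[i]).

Lemma es_inj : injective (fun j => es j).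
Proof. by move=> i j /(congr1 (fun f => f t)); exact: e_inj. Qed.

Lemma embeddingsP s : embeddings s <-> exists j, s = es j.
Proof.
split=> [[r _ <-]|[j ->]]; last by exists (e j).
by have [j rj] := e_surj r; exists j; apply/funext.
Qed.

(** The list [e] contains every embedding once, so the places inject into its indices and the
    finitely supported sum becomes an ordinary one. *)
Lemma fsum_places (Q : set (F -> R[i])) (g : (F -> R[i]) -> R) :
  \sum_(s \in [set s : Phi | Q (val s)]) g (val s) =
  \sum_(j | `[< Phi (es j) >] && `[< Q (es j) >]) g (es j).
Proof.
have [PhiE _ _] := hPhi.
have ex (s : Phi) : exists j, val s = es j by apply/embeddingsP/PhiE; exact: set_valP.
have [h hE] := choice ex.
have bij : set_bij [set s : Phi | Q (val s)] [set j | Phi (es j) /\ Q (es j)] h.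
  split.
  - move=> s Qs /=; rewrite -hE; split => //; exact: set_valP.
  - by move=> s s' _ _ hs; apply: val_inj; rewrite !hE hs.
  - move=> j [Pj Qj]; exists (SigSub (mem_set Pj)) => //=.
    by apply: es_inj; rewrite /= -hE.
transitivity (\sum_(s \in [set s : Phi | Q (val s)]) g (es (h s))).
  by apply: eq_fsbigr => s _; rewrite hE.
rewrite -(reindex_fsbig h _ _ (fun j => g (es j)) bij).
rewrite (bigfs _ (r := index_enum 'I_n)) ?index_enum_uniq //; last first.
  by move=> j _; rewrite mem_index_enum.
congr (\sum_(j \in _) _); apply/seteqP; split=> j /=.
  by move=> [? ?]; apply/andP; split; apply/asboolP.
by move=> /andP[/asboolP ? /asboolP ?].
Qed.

Lemma conj_index_exists : exists c : 'I_n -> 'I_n,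
  involutive c /\ forall j, es (c j) = conj_embedding (es j).
Proof.
have ex j : exists k, conj_embedding (es j) = es k.
  apply/embeddingsP.
  by exists (((@conjc R : {rmorphism R[i] -> R[i]}) \o e j) : {rmorphism F -> R[i]}).
have [c cE] := choice ex; exists c; split=> // j.
apply: es_inj; rewrite /= -!cE; apply/funext => x.
by rewrite /conj_embedding conjcK.
Qed.

Lemma real_embeddingE (s : F -> R[i]) : real_embedding s <-> conj_embedding s = s.
Proof.
split=> [sr|sE x].
  by apply/funext => x; have := sr x; rewrite /conj_embedding; case: (s x) => a b /= ->; rewrite oppr0.
have : conj_embedding s x = s x by rewrite sE.
by rewrite /conj_embedding; case: (s x) => a b /= [] /eqP; rewrite -subr_eq0 -opprD oppr_eq0 -mulr2n mulrn_eq0 /= => /eqP.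
Qed.

Lemma real_embedding_conj (s : F -> R[i]) :
  real_embedding (conj_embedding s) <-> real_embedding s.
Proof.
have cc : conj_embedding (conj_embedding s) = s.
  by apply/funext => x; rewrite /conj_embedding conjcK.
split=> /real_embeddingE sE; apply/real_embeddingE; last by rewrite !sE.
by rewrite -[RHS]cc sE.
Qed.

(** The factor 2 at a nonreal place is split between the chosen embedding and its conjugate, which
    lies outside [Phi]. *)
Lemma sum_places (u : (F -> R[i]) -> R) : (forall s, u (conj_embedding s) = u s) ->
  \sum_(s \in [set s : Phi | real_embedding (val s)]) u (val s) +
  \sum_(s \in [set s : Phi | ~ real_embedding (val s)]) 2 * u (val s) =
  \sum_j u (es j).
Proof.
move=> uc; have [_ Phi_real Phi_nonreal] := hPhi.
have [c [cK cE]] := conj_index_exists.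
rewrite (fsum_places (@real_embedding R F)).
rewrite (fsum_places (fun s => ~ real_embedding s) (fun s => 2 * u s)).
rewrite [RHS](bigID (fun j => `[< real_embedding (es j) >])) /=; congr (_ + _).
  apply: eq_bigl => j; apply/andP/asboolP => [[_ /asboolP] //|rj].
  by split; apply/asboolP => //; apply: Phi_real => //; apply/embeddingsP; exists j.
rewrite [RHS](bigID (fun j => `[< Phi (es j) >])) /= -mulr_sumr.
have E1 : \sum_(j < n | ~~ `[< real_embedding (es j) >] && `[< Phi (es j) >]) u (es j) =
    \sum_(j < n | `[< Phi (es j) >] && `[< ~ real_embedding (es j) >]) u (es j).
  by apply: eq_bigl => j; rewrite andbC asbool_neg.
have E2 : \sum_(j < n | ~~ `[< real_embedding (es j) >] && ~~ `[< Phi (es j) >]) u (es j) =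
    \sum_(j < n | `[< Phi (es j) >] && `[< ~ real_embedding (es j) >]) u (es j).
  rewrite (reindex_inj (inv_inj cK)) /=; apply: eq_big => j; last by rewrite cE uc.
  rewrite -!asbool_neg cE.
  have nPhi_c : ~ real_embedding (es j) -> (Phi (es j) <-> ~ Phi (conj_embedding (es j))).
    by apply: Phi_nonreal; apply/embeddingsP; exists j.
  rewrite -!asbool_and; apply/asbool_equiv_eq.
  by have := real_embedding_conj (es j); tauto.
by rewrite E1 E2 mulr_natl mulr2n.
Qed.

End Places.

Section Gram.
Variables (R : realType) (F : fieldExtType rat).
Local Notation n := (\dim {:F}).
Variables (e : 'I_n -> {rmorphism F -> R[i]}) (t : F).
Hypothesis e_inj : injective (fun i => e i t).
Variables (c : 'I_n -> 'I_n).
Hypothesis cK : involutive c.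
Hypothesis cE : forall j x, e (c j) x = conjc (e j x).
Local Notation toC := (real_complex R).
Local Notation mxC := (map_mx toC).
Local Notation mxJ := (map_mx (@conjc R)).
Implicit Types (b : n.-tuple F) (W : 'I_n -> R) (x : 'rV[R]_n).

(** Real parts make the matrix real by construction; for conjugation-invariant weights [mxC_gram]
    shows that they change nothing. *)
Definition gram b W : 'M[R]_n :=
  \matrix_(i, k) \sum_j W j * complex.Re (e j b`_i * conjc (e j b`_k)).

Lemma mxC_gram b W : (forall j, W (c j) = W j) ->
  mxC (gram b W) = emb_mx e b *m diag_mx (\row_j (W j)%:C%C) *m (mxJ (emb_mx e b))^T.
Proof.
move=> Wc; apply/matrixP => i k; rewrite !mxE rmorph_sum /=.
under [RHS]eq_bigr => j _ do rewrite mul_mx_diag !mxE mulrAC.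
(* Twice the sum is the sum plus its reindexing by [c], whose terms are the complex conjugates. *)
apply/(mulIf (x := 2)); first by rewrite pnatr_eq0.
rewrite [RHS]mulr_natr [RHS]mulr2n [X in _ = _ + X](reindex_inj (inv_inj cK)) -big_split /=.
rewrite mulr_suml; apply: eq_bigr => j _; rewrite !cE Wc conjcK rmorphM /=.
case: (e j b`_i) => p q; case: (e j b`_k) => r s.
by apply/eqP; rewrite eq_complex /=; apply/andP; split; apply/eqP; ring.
Qed.

Lemma gram_tr b W : (gram b W)^T = gram b W.
Proof.
apply/matrixP => i k; rewrite !mxE; apply: eq_bigr => j _; congr (_ * _).
by case: (e j _) => p q; case: (e j _) => r s /=; ring.
Qed.

Lemma mxJ_mxC m p (A : 'M[R]_(m, p)) : mxJ (mxC A) = mxC A.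
Proof. by apply/matrixP => i k; rewrite !mxE /= oppr0. Qed.

Lemma qf_gram b W x : (forall j, W (c j) = W j) ->
  qf (gram b W) x = \sum_j W j * Normc.normc ((mxC x *m emb_mx e b) 0 j) ^+ 2.
Proof.
move=> Wc; apply: complexI.
have -> : (qf (gram b W) x)%:C%C = (mxC (x *m gram b W *m x^T)) 0 0 by rewrite mxE.
rewrite !map_mxM mxC_gram // !mulmxA -map_trmx.
rewrite -[X in _ *m X^T]mxJ_mxC -(mulmxA _ (mxJ _)^T) -trmx_mul -map_mxM.
move: (mxC x *m emb_mx e b) => w.
rewrite mxE rmorph_sum; apply: eq_bigr => j _; rewrite mul_mx_diag !mxE /=.
case: (w 0 j) => p q; apply/eqP; rewrite eq_complex /= sqr_sqrtr ?addr_ge0 ?sqr_ge0 //.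
by apply/andP; split; apply/eqP; ring.
Qed.

Lemma gram_posdef b W : basis_of {:F} b -> (forall j, W (c j) = W j) ->
  (forall j, 0 < W j) -> posdef (gram b W).
Proof.
move=> bb Wc W0; split=> [|x x0]; first exact: gram_tr.
have w0 : mxC x *m emb_mx e b != 0.
  apply: contra_neq x0 => /(congr1 (mulmx^~ (invmx (emb_mx e b)))).
  rewrite mul0mx mulmxK ?(emb_mx_unit e_inj) // => /matrixP xE.
  by apply/matrixP => i j; apply: complexI; have := xE i j; rewrite !mxE.
have [j wj] : exists j, (mxC x *m emb_mx e b) 0 j != 0.
  apply/existsP; apply: contra_neqT w0 => /existsPn wE.
  by apply/rowP => j; rewrite [RHS]mxE; apply/eqP; have := wE j; rewrite negbK.
rewrite qf_gram // (bigD1 j) //=; apply: ltr_pwDl.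
  apply: mulr_gt0 => //; rewrite exprn_gt0 // lt_def; apply/andP; split.
    by apply: contra_neq wj => /Normc.eq0_normc.
  by case: (_ 0 j) => p q; exact: sqrtr_ge0.
by apply: sumr_ge0 => k _; rewrite mulr_ge0 ?sqr_ge0 // ltW.
Qed.

(** The outer factors of [mxC_gram] contribute a determinant and its conjugate, and [disc b] is the
    square of that determinant. *)
Lemma gram_det b W : (forall j, W (c j) = W j) -> 
  \det (gram b W) = (\prod_j W j) * `|ratr (disc b)|.
Proof.
move=> Wc; apply: complexI; rewrite -[LHS]det_map_mx mxC_gram //.
rewrite !det_mulmx det_diag det_tr det_map_mx rmorphM rmorph_prod.
rewrite mulrAC [LHS]mulrC; congr (_ * _).
  by apply: eq_bigr => j _; rewrite mxE.
have dE : `|ratr (disc b)|%:C%C = `|ratr (disc b) : R[i]|.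
  rewrite -!ratr_norm; exact: fmorph_rat.
apply: etrans (esym dE); by rewrite (disc_emb e_inj) normrX normCK.
Qed.

(** Trace duality is the relation [V V'^T = 1] without conjugation, whereas Gram matrices involve
    [V^*]. Since [gram b'] is real it may be replaced by its conjugate, after which the inner
    factors cancel. *)
Lemma gram_dual b b' W : (forall j, W (c j) = W j) -> (forall j, W j != 0) ->
  (forall i j : 'I_n, field_trace (b`_i * b'`_j) = (i == j)%:R) ->
  gram b' (fun j => (W j)^-1) = invmx (gram b W).
Proof.
move=> Wc W0 dual.
have VV : emb_mx e b *m (emb_mx e b')^T = 1%:M.
  apply/matrixP => i k; rewrite !mxE.
  have := trace_emb e_inj (b`_i * b'`_k); rewrite dual => /esym E.
  have -> : (i == k)%:R = ratr (i == k)%:R :> R[i] by case: (i == k); rewrite ?rmorph1 ?rmorph0.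
  by rewrite -[RHS]E; apply: eq_bigr => j _; rewrite !mxE rmorphM.
have Wc' j : (W (c j))^-1 = (W j)^-1 by rewrite Wc.
have GG : gram b W *m gram b' (fun j => (W j)^-1) = 1%:M.
  apply: (@map_mx_inj _ _ toC); rewrite map_mxM map_mx1 mxC_gram //.
  rewrite -[mxC (gram b' _)]mxJ_mxC mxC_gram // !map_mxM -map_trmx.
  have JJ (A : 'M[R[i]]_n) : mxJ (mxJ A) = A.
    by apply/matrixP => i k; rewrite !mxE conjcK.
  have VJ : (mxJ (emb_mx e b))^T *m mxJ (emb_mx e b') = 1%:M.
    have := congr1 trmx (mulmx1C VV); rewrite trmx_mul trmxK trmx1 map_trmx -map_mxM => ->.
    exact: map_mx1.
  rewrite JJ !mulmxA -(mulmxA _ _ (mxJ (emb_mx e b'))) VJ mulmx1.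
  rewrite -(mulmxA _ (diag_mx _)).
  have -> : diag_mx (\row_j (W j)%:C%C) *m mxJ (diag_mx (\row_j ((W j)^-1)%:C%C)) = 1%:M.
    apply/matrixP => i k; rewrite mul_diag_mx !mxE /=; case: eqP => [->|_].
      by rewrite !mulr1n conjc_real -rmorphM mulfV.
    by rewrite !mulr0n rmorph0 mulr0.
  by rewrite mulmx1.
have /mulmx1_unit [Gu _] := GG.
by rewrite -[LHS](mulKmx Gu) GG mulmx1.
Qed.

End Gram.

(** * Weights of the embeddings attached to a divisor *)

Section Weights.
Variables (R : realType) (F : fieldExtType rat) (Phi : set (F -> R[i])).
Local Notation n := (\dim {:F}).
Hypothesis hPhi : infinite_primes Phi.
Implicit Type D : arakelov_divisor Phi.

(* x_s, extended to all embeddings by x_(conj s) = x_s and to other maps by 0. *)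
Definition inf_coeff D (s : F -> R[i]) : R :=
  match pselect (Phi s), pselect (Phi (conj_embedding s)) with
  | left Ps, _ => D.2 (SigSub (mem_set Ps))
  | _, left Ps => D.2 (SigSub (mem_set Ps))
  | _, _ => 0
  end.

Definition weight_exp D s : R :=
  - (if `[< real_embedding s >] then 2 else 1) * inf_coeff D s.

Definition weight D s : R := expR (weight_exp D s).

Lemma inf_coeff_val D (s : Phi) : inf_coeff D (val s) = D.2 s.
Proof.
rewrite /inf_coeff; case: pselect => [p|[]]; last exact: set_valP.
by congr (D.2 _); apply: val_inj.
Qed.

Lemma conj_embeddingK (s : F -> R[i]) : conj_embedding (conj_embedding s) = s.
Proof. by apply/funext => x; rewrite /conj_embedding conjcK. Qed.

Lemma inf_coeff_conj D s : inf_coeff D (conj_embedding s) = inf_coeff D s.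
Proof.
have [PhiE _ Phi_nonreal] := hPhi.
have [sr|snr] := pselect (real_embedding s).
  by move/real_embeddingE : sr => ->.
rewrite /inf_coeff; case: (pselect (Phi s)) => [p|np].
  have /(Phi_nonreal _ (PhiE _ p))[npc _] := snr.
  case: pselect => [/(npc p) //|_].
  case: pselect => [q|]; last by rewrite conj_embeddingK.
  by congr (D.2 _); apply: val_inj; rewrite /= conj_embeddingK.
case: pselect => [p|npc]; last by case: pselect => // q; case: np; rewrite -[s]conj_embeddingK.
by [].
Qed.

Lemma weight_exp_conj D s : weight_exp D (conj_embedding s) = weight_exp D s.
Proof.
by rewrite /weight_exp inf_coeff_conj (asbool_equiv_eq (real_embedding_conj s)).
Qed.

Lemma weight_canonical_sub D s :
  weight (canonical_divisor Phi - D) s = (weight D s)^-1.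
Proof.
have [_ K0] := canonical_divisorP Phi.
have KD p : (canonical_divisor Phi - D).2 p = - D.2 p.
  by rewrite -[RHS]add0r -(K0 p).
rewrite /weight -expRN /weight_exp; congr expR; rewrite -mulrN; congr (_ * _).
by rewrite /inf_coeff; do 2?case: pselect => *; rewrite ?KD ?oppr0.
Qed.

Variables (e : 'I_n -> {rmorphism F -> R[i]}) (t : F).
Hypothesis e_inj : injective (fun i => e i t).
Hypothesis e_surj : forall s : {rmorphism F -> R[i]}, exists i, s =1 e i.
Local Notation es j := (e j : F -> R[i]).

Lemma sqnormE D f :
  sqnorm D f = \sum_j weight D (es j) * Normc.normc (e j f) ^+ 2.
Proof.
rewrite -(sum_places hPhi e_inj e_surj (u := fun s => weight D s * Normc.normc (s f) ^+ 2)).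
  congr (_ + _); apply: eq_fsbigr => s /set_mem /= sr.
    by rewrite /weight /weight_exp inf_coeff_val asboolT // mulrC.
  by rewrite /weight /weight_exp inf_coeff_val asboolF // mulN1r -mulrA [_ ^+ 2 * _]mulrC.
move=> s; rewrite /weight weight_exp_conj; congr (_ * _ ^+ 2).
by rewrite /conj_embedding; case: (s f) => a b /=; rewrite sqrrN.
Qed.

(** A real place contributes [-2 x_s] once and a nonreal one [- x_s] twice, so all places count
    alike, as in [degree]. *)
Lemma sum_weight_exp D :
  \sum_j weight_exp D (es j) = - 2 * \sum_(s \in [set: Phi]) D.2 s.
Proof.
rewrite -(sum_places hPhi e_inj e_surj (weight_exp_conj D)).
have -> : \sum_(s \in [set: Phi]) D.2 s = \sum_(j | `[< Phi (es j) >]) inf_coeff D (es j).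
  transitivity (\sum_(s \in [set s : Phi | (fun=> True) (val s)]) inf_coeff D (val s)).
    by apply: eq_fsbigr => s _; rewrite inf_coeff_val.
  rewrite (fsum_places hPhi e_inj e_surj (fun=> True)).
  by apply: eq_bigl => j; rewrite (asboolT I) andbT.
rewrite (fsum_places hPhi e_inj e_surj (@real_embedding R F) (weight_exp D)).
rewrite (fsum_places hPhi e_inj e_surj (fun s => ~ real_embedding s) (fun s => 2 * weight_exp D s)).
rewrite [in RHS](bigID (fun j => `[< real_embedding (es j) >])) /= mulrDr !mulr_sumr.
congr (_ + _); apply: eq_big => [j|j /andP[_ /asboolP sr]]; rewrite ?asbool_neg //.
  by rewrite /weight_exp asboolT.
by rewrite /weight_exp asboolF // mulN1r mulrN mulNr.
Qed.

End Weights.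

(** * From the theta identity to Riemann-Roch *)

Lemma ln_exprz (R : realType) (x : R) (z : int) : 0 < x -> ln (x ^ z) = z%:~R * ln x.
Proof.
move=> x0; case: z => k; first by rewrite -exprnP lnXn // mulr_natl.
rewrite NegzE -exprnN lnV ?posrE ?exprn_gt0 // lnXn //.
by rewrite rmorphN mulNr mulr_natl.
Qed.

Lemma ln_prod (R : realType) (I : Type) (r : seq I) (f : I -> R) : (forall i, 0 < f i) ->
  ln (\prod_(i <- r) f i) = \sum_(i <- r) ln (f i).
Proof.
move=> f0; rewrite -[RHS]expRK expR_sum; congr ln.
by apply: eq_bigr => i _; rewrite lnK // posrE.
Qed.

Section RiemannRoch.
Variables (R : realType) (F : fieldExtType rat) (Phi : set (F -> R[i])).
Local Notation n := (\dim {:F}).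
Local Notation intv := (map_mx (intr : int -> R)).
Hypothesis hPhi : infinite_primes Phi.
Implicit Types (D : arakelov_divisor Phi) (b : n.-tuple F).

Lemma k0_has_sum D b (Q : 'rV[R]_n -> R) S : zbasis (ideal_of D) b ->
  (forall v, Q (intv v) = sqnorm D (lincomb b v)) ->
  has_sum (fun v : 'rV[int]_n => expR (- (pi * Q (intv v)))) S -> k0 D = S%:E.
Proof.
move=> bA QE QS.
have bij : set_bij [set: 'rV[int]_n] (ideal_of D) (lincomb b).
  split=> [v _|v w _ _|x]; first by apply/(zbasisP _ bA); exists v.
    exact: lincomb_inj bA.1 _ _.
  by move=> /(zbasisP _ bA)[v ->]; exists v.
rewrite /k0 (reindex_esum _ _ _ _ bij) -(has_sum_esum _ QS); last by move=> v; exact: expR_ge0.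
by apply: eq_esum => v _; rewrite QE mulNr.
Qed.

Variables (e : 'I_n -> {rmorphism F -> R[i]}) (t : F).
Hypothesis e_inj : injective (fun i => e i t).
Hypothesis e_surj : forall s : {rmorphism F -> R[i]}, exists i, s =1 e i.
Local Notation es j := (e j : F -> R[i]).
Variables (c : 'I_n -> 'I_n).
Hypothesis cK : involutive c.
Hypothesis cE : forall j x, e (c j) x = conjc (e j x).

Lemma weight_conj_index D j : weight D (es (c j)) = weight D (es j).
Proof.
rewrite /weight -(weight_exp_conj hPhi); congr (expR (weight_exp D _)).
by apply/funext => x; rewrite /conj_embedding cE conjcK.
Qed.

Lemma qf_gram_sqnorm D b v :
  qf (gram e b (fun j => weight D (es j))) (intv v) = sqnorm D (lincomb b v).
Proof.
rewrite (qf_gram cK cE); last exact: weight_conj_index.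
rewrite (sqnormE hPhi e_inj e_surj); apply: eq_bigr => j _; congr (_ * Normc.normc _ ^+ 2).
rewrite mxE rmorph_sum; apply: eq_bigr => i _; rewrite !mxE [RHS]rmorphMz.
by rewrite -[RHS]mulrzl; congr (_ * _); exact: rmorph_int.
Qed.

(** The degree enters here: its finite part comes from the discriminant of the ideal, its infinite
    part from the product of the weights. *)
Lemma ln_gram_det D b :
  disc b = \prod_(P <- dom D.1) (residue_card (val P))%:R ^ (2 * - coeff P D.1)
           * discriminant F ->
  ln (\det (gram e b (fun j => weight D (es j)))) =
  - 2 * degree D + ln `|ratr (discriminant F)|.
Proof.
move=> bE.
have d0 : 0 < `|ratr (discriminant F)| :> R.
  by rewrite normr_gt0 fmorph_eq0 discriminant_neq0.
have card0 (P : prime_ideals F) : 0 < (residue_card (val P))%:R :> R by rewrite ltr0n residue_card_gt0.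
have p0 : 0 < \prod_(P <- dom D.1) (residue_card (val P))%:R ^ (2 * - coeff P D.1) :> R.
  by apply: prodr_gt0 => P _; rewrite exprz_gt0.
rewrite (gram_det e_inj cK cE) => [|j]; last exact: weight_conj_index.
rewrite bE rmorphM normrM rmorph_prod.
have -> : `|\prod_(P <- dom D.1) (ratr ((residue_card (val P))%:R ^ (2 * - coeff P D.1)))| =
   \prod_(P <- dom D.1) (residue_card (val P))%:R ^ (2 * - coeff P D.1) :> R.
  rewrite -[RHS]ger0_norm ?ltW //; congr `|_|; apply: eq_bigr => P _.
  by rewrite fmorphXz; congr (_ ^ _); exact: ratr_nat.
have W0 : 0 < \prod_j weight D (es j) by apply: prodr_gt0 => j _; exact: expR_gt0.
rewrite !lnM ?posrE ?mulr_gt0 //.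
rewrite addrA; congr (_ + _); rewrite -expR_sum expRK (sum_weight_exp hPhi e_inj e_surj).
rewrite ln_prod => [|P]; last by rewrite exprz_gt0.
rewrite /degree mulrDr addrC; congr (_ + _); rewrite mulr_sumr; apply: eq_bigr => P _.
by rewrite ln_exprz // mulrN rmorphN rmorphM; ring.
Qed.

End RiemannRoch.

Theorem proposition1 (R : realType) (F : fieldExtType rat)
    (Phi : set (F -> R[i])) (hPhi : infinite_primes Phi)
    (D : arakelov_divisor Phi) :
  (h0 D - h0 (canonical_divisor Phi - D)%R)%E
    = (degree D - 2^-1 * ln `|ratr (discriminant F)|)%:E.
Proof.
have [e [t [e_inj e_surj]]] := embeddings_exist F R[i].
have [c [cK cE0]] := conj_index_exists e_inj e_surj.
have cE j x : e (c j) x = conjc (e j x) by rewrite -[LHS]/((e (c j) : F -> R[i]) x) cE0.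
have [b [b' [bA bA' dual bE]]] := dual_bases D.
pose W j := weight D (e j : F -> R[i]).
have Wc j : W (c j) = W j by rewrite /W /weight cE0 weight_exp_conj.
have W0 j : 0 < W j := expR_gt0 _.
have Wn0 j : W j != 0 by rewrite gt_eqF.
have [d0 _ _ theta] := theta_posdef (gram_posdef e_inj cK cE bA.1 Wc W0).
have [S [T [HS HT ST]]] := theta 0 0.
have {}HS : has_sum (fun v : 'rV[int]_(\dim {:F}) => expR (- (pi * qf (gram e b W) (map_mx intr v)))) S.
  apply: eq_has_sum HS => v; rewrite /dot mul0mx mxE mulr0 addr0 cos0 mulr1 //.
have {}HT : has_sum (fun v : 'rV[int]_(\dim {:F}) =>
    expR (- (pi * qf (gram e b' (fun j => (W j)^-1)) (map_mx intr v)))) T.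
  by apply: eq_has_sum HT => v; rewrite addr0 (gram_dual e_inj cK cE Wc Wn0 dual).
have kS := k0_has_sum bA (qf_gram_sqnorm hPhi e_inj e_surj cK cE D b) HS.
have kT : k0 (canonical_divisor Phi - D) = T%:E.
  apply: (k0_has_sum bA') HT => v.
  rewrite -(qf_gram_sqnorm hPhi e_inj e_surj cK cE); congr qf.
  by congr gram; apply/funext => j; rewrite weight_canonical_sub.
have S0 : 0 < S.
  apply: lt_le_trans (has_sum_ge_term 0 _ HS) => [|v]; [exact: expR_gt0|exact: expR_ge0].
have T0 : 0 < T.
  apply: lt_le_trans (has_sum_ge_term 0 _ HT) => [|v]; [exact: expR_gt0|exact: expR_ge0].
rewrite cos0 mulr1 in ST.
(* Squaring removes the square root, so the identity reads [ln (det G) + 2 ln S = 2 ln T]. *)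
have := congr1 (fun x => ln (x ^+ 2)) ST.
rewrite exprMn sqr_sqrtr ?ltW // lnM ?posrE ?exprn_gt0 // !lnXn //.
rewrite (ln_gram_det hPhi e_inj e_surj cK cE bE).
rewrite /h0 kS kT !lne_EFin // -EFinB => E; congr EFin.
lra.
Qed.
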